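(* Let $\mu\leq_{c}\nu$ be finite measures on $\mathbb{R}$ with finite first moments in convex order, and let $B\subseteq\mathbb{R}^{2}$ be a Borel set. Then $B$ is $\mathcal{M}(\mu,\nu)$-polar if and only if there exist a $\mu$-nullset $N_{\mu}$ and a $\nu$-nullset $N_{\nu}$ such that $$B\subseteq(N_{\mu}\times\mathbb{R})\cup(\mathbb{R}\times N_{\nu})\cup\Big(\Delta\cup\bigcup_{k\ge1}I_{k}\times J_{k}\Big)^{c},$$ where $\Delta=\{(x,x)\in\mathbb{R}^{2}:x\in\mathbb{R}\}$ is the diagonal and $(I_{k},J_{k})_{k\ge1}$ are the domains of the irreducible components of $(\mu,\nu)$.
   Context: For finite measures $\mu,\nu$ on $\mathbb{R}$ with finite first moment, $\mu\leq_{c}\nu$ means $\int\phi\,d\mu\le\int\phi\,d\nu$ for all convex $\phi:\mathbb{R}\to\mathbb{R}$ (so $\mu,\nu$ have the same mass and barycenter). $\mathcal{M}(\mu,\nu)$ is the set of measures $P$ on $\mathbb{R}^{2}$ with marginals $\mu$ and $\nu$ under which $(X,Y)$ (the identity map on $\mathbb{R}^{2}$) is a martingale: in a disintegration $P=\mu\otimes\kappa$ one has $\int y\,\kappa(x,dy)=x$ for $\mu$-a.e. $x$. A set is $\mathcal{M}(\mu,\nu)$-polar if it is $P$-null for every $P\in\mathcal{M}(\mu,\nu)$. Let $u_{\mu}(x)=\int|t-x|\,\mu(dt)$. A pair $\mu\leq_{c}\nu$ is irreducible if $I=\{u_{\mu}<u_{\nu}\}$ is connected and $\mu(I)=\mu(\mathbb{R})$;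 its domain is $(I,J)$, where $J$ is the union of $I$ and those endpoints of $I$ that are atoms of $\nu$. For general $\mu\leq_{c}\nu$, let $(I_{k})_{1\le k\le N}$, $N\in\{0,1,\dots,\infty\}$, be the (open) connected components of $\{u_{\mu}<u_{\nu}\}$, $I_{0}=\mathbb{R}\setminus\bigcup_{k\ge1}I_{k}$, and $\mu_{k}=\mu|_{I_{k}}$ for $k\ge0$. There is a unique decomposition $\nu=\sum_{k\ge0}\nu_{k}$ with $\nu_{0}=\mu_{0}$ and $\mu_{k}\leq_{c}\nu_{k}$ for $k\ge1$. For $k\ge1$ the pair $(\mu_{k},\nu_{k})$ is irreducible with $\{u_{\mu_k}<u_{\nu_k}\}=I_{k}$, and its domain is denoted $(I_{k},J_{k})$; that is, $J_{k}$ is the union of $I_{k}$ and the endpoints of $I_{k}$ that are atoms of $\nu_{k}$. *)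

(* Defs.v *)
From HB Require Import structures.
From mathcomp Require Import all_boot all_order all_algebra.
From mathcomp Require Import all_classical all_reals all_analysis.
From mathcomp Require Import measurable_realfun.
Set Implicit Arguments.
Unset Strict Implicit.
Unset Printing Implicit Defensive.
Import Order.TTheory GRing.Theory Num.Theory.
Import numFieldNormedType.Exports.
Local Open Scope classical_set_scope.
Local Open Scope ring_scope.
Local Open Scope ereal_scope.

Notation fmeasR R := {finite_measure set (measurableTypeR R) -> \bar R}.

Definition finite_first_moment (R : realType) (mu : fmeasR R) : Prop :=
  mu.-integrable [set: R] (fun x => x%:E).

(* Under [finite_first_moment] the negative part of a convex function is
   integrable (it has an affine minorant), so both integrals are the usual ones,
   with values in ]-oo, +oo]. *)
Definition convex_order (R : realType) (mu nu : fmeasR R) : Prop :=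
  forall phi : R -> R, convex_function [set: R^o] phi ->
    \int[mu]_x (phi x)%:E <= \int[nu]_x (phi x)%:E.

(* P = mu \otimes k *)
Definition disintegration (R : realType) (mu : fmeasR R)
    (P : {measure set (measurableTypeR R * measurableTypeR R) -> \bar R})
    (k : R.-pker (measurableTypeR R) ~> (measurableTypeR R)) : Prop :=
  forall A, measurable A -> P A = \int[mu]_x k x (xsection A x).

(* In MathComp-Analysis, [\int f] is [\int f^\+ - \int f^\-] with [+oo - +oo]
   equal to [-oo]; hence [\int[k x]_y y%:E = x%:E] entails that the identity is
   integrable with respect to [k x]. *)
Definition martingale_measure (R : realType) (mu nu : fmeasR R)
    (P : {measure set (measurableTypeR R * measurableTypeR R) -> \bar R})
    : Prop :=
  [/\ forall A, measurable A -> pushforward P fst A = mu A,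
      forall A, measurable A -> pushforward P snd A = nu A &
      exists2 k : R.-pker (measurableTypeR R) ~> (measurableTypeR R),
        disintegration mu P k &
        {ae mu, forall x, \int[k x]_y y%:E = x%:E}].

Definition polar (R : realType) (mu nu : fmeasR R)
    (B : set (measurableTypeR R * measurableTypeR R)) : Prop :=
  forall P, martingale_measure mu nu P -> P.-negligible B.

Definition potential (R : realType) (mu : fmeasR R) (x : R) : \bar R :=
  \int[mu]_t `|t - x|%:E.

Definition components (R : realType) (U : set R) : set (set R) :=
  [set connected_component U x | x in U].

Lemma measurable_components (R : realType) (U I : set R) :
  components U I -> measurable (I : set (measurableTypeR R)).
Proof.
move=> [x _ <-]; apply: is_interval_measurable.
by apply/connected_intervalP; exact: component_connected.
Qed.

(* The components I_k, k >= 1, are indexed by themselves. *)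
Definition irr_comp (R : realType) (mu nu : fmeasR R) : set (set R) :=
  components [set x | potential mu x < potential nu x].

(* nu = nu_0 + \sum_(k >= 1) nu_k, where nu_0 = mu_0 is the restriction of mu to
   I_0 = ~` \bigcup_(k >= 1) I_k, and mu_k <=_c nu_k for k >= 1; the values of
   [nu_] outside of [irr_comp mu nu] play no role. *)
Definition irr_decomposition (R : realType) (mu nu : fmeasR R)
    (nu_ : set R -> fmeasR R) : Prop :=
  [/\ forall A : set (measurableTypeR R), measurable A ->
        nu A = mu (A `&` ~` \bigcup_(I in irr_comp mu nu) I) +
               \esum_(I in irr_comp mu nu) nu_ I A,
      forall I, irr_comp mu nu I -> finite_first_moment (nu_ I) &
      forall I (cI : irr_comp mu nu I),
        convex_order (mrestr mu (measurable_components cI)) (nu_ I)].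

(* Definite description of the family (nu_k): for mu <=_c nu with finite first
   moments, [irr_decomposition mu nu] determines it uniquely on the components.
   The zero branch is only a default value. *)
Definition irr_nu (R : realType) (mu nu : fmeasR R) : set R -> fmeasR R :=
  if pselect (exists nu_, irr_decomposition mu nu nu_) is left ex
  then sval (cid ex) else fun=> mzero.

Definition endpoints (R : realType) (I : set R) : set R :=
  [set e | has_lbound I /\ e = inf I] `|` [set e | has_ubound I /\ e = sup I].

Definition irr_J (R : realType) (mu nu : fmeasR R) (I : set R) : set R :=
  I `|` [set e | endpoints I e /\ 0 < irr_nu mu nu I [set e]].

(* Main.v *)
Require Import Defs.
From HB Require Import structures.
From mathcomp Require Import all_boot all_order all_algebra.
From mathcomp Require Import all_classical all_reals all_analysis.
From mathcomp Require Import measurable_realfun ring lra.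
Set Implicit Arguments.
Unset Strict Implicit.
Unset Printing Implicit Defensive.
Import Order.TTheory GRing.Theory Num.Theory.
Import numFieldNormedType.Exports.
Local Open Scope classical_set_scope.
Local Open Scope ring_scope.

(** * Covers by rectangles with one full side *)

Section fine_measure.
Context d (T : measurableType d) (R : realType).
Variable mu : {finite_measure set T -> \bar R}.

Lemma fine_measureK (A : set T) : measurable A -> (fine (mu A))%:E = mu A.
Proof. by move=> mA; rewrite fineK// fin_num_measure. Qed.

Lemma fine_measure_ge0 (A : set T) : 0 <= fine (mu A).
Proof. by rewrite fine_ge0. Qed.

Lemma le_fine_measure (A B : set T) : measurable A -> measurable B ->
  A `<=` B -> fine (mu A) <= fine (mu B).
Proof.
by move=> mA mB AB; rewrite -lee_fin !fine_measureK// le_measure ?inE.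
Qed.

Lemma fine_measureUI (A B : set T) : measurable A -> measurable B ->
  fine (mu (A `|` B)) + fine (mu (A `&` B)) = fine (mu A) + fine (mu B).
Proof.
move=> mA mB; rewrite measureUfinl//; last first.
  by rewrite -ge0_fin_numE// fin_num_measure.
have mAB : measurable (A `&` B) by exact: measurableI.
rewrite fineB ?fin_numD ?fin_num_measure// fineD ?fin_num_measure//.
by rewrite subrK.
Qed.

Lemma fine_measure_bigcup_le (F : (set T)^nat) (c : R) :
  (forall n, measurable (F n)) -> nondecreasing_seq F ->
  (forall n, fine (mu (F n)) <= c) -> fine (mu (\bigcup_n F n)) <= c.
Proof.
move=> mF ndF Fc.
have mU : measurable (\bigcup_n F n) by exact: bigcup_measurable.
rewrite -lee_fin fine_measureK//.
have cv := nondecreasing_cvg_mu (mu := mu) mF mU ndF.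
rewrite -(cvg_lim _ cv)//; apply: lime_le; first by apply/cvg_ex; eexists; exact: cv.
by apply: nearW => n /=; rewrite -fine_measureK// lee_fin.
Qed.

End fine_measure.

Section cover_capacity.
Context d1 d2 (X : measurableType d1) (Y : measurableType d2) (R : realType).
Variables (mu : {finite_measure set X -> \bar R})
  (nu : {finite_measure set Y -> \bar R}).

Definition covers (M : set X) (N : set Y) (A : set (X * Y)) : Prop :=
  forall z, A z -> M z.1 \/ N z.2.

Definition cover_cost (M : set X) (N : set Y) : R :=
  fine (mu M) + fine (nu N).

Definition cover_costs (A : set (X * Y)) : set R :=
  [set r | exists M N, [/\ measurable M, measurable N, covers M N A &
                           r = cover_cost M N]].

Definition cover_cap (A : set (X * Y)) : R := inf (cover_costs A).

Lemma cover_cost_ge0 M N : 0 <= cover_cost M N.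
Proof. by rewrite addr_ge0 ?fine_measure_ge0. Qed.

Lemma cover_costs_neq0 A : cover_costs A !=set0.
Proof.
by exists (cover_cost setT set0), setT, set0; split => //= z _; left.
Qed.

Lemma cover_costs_lb A : lbound (cover_costs A) 0.
Proof. by move=> _ [M [N [_ _ _ ->]]]; exact: cover_cost_ge0. Qed.

Lemma cover_cap_le A M N : measurable M -> measurable N -> covers M N A ->
  cover_cap A <= cover_cost M N.
Proof.
move=> mM mN MNA; apply: ge_inf; first by exists 0; exact: cover_costs_lb.
by exists M, N.
Qed.

Lemma cover_cap_adherent A e : 0 < e -> exists M N,
  [/\ measurable M, measurable N, covers M N A &
      cover_cost M N < cover_cap A + e].
Proof.
move=> e0; have hi : has_inf (cover_costs A).
  by split; [exact: cover_costs_neq0|exists 0; exact: cover_costs_lb].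
by have [_ [M [N [mM mN MNA ->]]] lt] := inf_adherent e0 hi; exists M, N.
Qed.

Lemma le_cover_cap A B : A `<=` B -> cover_cap A <= cover_cap B.
Proof.
move=> AB; apply: lb_le_inf; first exact: cover_costs_neq0.
move=> _ [M [N [mM mN MNB ->]]]; apply: cover_cap_le => // z /AB; exact: MNB.
Qed.

Section increasing.
Variables (A : nat -> set (X * Y)) (L : R).
Hypothesis ndA : nondecreasing_seq A.
Hypothesis AL : forall n, cover_cap (A n) <= L.
Variables (M : nat -> set X) (N : nat -> set Y).
Hypotheses (mM : forall n, measurable (M n)) (mN : forall n, measurable (N n)).
Hypothesis MNA : forall n, covers (M n) (N n) (A n).
Hypothesis MNcost : forall n,
  cover_cost (M n) (N n) <= cover_cap (A n) + 2^-1 ^+ n.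

Fixpoint capM n d : set X := if d is d'.+1 then M n `&` capM n.+1 d' else M n.
Fixpoint cupN n d : set Y := if d is d'.+1 then N n `|` cupN n.+1 d' else N n.

Let mcapM n d : measurable (capM n d).
Proof. by elim: d n => [|d IH] n //=; exact: measurableI. Qed.

Let mcupN n d : measurable (cupN n d).
Proof. by elim: d n => [|d IH] n //=; exact: measurableU. Qed.

Let cover_capM n d : covers (capM n d) (cupN n d) (A n).
Proof.
elim: d n => [|d IH] n /=; first exact: MNA.
move=> z Az; have [Mz|Nz] := MNA Az; last by right; left.
have [|Mz'|Nz'] := IH n.+1 z; last by right; right.
- by have /subsetPset := ndA (leqnSn n); exact.
- by left.
Qed.

(** The two mixed pairs, (intersection, union) and (union, intersection), both
    cover the smaller set; by modularity their costs add up to the sum of the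
    original costs, and the second is at least the capacity of the smaller set.
    So the first costs at most the larger set's cover, up to the error made for
    the smaller set. Working downwards from [n + d] to [n], these errors sum to
    less than [2 * 2^-n]. *)
Lemma cost_capM n d :
  cover_cost (capM n d) (cupN n d) <= L + 2 * 2^-1 ^+ n.
Proof.
elim: d n => [|d IH] n /=.
  have := MNcost n; have := AL n; have : 0 <= 2^-1 ^+ n :> R by rewrite exprn_ge0.
  by lra.
have c : cover_cap (A n) <=
    cover_cost (M n `|` capM n.+1 d) (N n `&` cupN n.+1 d).
  apply: cover_cap_le; [exact: measurableU|exact: measurableI|].
  move=> z Az; have [Mz|Nz] := MNA Az; first by left; left.
  have [|Mz'|Nz'] := @cover_capM n.+1 d z.
  - by have /subsetPset := ndA (leqnSn n); exact.
  - by left; right.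
  - by right.
have := IH n.+1; rewrite exprS mulrA mulfV// mul1r => IHn.
have hM := fine_measureUI mu (mM n) (mcapM n.+1 d).
have hN := fine_measureUI nu (mN n) (mcupN n.+1 d).
have := MNcost n; rewrite /cover_cost in c IHn *; lra.
Qed.

Let MI n := \bigcap_k M (n + k)%N.
Let NU n := \bigcup_k N (n + k)%N.

Let cost_MI n : cover_cost (MI n) (NU n) <= L + 2 * 2^-1 ^+ n.
Proof.
have -> : NU n = \bigcup_d cupN n d.
  rewrite /NU; apply/seteqP; split=> y [k _].
    move=> Nk; exists k => //; elim: k n Nk => [|k IH] n; first by rewrite addn0.
    by rewrite addnS -addSn => /IH Nk; right.
  elim: k n => [|k IH] n /= ; first by exists 0%N => //; rewrite addn0.
  by move=> [Nn|/IH[j _]]; [exists 0%N; rewrite ?addn0|exists j.+1; rewrite ?addnS].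
have mMI : measurable (MI n) by apply: bigcap_measurable => //; exists 0%N.
rewrite /cover_cost addrC -lerBrDr; apply: fine_measure_bigcup_le => //.
  apply/nondecreasing_seqP => d; apply/subsetPset; clear mMI.
  elim: d n => [|d IH] n /=; first by left.
  by move=> y [Ny|/IH]; [left|right].
move=> d; have := cost_capM n d.
have : fine (mu (MI n)) <= fine (mu (capM n d)).
  apply: le_fine_measure => // x MIx; clear mMI.
  have : forall k, M (n + k)%N x by move=> k; exact: MIx.
  clear MIx; elim: d n => [|d IH] n Mx /=; first by have := Mx 0%N; rewrite addn0.
  split; first by have := Mx 0%N; rewrite addn0.
  by apply: IH => k; rewrite addSn -addnS.
by rewrite /cover_cost; lra.
Qed.

Lemma cover_bigcup_liminf_limsup :
  let M' := \bigcup_n MI n in let N' := \bigcap_n NU n in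
  [/\ measurable M', measurable N', covers M' N' (\bigcup_n A n) &
      cover_cost M' N' <= L].
Proof.
have mMI n : measurable (MI n) by apply: bigcap_measurable => //; exists 0%N.
have mNU n : measurable (NU n) by exact: bigcup_measurable.
have mN' : measurable (\bigcap_n NU n) by apply: bigcap_measurable => //; exists 0%N.
have ndMI : nondecreasing_seq MI.
  apply/nondecreasing_seqP => n; apply/subsetPset => x Mx k _.
  by rewrite addSn -addnS; exact: Mx.
split => //; first exact: bigcup_measurable.
- move=> z [n _ Az].
  have [[m Mm]|noM] := pselect (exists m, MI m z.1); first by left; exists m.
  right => m _.
  have [k Mk] : exists k, ~ M (maxn n m + k)%N z.1.
    by apply/not_existsP => H; apply: noM; exists (maxn n m) => k _; apply: contrapT.
  have [|//|Nk] := @MNA (maxn n m + k)%N z.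
    have /subsetPset := ndA (leq_trans (leq_maxl n m) (leq_addr k _)); exact.
  exists (maxn n m - m + k)%N => //.
  by rewrite addnA subnKC// leq_maxr.
- rewrite /cover_cost -lerBrDr; apply: fine_measure_bigcup_le => // n.
  rewrite lerBrDr; apply/ler_addgt0Pl => e e0.
  have [m _ mP] : \forall m \near \oo, 2 * 2^-1 ^+ m <= e :> R.
    have : 2 * 2^-1 ^+ m @[m --> \oo] --> (2 * 0 : R).
      apply: cvgM; first exact: cvg_cst.
      by apply: cvg_expr; rewrite ger0_norm ?invr_ge0// invf_lt1// ltr1n.
    by rewrite mulr0 => /cvgr0Pnorm_le /(_ _ e0); apply: filterS => k;
       apply: le_trans; rewrite ler_norm.
  have := cost_MI (maxn n m); rewrite /cover_cost.
  have : fine (mu (MI n)) <= fine (mu (MI (maxn n m))).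
    by apply: le_fine_measure => //; apply/subsetPset/ndMI/leq_maxl.
  have : fine (nu (\bigcap_n0 NU n0)) <= fine (nu (NU (maxn n m))).
    by apply: le_fine_measure => // y; apply.
  by have := mP _ (leq_maxr n m); rewrite /=; lra.
Qed.

End increasing.

Lemma cover_bigcup (A : nat -> set (X * Y)) (L : R) : nondecreasing_seq A ->
  (forall n, cover_cap (A n) <= L) -> exists M N,
  [/\ measurable M, measurable N, covers M N (\bigcup_n A n) &
      cover_cost M N <= L].
Proof.
move=> ndA AL.
have /choice[MN MNP] n : exists MN : set X * set Y,
    [/\ measurable MN.1, measurable MN.2, covers MN.1 MN.2 (A n) &
     cover_cost MN.1 MN.2 <= cover_cap (A n) + 2^-1 ^+ n].
  have e0 : 0 < 2^-1 ^+ n :> R by rewrite exprn_gt0// invr_gt0.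
  have [M [N [mM mN c lt]]] := cover_cap_adherent (A n) e0.
  by exists (M, N); split => //; exact: ltW.
do 2 eexists; apply: (@cover_bigcup_liminf_limsup A L ndA AL
  (fst \o MN) (snd \o MN)) => n /=; by have [] := MNP n.
Qed.

Lemma cover_cap_attained A : exists M N,
  [/\ measurable M, measurable N, covers M N A & cover_cost M N <= cover_cap A].
Proof.
have [//|//|M [N [mM mN c le]]] := @cover_bigcup (fun=> A) (cover_cap A).
by exists M, N; split => // z Az; apply: c; exists 0%N.
Qed.

End cover_capacity.

(** * Suslin sets over measurable rectangles *)

Section ultrafilter_nat.
Variable U : set_system nat.
Hypothesis UU : UltraFilter U.

Lemma ultra_pigeonhole (f : nat -> nat) m :
  U [set n | f n <= m]%N -> exists v, U [set n | f n = v].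
Proof.
have UF : ProperFilter U by case: UU.
elim: m => [|m IH] Um.
  by exists 0%N; apply: filterS Um => n /=; rewrite leqn0 => /eqP.
have [Uv|Uv] := @in_ultra_setVsetC _ U [set n | f n = m.+1] UU; first by exists m.+1.
apply: IH; apply: filterS (filterI Um Uv) => n /= [].
by rewrite leq_eqVlt ltnS => /orP[/eqP|].
Qed.

End ultrafilter_nat.

Section suslin.
Context d1 d2 (X : measurableType d1) (Y : measurableType d2).
Implicit Types A B K : set (X * Y).

Definition rect_closed K : Prop := exists (A : nat -> set X) (B : nat -> set Y),
  [/\ forall n, measurable (A n), forall n, measurable (B n) &
      ~` K = \bigcup_n (A n `*` B n)].

Lemma rect_closedC (M : set X) (N : set Y) : measurable M -> measurable N ->
  rect_closed (~` (M `*` N)).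
Proof.
move=> mM mN; exists (fun=> M), (fun=> N); split => //.
by rewrite setCK; apply/seteqP; split => [z Mz|z [_ _]//]; exists 0%N.
Qed.

Lemma rect_closed_bigcap (K : nat -> set (X * Y)) :
  (forall n, rect_closed (K n)) -> rect_closed (\bigcap_n K n).
Proof.
move=> /choice[A] /choice[B] AB.
exists (fun k => if unpickle k is Some (i, j) then A i j else set0),
  (fun k => if unpickle k is Some (i, j) then B i j else set0); split.
- by move=> k; case: unpickle => // -[i j]; case: (AB i).
- by move=> k; case: unpickle => // -[i j]; case: (AB i).
- rewrite setC_bigcap; apply/seteqP; split => z [i _].
    case: (AB i) => _ _ -> [j _ ABz]; exists (pickle (i, j)) => //.
    by rewrite pickleK.
  case: unpickle => [[k j]|[]//] ABz; exists k => //.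
  by case: (AB k) => _ _ ->; exists j.
Qed.

Lemma rect_closedI K1 K2 :
  rect_closed K1 -> rect_closed K2 -> rect_closed (K1 `&` K2).
Proof.
move=> c1 c2.
rewrite (_ : _ `&` _ = \bigcap_n (if n is 0%N then K1 else K2)).
  by apply: rect_closed_bigcap => -[].
apply/seteqP; split => [z [K1z K2z] [|n] _//|z Kz].
by split; [exact: (Kz 0%N)|exact: (Kz 1%N)].
Qed.

Lemma rect_closedT : rect_closed setT.
Proof.
by exists (fun=> set0), (fun=> set0); split => //; rewrite setCT bigcup0// => n _;
   rewrite set0X.
Qed.

Lemma rect_closed0 : rect_closed set0.
Proof. by rewrite -[set0]setCK setC0 -setXTT; exact: rect_closedC. Qed.

Lemma rect_closedX (M : set X) (N : set Y) : measurable M -> measurable N ->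
  rect_closed (M `*` N).
Proof.
move=> mM mN; rewrite (_ : _ `*` _ =
  ~` (~` M `*` setT) `&` ~` (setT `*` ~` N)).
  by apply: rect_closedI; apply: rect_closedC => //; exact: measurableC.
apply/seteqP; split => z /=; first by tauto.
by move=> [h1 h2]; split; apply: contrapT => h; [apply: h1|apply: h2].
Qed.

Lemma rect_closedU K1 K2 :
  rect_closed K1 -> rect_closed K2 -> rect_closed (K1 `|` K2).
Proof.
move=> [A1 [B1 [mA1 mB1 e1]]] [A2 [B2 [mA2 mB2 e2]]].
exists (fun k => if unpickle k is Some (i, j) then A1 i `&` A2 j else set0),
  (fun k => if unpickle k is Some (i, j) then B1 i `&` B2 j else set0); split.
- by move=> k; case: unpickle => // -[i j]; exact: measurableI.
- by move=> k; case: unpickle => // -[i j]; exact: measurableI.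
- rewrite setCU e1 e2; apply/seteqP; split => z.
    move=> [[i _ [? ?]] [j _ [? ?]]]; exists (pickle (i, j)) => //.
    by rewrite pickleK.
  move=> [k _]; case: unpickle => [[i j]|[]//] [[? ?] [? ?]].
  by split; [exists i|exists j].
Qed.

Lemma rect_closed_bigcup_le (K : nat -> set (X * Y)) m :
  (forall n, rect_closed (K n)) ->
  rect_closed [set z | exists2 i, (i <= m)%N & K i z].
Proof.
move=> cK; elim: m => [|m IH].
  rewrite (_ : mkset _ = K 0%N)//; apply/seteqP; split => [z [i]|z Kz].
    by rewrite leqn0 => /eqP ->.
  by exists 0%N.
rewrite (_ : mkset _ = [set z | exists2 i, (i <= m)%N & K i z] `|` K m.+1).
  exact: rect_closedU.
apply/seteqP; split => [z [i]|z [[i im Kz]|Kz]].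
- by rewrite leq_eqVlt ltnS => /orP[/eqP-> ?|? ?]; [right|left; exists i].
- by exists i => //; exact: leqW.
- by exists m.+1.
Qed.

Definition suslin A : Prop := exists F : seq nat -> set (X * Y),
  (forall s, rect_closed (F s)) /\
  A = [set z | exists g : nat -> nat, forall n, F (mkseq g n) z].

Lemma rect_closed_suslin K : rect_closed K -> suslin K.
Proof.
move=> cK; exists (fun=> K); split => //; apply/seteqP; split => [z Kz|z [g]].
  by exists id.
by apply; exact: 0%N.
Qed.

Lemma suslin_bigcup (A : nat -> set (X * Y)) :
  (forall n, suslin (A n)) -> suslin (\bigcup_n A n).
Proof.
move=> /choice[F FP].
exists (fun s => if s is i :: s' then F i s' else setT); split.
  by case=> [|i s']; [exact: rect_closedT|case: (FP i)].
have mkS (g : nat -> nat) n : mkseq g n.+1 = g 0%N :: mkseq (g \o S) n.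
  by rewrite /mkseq /= -add1n iotaDl -map_comp.
apply/seteqP; split => [z [i _]|z [g gP]].
  have [_ ->] := FP i; move=> [g gP].
  exists (fun k => if k is k'.+1 then g k' else i) => n.
  by case: n => [//|n]; rewrite (mkS _ n); exact: gP.
exists (g 0%N) => //; have [_ ->] := FP (g 0%N).
exists (g \o S) => n; have -> : mkseq (g \o S) n = behead (mkseq g n.+1) by rewrite mkS.
exact: (gP n.+1).
Qed.

Lemma suslin_bigcap (A : nat -> set (X * Y)) :
  (forall n, suslin (A n)) -> suslin (\bigcap_n A n).
Proof.
move=> /choice[F FP].
pose dec (g : nat -> nat) (i j : nat) := g (pickle (i, j)).
(* [s] determines the first [n] values of the [i]-th sequence that it codes *)
pose ok (s : seq nat) (i n : nat) := forall j, (j < n)%N -> (pickle (i, j) < size s)%N.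
pose G (s : seq nat) k : set (X * Y) :=
  if unpickle k is Some (i, n) then
    if `[< ok s i n >] then F i (mkseq (dec (nth 0%N s) i) n) else setT
  else setT.
have decE g m i n : ok (mkseq g m) i n ->
    mkseq (dec (nth 0%N (mkseq g m)) i) n = mkseq (dec g i) n.
  rewrite /ok size_mkseq => okn; apply/eq_in_map => j.
  by rewrite mem_iota add0n => /= jn; rewrite /dec nth_mkseq// okn.
exists (fun s => \bigcap_k G s k); split.
  move=> s; apply: rect_closed_bigcap => k; rewrite /G.
  case: unpickle => [[i n]|]; last exact: rect_closedT.
  by case: ifP => _; [case: (FP i)|exact: rect_closedT].
apply/seteqP; split => [z Az|z [g gP] i _].
  have /choice[g gP] i : exists g, forall n, F i (mkseq g n) z.
    by have := Az i I; have [_ ->] := FP i.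
  exists (fun k => if unpickle k is Some (i, j) then g i j else 0%N) => m k _.
  rewrite /G; case: unpickle => [[i n]|//]; case: asboolP => // /decE ->.
  rewrite (_ : mkseq _ n = mkseq (g i) n)//; apply/eq_map => j.
  by rewrite /dec pickleK.
have [_ ->] := FP i; exists (dec g i) => n.
pose m := (\max_(j < n) pickle (i, val j)).+1.
have okn : ok (mkseq g m) i n.
  move=> j jn; rewrite size_mkseq ltnS.
  exact: (leq_bigmax (F := fun j : 'I_n => pickle (i, val j)) (Ordinal jn)).
have := gP m (pickle (i, n)) I; rewrite /G pickleK.
by case: asboolP => // _; rewrite decE.
Qed.

(** Complements are not available for Suslin sets, so the induction over the
    product sigma-algebra carries a set together with its complement. *)
Lemma measurable_suslin (A : set (X * Y)) : measurable A -> suslin A.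
Proof.
move=> mA; suff [] : suslin A /\ suslin (~` A) by [].
move: A mA; rewrite measurable_prod_measurableType; apply: smallest_sub.
  split => /=.
  - split; apply: rect_closed_suslin; first exact: rect_closed0.
    by rewrite setC0; exact: rect_closedT.
  - by move=> A [sA sCA]; rewrite setTD setCK.
  - move=> A sA; split; first by apply: suslin_bigcup => n; case: (sA n).
    by rewrite setC_bigcup; apply: suslin_bigcap => n; case: (sA n).
move=> _ [M mM [N mN <-]]; split; apply: rect_closed_suslin.
  exact: rect_closedX.
exact: rect_closedC.
Qed.

Section capacitability.
Context (R : realType).
Variable C : set (X * Y) -> R.
Hypothesis C_mono : forall A B, A `<=` B -> C A <= C B.
Hypothesis C_bigcup : forall (A : nat -> set (X * Y)) L, nondecreasing_seq A ->
  (forall n, C (A n) <= L) -> C (\bigcup_n A n) <= L.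

Section scheme.
Variables (F : seq nat -> set (X * Y)) (m : nat -> nat).

Fixpoint tree (s : seq nat) (n : nat) : set (X * Y) :=
  if n is n'.+1 then
    F s `&` [set z | exists2 i, (i <= m (size s))%N & tree (rcons s i) n' z]
  else F s.

Lemma rect_closed_tree s n :
  (forall t, rect_closed (F t)) -> rect_closed (tree s n).
Proof.
move=> cF; elim: n s => [|n IH] s //=; apply: rect_closedI => //.
exact: (@rect_closed_bigcup_le (fun i => tree (rcons s i) n)).
Qed.

Lemma tree_mkseq g z k n : (forall i, F (mkseq g i) z) ->
  (forall i, (i < k + n)%N -> (g i <= m i)%N) -> tree (mkseq g k) n z.
Proof.
move=> Fz; elim: n k => [|n IH] k gm //=; split => //.
exists (g k); first by rewrite size_mkseq gm// addnS ltnS leq_addr.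
by rewrite -mkseqS; apply: IH => i; rewrite addSn -addnS; exact: gm.
Qed.

Lemma treeP s n z : tree s n z -> exists t : seq nat, [/\ size t = n,
  (forall i, (i < n)%N -> (nth 0%N t i <= m (size s + i))%N) &
  (forall j, (j <= n)%N -> F (s ++ take j t) z)].
Proof.
elim: n s => [|n IH] s /=.
  by move=> Fz; exists [::]; split => // j _; rewrite cats0.
move=> [Fz [i im /IH[t [st tm tF]]]]; exists (i :: t); split.
- by rewrite /= st.
- move=> [|j]; rewrite /= ?addn0// ltnS => /tm.
  by rewrite size_rcons addSn -addnS.
- move=> [|j]; first by rewrite take0 cats0.
  by rewrite ltnS => /tF; rewrite cat_rcons.
Qed.

Lemma tree_nonincreasing s n : tree s n.+1 `<=` tree s n.
Proof.
elim: n s => [|n IH] s z; first by move=> [].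
by move=> [Fz [i im /IH tz]]; split => //; exists i.
Qed.

(** Koenig's lemma: a point in every level of the finitely branching tree lies
    on an infinite branch. The branch is the limit along an ultrafilter of
    finite branches of growing length. *)
Lemma tree_branch z : (forall n, tree [::] n z) ->
  exists g : nat -> nat, forall n, F (mkseq g n) z.
Proof.
move=> allz; have /choice[t tP] n := treeP (allz n).
have [U [UU Uoo]] := @ultraFilterLemma nat \oo _.
have PU : ProperFilter U by case: UU.
have ge_U k : U [set n | (k <= n)%N] by apply: Uoo; exists k.
have /choice[g gP] i : exists v, U [set n | nth 0%N (t n) i = v].
  apply: (@ultra_pigeonhole U UU _ (m i)).
  apply: filterS (ge_U i.+1) => n /= ilt; have [_ /(_ _ ilt) + _] := tP n.
  by rewrite add0n.
exists g => k.
have : U [set n | forall i, (i < k)%N -> nth 0%N (t n) i = g i].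
  elim: k => [|k IH]; first by apply: filterS (ge_U 0%N) => n _ i.
  apply: filterS (filterI IH (gP k)) => n [h1 h2] i.
  by rewrite ltnS leq_eqVlt => /orP[/eqP ->|/h1].
move=> /(filterI (ge_U k)) /filter_ex[n [/= kn tg]].
have [st _ /(_ _ kn)] := tP n.
rewrite cat0s (_ : take k _ = mkseq g k)//.
apply: (@eq_from_nth _ 0%N) => [|i].
  by rewrite size_takel ?st// size_mkseq.
by rewrite size_takel ?st// => ik; rewrite nth_take// nth_mkseq// tg.
Qed.

End scheme.

(** Choquet's capacitability argument: bounding successively the coordinates of
    the witnessing sequence loses no capacity, and the sets described by finitely
    many bounds lie in the rectangle-closed levels of a tree. *)
Lemma suslin_capacitable A c : suslin A -> c < C A ->
  exists K : nat -> set (X * Y), [/\ forall n, rect_closed (K n),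
    forall n, K n.+1 `<=` K n, forall n, c <= C (K n) & \bigcap_n K n `<=` A].
Proof.
move=> [F [cF AE]] cA.
pose A_ (l : seq nat) := [set z | exists2 g : nat -> nat,
  forall n, F (mkseq g n) z & forall i, (i < size l)%N -> (g i <= nth 0%N l i)%N].
have step l : exists i, c < C (A_ l) -> c < C (A_ (rcons l i)).
  have [h|] := pselect (exists i, c < C (A_ (rcons l i))).
    by case: h => i ?; exists i.
  move=> /forallNP h; exists 0%N; rewrite (_ : A_ l = \bigcup_i A_ (rcons l i)).
    rewrite ltNge => /negP[]; apply: C_bigcup; last by move=> i; rewrite leNgt; exact/negP.
    apply/nondecreasing_seqP => i; apply/subsetPset => z [g Fz gl].
    exists g => // j; rewrite size_rcons => jl; have := gl j.
    rewrite size_rcons !nth_rcons => /(_ jl).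
    by case: ifP => // _; case: ifP => // _; exact: leqW.
  apply/seteqP; split => z.
    move=> [g Fz gl]; exists (g (size l)) => //; exists g => // j.
    by rewrite size_rcons nth_rcons ltnS; case: ltngtP => [/gl|//|->].
  move=> [i _ [g Fz gl]]; exists g => // j jl; have := gl j.
  by rewrite size_rcons nth_rcons jl; apply; exact: ltnW.
move: step => /choice[f fP].
pose ls := fix ls n : seq nat :=
  if n is n'.+1 then rcons (ls n') (f (ls n')) else [::].
pose m n := f (ls n).
have lsE n : ls n = mkseq m n by elim: n => [//|n IH]; rewrite mkseqS -IH.
have cls n : c < C (A_ (ls n)).
  elim: n => [|n IH] /=; last exact: fP.
  rewrite (_ : A_ [::] = A)// AE; apply/seteqP; split => z [g]; first by exists g.
  by exists g.
exists (tree F m [::]); split.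
- by move=> n; exact: rect_closed_tree.
- by move=> n; exact: tree_nonincreasing.
- move=> n; apply: (le_trans (ltW (cls n))); apply: C_mono => z [g Fz gl].
  apply: (@tree_mkseq F m g z 0) => // i iltn; have := gl i.
  by rewrite lsE size_mkseq nth_mkseq//; exact.
- by move=> z Tz; rewrite AE; apply: tree_branch => n; exact: Tz.
Qed.

End capacitability.

End suslin.

(** * Contents dominated by a finite measure *)

Section dominated_content.
Context d (T : measurableType d) (R : realType).

Definition additive_on_measurable (m : set T -> R) : Prop := forall A B,
  measurable A -> measurable B -> A `&` B = set0 -> m (A `|` B) = m A + m B.

Variables (m : set T -> R) (lam : {finite_measure set T -> \bar R}).
Hypothesis addm : additive_on_measurable m.
Hypothesis m_ge0 : forall A, measurable A -> 0 <= m A.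
Hypothesis m_le : forall A, measurable A -> m A <= fine (lam A).

Let m0 : m set0 = 0.
Proof.
have := addm measurable0 measurable0 (setI0 _).
by rewrite setU0 => /eqP; rewrite -subr_eq0 opprD addNKr oppr_eq0 => /eqP.
Qed.

Let bigsetU_add (F : (set T)^nat) n : (forall i, measurable (F i)) ->
  trivIset setT F -> m (\big[setU/set0]_(i < n) F i) = \sum_(i < n) m (F i).
Proof.
move=> mF tF; elim: n => [|n IH]; first by rewrite !big_ord0.
rewrite !big_ord_recr /= addm ?IH//; first exact: bigsetU_measurable.
rewrite -[RHS](@trivIset_bigsetUI _ predT F _ n n)//.
by apply: sub_trivIset tF.
Qed.

Let mE (A : set T) : \bar R := `|m A|%:E.

Let mE0 : mE set0 = 0%E. Proof. by rewrite /mE m0 normr0. Qed.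

Let mE_ge0 A : (0 <= mE A)%E. Proof. by rewrite lee_fin. Qed.

(** The tail of a disjoint union has small measure, hence small content. *)
Let mE_sigma_additive : semi_sigma_additive mE.
Proof.
move=> F mF tF mUF.
have -> : (fun n => \sum_(0 <= i < n) mE (F i))%E =
          EFin \o (fun n => \sum_(0 <= i < n) m (F i)).
  apply/funext => n /=; rewrite -sumEFin; apply: eq_bigr => i _.
  by rewrite /mE ger0_norm// m_ge0.
rewrite /mE ger0_norm ?m_ge0//; apply: cvg_EFin; first exact: nearW.
have cl : \sum_(0 <= i < n) fine (lam (F i)) @[n --> \oo] -->
    fine (lam (\bigcup_n F n)).
  have : (\sum_(0 <= i < n) lam (F i))%E @[n --> \oo] -->
      (fine (lam (\bigcup_n F n)))%:E.
    by rewrite fine_measureK//; exact: measure_semi_sigma_additive.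
  move/fine_cvg; apply: cvg_trans; apply: near_eq_cvg.
  apply: nearW => n /=; rewrite sum_fine// => i _; exact: fin_num_measure.
apply/cvgrPdist_le => e e0; move/cvgrPdist_le : cl => /(_ _ e0).
apply: filterS => n /=; rewrite !big_mkord => le_e.
have mB : measurable (\big[setU/set0]_(i < n) F i) by exact: bigsetU_measurable.
pose W := \bigcup_n F n `\` \big[setU/set0]_(i < n) F i.
have mW : measurable W by exact: measurableD.
have BW0 : \big[setU/set0]_(i < n) F i `&` W = set0 by rewrite setDIK.
have BWU : \big[setU/set0]_(i < n) F i `|` W = \bigcup_n F n.
  by rewrite /W setDUK//; exact: bigsetU_bigcup.
have mU : m (\bigcup_n F n) = \sum_(i < n) m (F i) + m W.
  by rewrite -BWU addm// bigsetU_add.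
have lU : fine (lam (\bigcup_n F n)) = \sum_(i < n) fine (lam (F i)) + fine (lam W).
  rewrite -BWU measureU// fineD ?fin_num_measure//; congr (_ + _).
  rewrite measure_bigsetU//.
  by rewrite sum_fine// => i _; exact: fin_num_measure.
have DK x y : x + y - x = y :> R by rewrite addrC addKr.
move: le_e; rewrite mU lU !DK.
rewrite ger0_norm ?fine_measure_ge0// ger0_norm ?m_ge0//.
by apply: le_trans; exact: m_le.
Qed.

Lemma dominated_content_measure : exists M : {finite_measure set T -> \bar R},
  forall A, measurable A -> M A = (m A)%:E.
Proof.
pose M0 := isMeasure.Build _ T R mE mE0 mE_ge0 mE_sigma_additive.
pose M1 : {measure set T -> \bar R} := HB.pack mE M0.
have fM : fin_num_fun M1 by move=> A mA.
pose M2 := Measure_isFinite.Build _ T R M1 fM.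
pose M : {finite_measure set T -> \bar R} := HB.pack (M1 : set T -> \bar R) M1 M2.
by exists M => A mA; rewrite /M /= /M1 /= /mE ger0_norm// m_ge0.
Qed.

End dominated_content.

(** * From additive set functions of rectangles to measures and kernels *)

Section integral_comparison.
Context d (T : measurableType d) (R : realType).
Variable mu : {measure set T -> \bar R}.
Local Open Scope ereal_scope.

Lemma ae_le_of_integral (f g : T -> \bar R) :
  (forall x, 0 <= f x) -> (forall x, 0 <= g x) ->
  mu.-integrable setT f -> mu.-integrable setT g ->
  (forall A, measurable A -> \int[mu]_(x in A) f x <= \int[mu]_(x in A) g x) ->
  {ae mu, forall x, f x <= g x}.
Proof.
move=> f0 g0 intf intg fg.
have mf : measurable_fun setT f := measurable_int mu intf.
have mg : measurable_fun setT g := measurable_int mu intg.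
have mM : measurable_fun setT (fun x => maxe (f x) (g x)).
  exact: measurable_maxe.
pose D := [set x | g x < f x].
have mD : measurable D by rewrite -[D]setTI; exact: measurable_lte.
have : ae_eq mu setT g (fun x => maxe (f x) (g x)).
  apply: integral_ae_eq => // E _ mE.
  apply/eqP; rewrite eq_le; apply/andP; split.
    apply: ge0_le_integral => //; try exact: measurable_funTS.
    by move=> x _; rewrite le_max lexx orbT.
  have mED : measurable (E `&` D) by exact: measurableI.
  have mEC : measurable (E `&` ~` D) by apply: measurableI => //; exact: measurableC.
  rewrite -(setUIDK E D) setDE.
  have disj : [disjoint E `&` D & E `&` ~` D].
    by apply/disj_setPS => x [[_ ?] [_]].
  rewrite !ge0_integral_setU//; try exact: measurable_funTS.
  - apply: leeD.
      rewrite (eq_integral f) ?fg// => x; rewrite inE => -[_ gf].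
      by rewrite max_l// ltW.
    rewrite (eq_integral g)// => x; rewrite inE => -[_ /negP].
    by rewrite -leNgt => ?; rewrite max_r.
  - by move=> x _; rewrite le_max f0.
apply: filterS => x /= /(_ I) ->.
by rewrite le_max lexx.
Qed.

End integral_comparison.

Section kernel_of_fun.
Context d1 d2 d3 (X : measurableType d1) (Y : measurableType d2)
  (Z : measurableType d3) (R : realType).

Lemma kernel_of_fun (U : probability Y R) (G : X * Y -> Z) :
  measurable_fun setT G -> exists k : R.-pker X ~> Z, forall x B,
    measurable B -> k x B = U [set u | B (G (x, u))].
Proof.
move=> mG.
have mU : measurable_fun [set: X] (fun _ : X => (U : pprobability Y R)) by exact: measurable_cst.
pose l : R.-pker X ~> Y := kprobability mU.
pose k : R.-pker (X * Y)%type ~> Z := kdirac mG.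
have kE x B : measurable B -> (mkcomp l k) x B = U [set u | B (G (x, u))].
  move=> mB; rewrite /= /kcomp /=.
  have mS : measurable [set u | B (G (x, u))].
    rewrite -[X in measurable X]setTI; apply: (measurableT_comp mG _ measurableT mB).
    exact: measurable_pair1.
  rewrite -[in RHS](setIT [set u | _]) -integral_indic//.
have k1 : forall a, (mkcomp l k) a setT = 1%E.
  by move=> a; rewrite kE//= (_ : [set u | _] = setT) ?probability_setT.
pose H := Kernel_isProbability.Build _ _ X Z R (mkcomp l k) k1.
pose K : R.-pker X ~> Z := HB.pack (mkcomp l k) H.
by exists K.
Qed.

End kernel_of_fun.

Section bicontent.
Context d1 d2 (X : measurableType d1) (Y : measurableType d2) (R : realType).

Definition bicontent (L : set X -> set Y -> R) : Prop :=
  [/\ forall A B, measurable A -> measurable B -> 0 <= L A B,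
      forall B, measurable B -> additive_on_measurable (L ^~ B) &
      forall A, measurable A -> additive_on_measurable (L A)].

Variable L : set X -> set Y -> R.
Hypothesis biL : bicontent L.

Lemma bicontent_mono A A' B B' : measurable A -> measurable A' ->
  measurable B -> measurable B' -> A `<=` A' -> B `<=` B' -> L A B <= L A' B'.
Proof.
move=> mA mA' mB mB' AA' BB'; have [L0 L1 L2] := biL.
apply: (@le_trans _ _ (L A B')).
  have mBD : measurable (B' `\` B) by exact: measurableD.
  have -> : B' = B `|` (B' `\` B) by rewrite setDUK.
  by rewrite L2// ?setDIK// lerDl L0.
have mAD : measurable (A' `\` A) by exact: measurableD.
have -> : A' = A `|` (A' `\` A) by rewrite setDUK.
by rewrite L1// ?setDIK// lerDl L0.
Qed.

End bicontent.

Section pushforward_measure_exists.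
Context d1 d2 (X : measurableType d1) (Y : measurableType d2) (R : realType).

Lemma pushforward_measure_exists (m : {measure set X -> \bar R}) (f : X -> Y) :
  measurable_fun setT f ->
  exists M : {measure set Y -> \bar R}, forall B, M B = m (f @^-1` B).
Proof.
move=> mf.
have h0 : pushforward m f set0 = 0%E by exact: measure0.
have hge A : (0 <= pushforward m f A)%E by exact: measure_ge0.
have hs : semi_sigma_additive (pushforward m f).
  exact: measure_semi_sigma_additive.
pose H := isMeasure.Build _ Y R (pushforward m f) h0 hge hs.
pose M : {measure set Y -> \bar R} := HB.pack (pushforward m f) H.
by exists (M mf).
Qed.

End pushforward_measure_exists.

Lemma rat_nondecreasing_approx (R : realType) (y : R) : exists q : nat -> rat,
  [/\ {homo q : m n / (m <= n)%N >-> m <= n}, forall n, ratr (q n) < y &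
  forall r : R, r < y -> exists n, r < ratr (q n)].
Proof.
have step (p : rat * nat) : exists q : rat, (ratr p.1 < y) ->
    [/\ p.1 <= q, ratr q < y & y - p.2.+1%:R^-1 < ratr q].
  have [h|h] := pselect (ratr p.1 < y); last by exists 0.
  have : Num.max (ratr p.1) (y - p.2.+1%:R^-1) < y.
    by rewrite gt_max h ltrBlDr ltrDl invr_gt0 ltr0n.
  move=> /rat_in_itvoo[q]; rewrite in_itv/= gt_max => /andP[/andP[pq pq'] qy].
  by exists q => _; split => //; move: (ltW pq); rewrite ler_rat.
have /choice[f fP] := step.
have [q0 q0y] : exists q0 : rat, ratr q0 < y.
  have : y - 1 < y by rewrite ltrBlDr ltrDl.
  by move=> /rat_in_itvoo[q]; rewrite in_itv/= => /andP[_ ?]; exists q.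
pose q := fix q n : rat := if n is m.+1 then f (q m, m) else q0.
have qy n : ratr (q n) < y.
  by elim: n => [//|n IH] /=; have [] := fP (q n, n) IH.
exists q; split => //.
  apply: homo_leq => [p|p r t|n]; [exact: lexx|exact: le_trans|].
  by have [] := fP (q n, n) (qy n).
move=> r ry.
have [n nP] : exists n, n.+1%:R^-1 < y - r.
  have yr0 : 0 < (y - r)^-1 by rewrite invr_gt0 subr_gt0.
  exists (Num.truncn (y - r)^-1); rewrite invf_plt ?posrE ?subr_gt0//.
  by rewrite truncnS_gt.
exists n.+1 => /=; have [_ _] := fP (q n, n) (qy n) => /=.
by apply: le_lt_trans; rewrite lerBrDr -lerBrDl ltW.
Qed.

Section disintegration_of_bicontent.
Context d (X : measurableType d) (R : realType).
Variables (L : set X -> set (measurableTypeR R) -> R).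
Variables (lam : {finite_measure set X -> \bar R}) (rho : fmeasR R).
Hypothesis biL : bicontent L.
Hypothesis L_lam : forall A, measurable A -> L A setT = fine (lam A).
Hypothesis L_rho : forall B, measurable B -> L setT B <= fine (rho B).

Let L_le_rho A B : measurable A -> measurable B -> L A B <= fine (rho B).
Proof.
by move=> mA mB; apply: le_trans (L_rho mB); exact: (bicontent_mono biL).
Qed.

Let L_le_lam A B : measurable A -> measurable B -> L A B <= fine (lam A).
Proof.
by move=> mA mB; rewrite -L_lam//; exact: (bicontent_mono biL).
Qed.

Let L_mono A B B' : measurable A -> measurable B -> measurable B' ->
  B `<=` B' -> L A B <= L A B'.
Proof. by move=> *; exact: (bicontent_mono biL). Qed.

(** A version of the conditional distribution function at rational points. It is
    corrected on a single null set, so that it is monotone everywhere. *)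
Let cond_cdf : exists F : rat -> X -> R, [/\ forall q, measurable_fun setT (F q),
  forall q x, 0 <= F q x <= 1,
  forall q r x, q <= r -> F q x <= F r x &
  forall q A, measurable A ->
    (\int[lam]_(x in A) (F q x)%:E = (L A `]-oo, ratr q[)%:E)%E].
Proof.
have [L0 L1 L2] := biL.
have /choice[f fP] q : exists f : X -> \bar R, [/\ forall x, (0 <= f x)%E,
    lam.-integrable setT f & forall A, measurable A ->
    (\int[lam]_(x in A) f x = (L A `]-oo, ratr q[)%:E)%E].
  have mq : measurable (`]-oo, ratr q[ : set (measurableTypeR R)) by [].
  have [M ME] : exists M : {finite_measure set X -> \bar R},
      forall A, measurable A -> M A = (L A `]-oo, ratr q[)%:E.
    apply: (dominated_content_measure (lam := lam)) => [|A mA|A mA].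
    - exact: L1.
    - exact: L0.
    - exact: L_le_lam.
  have Mlam : M `<< lam.
    apply/null_content_dominatesP => A mA A0; rewrite ME//; congr EFin.
    by apply/eqP; rewrite eq_le L0// (le_trans (L_le_lam mA mq))//= A0.
  have [f [f0 intf fE]] := radon_nikodym_finite Mlam.
  by exists f; split => // A mA; rewrite -fE// ME.
have f0 q x : (0 <= f q x)%E by have [] := fP q.
have mono_ae q r : q <= r -> {ae lam, forall x, (f q x <= f r x)%E}.
  move=> qr; have [fq iq Eq] := fP q; have [fr ir Er] := fP r.
  apply: ae_le_of_integral => // A mA; rewrite Eq// Er// lee_fin.
  apply: L_mono => // y /=; rewrite !in_itv/= => /lt_le_trans; apply.
  by rewrite ler_rat.
have le1_ae q : {ae lam, forall x, (f q x <= 1)%E}.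
  have [fq iq Eq] := fP q.
  apply: (ae_le_of_integral (g := cst 1%E)) => //.
    apply/integrableP; split; first exact: measurable_cst.
    by rewrite integral_cst//= normr1 mul1e -ge0_fin_numE// fin_num_measure.
  move=> A mA; rewrite Eq// integral_cst// mul1e.
  by rewrite -[leRHS](fine_measureK lam mA) lee_fin L_le_lam.
have : {ae lam, forall x, forall k,
    if (unpickle k : option (rat * rat)) is Some (q, r) then
    (q <= r -> (f q x <= f r x)%E) /\ (f q x <= 1)%E else True}.
  apply: ae_foralln => k; case: unpickle => [[q r]|]; last exact: aeW.
  have [qr|qr] := boolP (q <= r); last by apply: filterS (le1_ae q).
  by apply: filterS2 (mono_ae _ _ qr) (le1_ae q) => x.
move=> [N [mN N0 badN]].
have good x : ~ N x -> forall q r, (q <= r -> (f q x <= f r x)%E) /\ (f q x <= 1)%E.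
  move=> Nx q r; have := contra_notP (badN x) Nx.
  by move=> /(_ (pickle (q, r))); rewrite pickleK.
exists (fun q x => fine (f q x) * \1_(~` N) x).
have fN q x : x \notin N -> [/\ (f q x)%E \is a fin_num, 0 <= fine (f q x) &
    fine (f q x) <= 1].
  rewrite notin_setE => /good /(_ q q) [_ f1].
  have fi : (f q x)%E \is a fin_num.
    by rewrite ge0_fin_numE//; apply: le_lt_trans f1 _; rewrite ltry.
  by split => //; [exact: fine_ge0|rewrite -lee_fin fineK].
have mC : measurable (~` N) by exact: measurableC.
split.
- move=> q; have [_ /integrableP[mf _] _] := fP q.
  apply: measurable_funM => //; exact: measurableT_comp.
- move=> q x; rewrite indicE in_setC; have [xN|xN] /= := boolP (x \in N).
    by rewrite mulr0 lexx ler01.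
  by have [_ ? ?] := fN q x xN; rewrite mulr1; apply/andP.
- move=> q r x qr; rewrite indicE in_setC; have [xN|xN] /= := boolP (x \in N).
    by rewrite !mulr0.
  have [? _ _] := fN q x xN; have [? _ _] := fN r x xN; rewrite !mulr1 fine_le//.
  by move: xN; rewrite notin_setE => /good /(_ q r) [+ _]; apply.
- move=> q A mA; have [_ iq <-//] := fP q.
  have mf : measurable_fun setT (f q) := measurable_int lam iq.
  apply: ae_eq_integral => //.
  - apply/measurable_EFinP/measurable_funM => //.
    by apply: measurable_funTS; exact: measurableT_comp.
  - exact: measurable_funTS.
  - exists N; split => // x /=; apply: contra_notP => Nx _.
    have xN : x \notin N by rewrite notin_setE.
    have [? _ _] := fN q x xN.
    by rewrite indicE in_setC xN mulr1 fineK.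
Qed.


(** The kernel is the law of the conditional quantile function at a uniformly
    distributed level. *)
Lemma bicontent_kernel : exists k : R.-pker X ~> (measurableTypeR R),
  forall A B, measurable A -> measurable B ->
    (\int[lam]_(x in A) k x B = (L A B)%:E)%E.
Proof.
have [L0 L1 L2] := biL.
have [F [mF F01 Fmono FL]] := cond_cdf.
pose U : probability (measurableTypeR R) R := uniform_prob (@ltr01 R).
have U0c (c : R) : 0 <= c <= 1 -> U `]-oo, c]%classic = c%:E.
  move=> /andP[c0 c1]; rewrite /U /= /uniform_prob integral_uniform_pdf.
  have -> : `]-oo, c]%classic `&` `[0, 1]%classic = `[0, c]%classic :> set R.
    apply/seteqP; split => z /=; rewrite !in_itv/=.
      by move=> [zc /andP[-> _]].
    by move=> /andP[-> zc]; split => //; exact: le_trans zc c1.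
  rewrite (eq_integral (fun=> 1%E)); last first.
    move=> z; rewrite inE/= in_itv/= => /andP[z0 zc].
    by rewrite /uniform_pdf z0 (le_trans zc c1)/= subr0 invr1.
  rewrite integral_cst//= mul1e lebesgue_measure_itv/= lte_fin.
  case: ltgtP c0 => //= [_ _|<- _]; last by [].
  by rewrite oppr0 adde0.
pose gn n (z : X * measurableTypeR R) : \bar R :=
  if (unpickle n : option rat) is Some q then
    if z.2 <= F q z.1 then (ratr q : R)%:E else +oo%E
  else +oo%E.
pose g z := einfs (gn ^~ z) 0%N.
have mg : measurable_fun setT g.
  apply: measurable_fun_einfs => n; rewrite /gn; case: unpickle => [q|//].
  apply: measurable_fun_ifT => //; apply: measurable_fun_ler => //.
  exact: measurableT_comp.
have g_lt x u y : (g (x, u) < y)%E <->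
    exists2 q : rat, ((ratr q : R)%:E < y)%E & u <= F q x.
  split.
    rewrite /g /einfs => /ereal_inf_lt[_ [n _ <-]]; rewrite /gn.
    case: unpickle => [q|]; last by rewrite ltNge leey.
    by case: ifPn => [uF qy|]; [exists q|rewrite ltNge leey].
  move=> [q qy uF]; apply: le_lt_trans qy; apply: ereal_inf_lbound.
  by exists (pickle q) => //; rewrite /gn pickleK uF.
pose G (z : X * measurableTypeR R) : measurableTypeR R := fine (g z).
have mG : measurable_fun setT G by exact: measurableT_comp.
have [k kE] := kernel_of_fun U mG; exists k => A B mA mB.
have [Q QE] : exists Q : {measure set (X * measurableTypeR R) -> \bar R},
    forall E, Q E = (\int[lam]_x U (xsection E x))%E.
  by exists (lam \x U)%E.
have mD q : measurable [set z : X * measurableTypeR R | z.2 <= F q z.1].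
  rewrite -[X in measurable X]setTI; apply: measurable_fun_ler => //.
  exact: measurableT_comp.
have mAT (C : set X) : measurable C -> measurable (C `*` [set: measurableTypeR R]).
  by move=> mC; exact: measurableX.
have QAT C E : Q ((C `*` setT) `&` E) = (\int[lam]_(x in C) U (xsection E x))%E.
  rewrite QE [RHS]integral_mkcond; apply: eq_integral => x _.
  rewrite xsectionI patchE; case: ifPn => Cx.
    by rewrite in_xsectionX// setTI.
  by rewrite notin_xsectionX// set0I measure0.
have mlt y : measurable [set z | (g z < y)%E].
  rewrite -[X in measurable X]setTI.
  exact: (measurable_lte measurableT mg (measurable_cst _)).
have Qlt C y : measurable C ->
    Q ((C `*` setT) `&` [set z | (g z < y%:E)%E]) = (L C `]-oo, y[)%:E.
  move=> mC; have [q [ndq qy yq]] := rat_nondecreasing_approx y.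
  have gE : [set z | (g z < y%:E)%E] = \bigcup_n [set z | z.2 <= F (q n) z.1].
    apply/seteqP; split => [[x u] /= /g_lt[r]|[x u] [n _ /= uF]].
      rewrite lte_fin => /yq[n rn] uF; exists n => //=; apply: le_trans uF _.
      by apply: Fmono; rewrite -(ler_rat R) ltW.
    by apply/g_lt; exists (q n) => //; rewrite lte_fin.
  have [M ME] : exists M : fmeasR R, forall B, measurable B -> M B = (L C B)%:E.
    by apply: (dominated_content_measure (lam := rho)) => [|B' mB'|B' mB'];
      [exact: L2|exact: L0|exact: L_le_rho].
  have mq n : measurable (`]-oo, ratr (q n)[%classic : set (measurableTypeR R)).
    by [].
  have my : measurable (`]-oo, y[%classic : set (measurableTypeR R)) by [].
  have cE : `]-oo, y[%classic = \bigcup_n `]-oo, ratr (q n) : R[%classic.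
    apply/seteqP; split => [z /=|z [n _ /=]]; rewrite in_itv/=.
      by move=> /yq[n zq]; exists n => //=; rewrite in_itv.
    by rewrite in_itv/= => /lt_trans; apply.
  have ndI : nondecreasing_seq (fun n => `]-oo, ratr (q n) : R[%classic).
    move=> m n mn; apply/subsetPset => z /=; rewrite !in_itv/= => /lt_le_trans.
    by apply; rewrite ler_rat ndq.
  have QD n : Q ((C `*` setT) `&` [set z | z.2 <= F (q n) z.1]) = M `]-oo, ratr (q n)[%classic.
    rewrite QAT ME// -FL//; apply: eq_integral => x _.
    rewrite -U0c ?F01//; congr (U _); apply/seteqP.
    by split => u; rewrite /xsection/= in_itv/= inE.
  rewrite gE setI_bigcupr -ME// cE.
  have c1 : Q ((C `*` setT) `&` [set z | z.2 <= F (q n) z.1]) @[n --> \oo] -->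
      Q (\bigcup_n ((C `*` setT) `&` [set z | z.2 <= F (q n) z.1])).
    apply: nondecreasing_cvg_mu.
    - by move=> n; apply: measurableI => //; exact: mAT.
    - by apply: bigcup_measurable => n _; apply: measurableI => //; exact: mAT.
    - move=> m n mn; apply/subsetPset => z [? /= h]; split => //=.
      by apply: le_trans h _; apply: Fmono; exact: ndq.
  have c2 : M `]-oo, ratr (q n)[%classic @[n --> \oo] -->
      M (\bigcup_n `]-oo, ratr (q n)[%classic).
    by apply: nondecreasing_cvg_mu => //; rewrite -cE.
  move: c1; under eq_fun do rewrite QD.
  by move=> c1; exact: cvg_unique c1 c2.
have mI (i : interval R) : measurable ([set` i] : set (measurableTypeR R)).
  exact: measurable_itv.
have mg1 (y : \bar R) : measurable [set z | g z = y].
  by rewrite -[X in measurable X]setTI; exact: measurable_eqe.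
have QT : Q setT = (L setT setT)%:E.
  have -> : [set: X * measurableTypeR R] = (setT `*` setT) `&` setT.
    by rewrite setXTT setTI.
  rewrite QAT L_lam// fine_measureK//.
  under eq_integral do rewrite xsectionE preimage_setT probability_setT.
  by rewrite integral_cst// mul1e.
have rho_lim (I : nat -> interval R) : {homo (fun n => [set` I n]) : m n /
      (m <= n)%N >-> n `<=` m} -> \bigcap_n [set` I n] = set0 ->
    rho [set` I n] @[n --> \oo] --> 0%E.
  move=> ndI I0; rewrite -(measure0 rho) -I0; apply: nonincreasing_cvg_mu.
  - by rewrite -ge0_fin_numE// fin_num_measure//; exact: mI.
  - by move=> n; exact: mI.
  - by apply: bigcap_measurable => [|n _]; [exists 0%N|exact: mI].
  - by move=> m n mn; apply/subsetPset/ndI.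
have rho_le0 (I : nat -> interval R) (c : \bar R) : {homo (fun n => [set` I n]) : m n /
      (m <= n)%N >-> n `<=` m} -> \bigcap_n [set` I n] = set0 ->
    (0 <= c)%E -> (forall n, c <= (L setT [set` I n])%:E)%E -> c = 0%E.
  move=> ndI I0 c0 cI; apply/eqP; rewrite eq_le c0 andbT.
  have cv := rho_lim _ ndI I0.
  rewrite -(cvg_lim _ cv)//; apply: lime_ge; first by apply/cvg_ex; eexists; exact: cv.
  apply: nearW => n; apply: le_trans (cI n) _.
  by rewrite -[leRHS](fine_measureK rho (mI _)) lee_fin L_rho//; exact: mI.
have Qm : Q [set z | g z = -oo%E] = 0%E.
  apply: (rho_le0 (fun n => `]-oo, (- n%:R)[)) => //.
  - move=> m n mn x /=; rewrite !in_itv/= => /lt_le_trans; apply.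
    by rewrite lerN2 ler_nat.
  - apply/seteqP; split => // x xI; have := xI (Num.truncn `|x|).+1 I.
    rewrite /= in_itv/= ltNge => /negP[]; rewrite lerNl.
    by rewrite (le_trans (ler_norm _))// normrN ltW// truncnS_gt.
  - move=> n; rewrite -(Qlt setT _ measurableT); apply: le_measure; rewrite ?inE//.
      by apply: measurableI => //; exact: mAT.
    by move=> z /= ->; split => //; rewrite ltNyr.
have Qp : Q [set z | g z = +oo%E] = 0%E.
  apply: (rho_le0 (fun n => `[n%:R, +oo[)) => //.
  - move=> m n mn x /=; rewrite !in_itv/= !andbT; apply: le_trans.
    by rewrite ler_nat.
  - apply/seteqP; split => // x xI; have := xI (Num.truncn `|x|).+1 I.
    rewrite /= in_itv/= andbT leNgt => /negP[].
    by rewrite (le_lt_trans (ler_norm _))// truncnS_gt.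
  - move=> n; have LT : L setT setT = L setT `]-oo, n%:R[ + L setT `[n%:R, +oo[.
      rewrite -(L2 _ measurableT _ _ (mI _) (mI _)).
        congr (L _ _); apply/seteqP; split => // x _ /=; rewrite !in_itv/= andbT.
        by case: ltP; [left|right].
      apply/seteqP; split => // x [] /=; rewrite !in_itv/= andbT => xn.
      by rewrite leNgt xn.
    rewrite -(@leeD2lE _ (L setT `]-oo, n%:R[)%:E)// -EFinD -LT -QT.
    rewrite -(Qlt setT _ measurableT).
    rewrite -measureU//; last first.
    + by apply/seteqP; split => // z [[_ /= +] /= gz]; rewrite gz ltNge leey.
    + by apply: measurableI => //; exact: mAT.
    by apply: le_measure; rewrite ?inE//; apply: measurableU => //;
      apply: measurableI => //; exact: mAT.
have mGlt y : measurable [set z | G z < y].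
  by rewrite -[X in measurable X]setTI; exact: (measurable_fun_ltr mG (measurable_cst _)).
pose N := [set z | g z = -oo%E] `|` [set z | g z = +oo%E].
have mN : measurable N by exact: measurableU.
have QN : Q N = 0%E by rewrite measureU0// Qm.
have QG C y : measurable C ->
    Q ((C `*` setT) `&` [set z | G z < y]) = (L C `]-oo, y[)%:E.
  move=> mC; rewrite -(Qlt C y mC).
  rewrite -(measureU0 _ mN QN); last by apply: measurableI => //; exact: mAT.
  rewrite -[RHS](measureU0 _ mN QN); last by apply: measurableI => //; exact: mAT.
  congr (Q _); apply/seteqP; split => z [|]; [|by right| |by right].
    move=> [Cz /=]; rewrite /G; case E : (g z) => [r||] /= ry; last 2 first.
    - by right; right.
    - by right; left.
    by left; split => //=; rewrite E lte_fin.
  move=> [Cz /=]; case E : (g z) => [r||] /= ry; last 2 first.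
  - by right; right.
  - by right; left.
  by left; split => //=; rewrite /G E; rewrite lte_fin in ry.
have [M ME] : exists M : fmeasR R, forall B, measurable B -> M B = (L A B)%:E.
  by apply: (dominated_content_measure (lam := rho)) => [|B' mB'|B' mB'];
    [exact: L2|exact: L0|exact: L_le_rho].
pose QA : {measure set (X * measurableTypeR R) -> \bar R} := mrestr Q (mAT _ mA).
have [M1 M1E] := pushforward_measure_exists QA mG.
have M1k C : measurable C -> M1 C = (\int[lam]_(x in A) k x C)%E.
  move=> mC; rewrite M1E /QA /= /mrestr setIC QAT; apply: eq_integral => x _.
  by rewrite kE// xsectionE.
rewrite -M1k// -ME//.
apply: (@measure_unique _ R (measurableTypeR R) (@RGenInftyO.G R)
  (fun n => `]-oo, n%:R[%classic) _ _ _ _ M1 M) => //.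
- exact: RGenInftyO.measurableE.
- move=> _ _ [y ->] [z ->]; exists (Num.min y z).
  by apply/seteqP; split => x /=; rewrite !in_itv/= lt_min => /andP.
- by move=> n; exists n%:R.
- apply/seteqP; split => // x _; exists (Num.truncn `|x|).+1 => //=.
  by rewrite in_itv/= (le_lt_trans (ler_norm _))// truncnS_gt.
- move=> _ [y ->]; transitivity ((L A `]-oo, y[)%:E : \bar R); last first.
    by apply/esym/ME; exact: mI.
  rewrite M1E.
  by rewrite /QA /= /mrestr setIC -(QG A y mA); congr (Q (_ `&` _)).
- move=> n; rewrite M1E; apply: (@le_lt_trans _ _ (Q setT)); last by rewrite [ltLHS]QT ltry.
  rewrite /QA /= /mrestr; apply: le_measure; rewrite ?inE//.
  apply: measurableI; last exact: measurableX.
  by rewrite -[X in measurable X]setTI; apply: mG => //; exact: mI.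
Qed.

End disintegration_of_bicontent.

(** * Limits of additive set functions along ultrafilters *)

Section finite_constraints.
Context (R : realType) (Omega I : Type).
Variables (base : nat -> set Omega) (ok : set I) (C : I -> R -> set Omega).
Hypothesis base_nonincreasing : forall n, base n.+1 `<=` base n.
Hypothesis C_mono : forall i e e', e <= e' -> C i e `<=` C i e'.
Hypothesis ok_neq0 : ok !=set0.
Hypothesis satisfiable : forall n (a : nat -> I) (e : R), (forall k, ok (a k)) -> 0 < e ->
  exists2 q, base n q & forall k, (k < n)%N -> C (a k) e q.

Let ok_seq (p : nat * (nat -> I)) := forall k, ok (p.2 k).

Let almost (p : nat * (nat -> I)) : set Omega :=
  [set q | base p.1 q /\ forall k, (k < p.1)%N -> C (p.2 k) p.1.+1%:R^-1 q].

Let le_base m n : (m <= n)%N -> base n `<=` base m.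
Proof.
move=> /subnK <-; elim: (n - m)%N => // k IH; rewrite addSn.
by move=> z /base_nonincreasing /IH.
Qed.

(** If any finitely many constraints can be met up to any error, then a filter
    meets all of them in the limit. *)
Lemma finite_constraints_filter : exists F : set_system Omega,
  [/\ ProperFilter F, forall n, F (base n) &
      forall i e, ok i -> 0 < e -> F (C i e)].
Proof.
have [i0 oki0] := ok_neq0.
exists (filter_from ok_seq almost); split.
- apply: (@filter_from_proper _ _ ok_seq almost); last first.
    move=> [n a] /= oka; have [//|q bq Cq] := @satisfiable n a n.+1%:R^-1 oka.
    by exists q.
  apply: (@filter_from_filter _ _ ok_seq almost); first by exists (0%N, fun=> i0).
  move=> [n a] [n' a'] /= oka oka'.
  pose N := (maxn n n').*2.+1.
  pose mix k := if odd k then a' k./2 else a k./2.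
  exists (N, mix); first by move=> k; rewrite /= /mix; case: ifP.
  have nN : (n <= N)%N by rewrite /N -addnn -addnS (leq_trans (leq_maxl n n')) ?leq_addr.
  have n'N : (n' <= N)%N by rewrite /N -addnn -addnS (leq_trans (leq_maxr n n')) ?leq_addr.
  have eN m : (m <= N)%N -> N.+1%:R^-1 <= m.+1%:R^-1 :> R.
    by move=> mN; rewrite lef_pV2 ?posrE ?ltr0n// ler_nat.
  move=> q [/= bq Cq]; split; split => /=.
  + exact: le_base bq.
  + move=> k kn; apply: C_mono (eN _ nN) _ _.
    have := Cq k.*2; rewrite /mix odd_double doubleK; apply.
    by rewrite /N ltnS leq_double (leq_trans (ltnW kn))// leq_maxl.
  + exact: le_base bq.
  + move=> k kn; apply: C_mono (eN _ n'N) _ _.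
    have := Cq k.*2.+1; rewrite /mix /= odd_double /= uphalf_double; apply.
    by rewrite /N ltnS ltn_double (leq_trans kn)// leq_maxr.
- by move=> n; exists (n, fun=> i0) => // q [].
- move=> i e oki e0.
  have [n ne] : exists n, n.+2%:R^-1 <= e.
    have e'0 : 0 < e^-1 by rewrite invr_gt0.
    exists (Num.truncn e^-1); apply: ltW; rewrite invf_plt ?posrE//.
    by apply: lt_trans (truncnS_gt _) _; rewrite ltr_nat.
  exists (n.+1, fun=> i) => // q [/= _ /(_ 0%N isT)].
  exact: C_mono.
Qed.

End finite_constraints.

Section ultra_limit.
Context (R : realType).

Lemma ultra_bounded_cvg (I : Type) (U : set_system I) (f : I -> R) (M : R) :
  UltraFilter U -> U [set i | 0 <= f i <= M] -> exists l : R, f @ U --> l.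
Proof.
move=> UU fM; have PU : ProperFilter U by case: UU.
pose S := [set x : R | U [set i | x <= f i]].
have S0 : S 0 by apply: filterS fM => i /= /andP[].
have Sub : ubound S M.
  move=> x Sx; have : U ([set i | 0 <= f i <= M] `&` [set i | x <= f i]).
    exact: filterI.
  move=> /filter_ex[i [/= /andP[_ fM'] xf]].
  exact: le_trans xf fM'.
have hS : has_sup S by split; [exists 0|exists M].
exists (sup S); apply/cvgrPdist_le => e e0.
have [x Sx xe] := sup_adherent e0 hS.
have [Sy|nSy] := @in_ultra_setVsetC _ U [set i | sup S + e <= f i] UU.
  have := ub_le_sup hS.2 Sy; lra.
near=> i.
have xf : x <= f i by near: i.
have fe : ~ (sup S + e <= f i) by near: i.
by rewrite ler_norml; lra.
Unshelve. all: by end_near. Qed.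

End ultra_limit.

Section bicontent_limit.
Context d1 d2 (X : measurableType d1) (Y : measurableType d2) (R : realType).
Variables (lam : {finite_measure set X -> \bar R})
  (rho : {finite_measure set Y -> \bar R}).
Variable F : set_system (set X -> set Y -> R).
Hypothesis FF : ProperFilter F.
Hypothesis F_bicontent : F (@bicontent _ _ X Y R).
Hypothesis F_lam : forall A e, measurable A -> 0 < e ->
  F [set Q | Q A setT <= fine (lam A) + e].
Hypothesis F_rho : forall B e, measurable B -> 0 < e ->
  F [set Q | Q setT B <= fine (rho B) + e].

Lemma bicontent_limit : exists U L, [/\ UltraFilter U, F `<=` U, bicontent L,
  forall A B, measurable A -> measurable B ->
    (fun Q => Q A B) @ U --> (L A B : R) &
  (forall A, measurable A -> L A setT <= fine (lam A)) /\
  (forall B, measurable B -> L setT B <= fine (rho B))].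
Proof.
have [U [UU FU]] := ultraFilterLemma FF.
have PU : ProperFilter U by case: UU.
have FilF : Filter F by case: FF.
have cv A B : measurable A -> measurable B ->
    exists l : R, (fun Q => Q A B) @ U --> l.
  move=> mA mB; apply: (@ultra_bounded_cvg _ _ _ _ (fine (lam A) + 1)) => //.
  apply: FU; apply: filterS2 F_bicontent (F_lam mA ltr01) => Q bQ /= QA.
  have [Q0 _ _] := bQ; rewrite Q0//= (le_trans _ QA)//.
  exact: (bicontent_mono bQ).
pose L A B : R := lim ((fun Q : set X -> set Y -> R => Q A B) @ U).
have cL A B : measurable A -> measurable B -> (fun Q => Q A B) @ U --> L A B.
  by move=> mA mB; apply/cvg_ex; exact: cv.
have Ubi : U (@bicontent _ _ X Y R) := FU _ F_bicontent.
exists U, L; split => //; first split.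
- move=> A B mA mB; apply: (cvgr_to_ge (cL A B mA mB)).
  by apply: filterS Ubi => Q [Q0 _ _]; exact: Q0.
- move=> B mB A A' mA mA' AA'.
  have c1 := cL _ _ (measurableU _ _ mA mA') mB.
  have c2 : (fun Q => Q (A `|` A') B) @ U --> (L A B + L A' B : R).
    apply: cvg_trans (cvgD (cL _ _ mA mB) (cL _ _ mA' mB)).
    by apply: near_eq_cvg; apply: filterS Ubi => Q [_ Q1 _]; rewrite [RHS]Q1.
  exact: cvg_unique c1 c2.
- move=> A mA B B' mB mB' BB'.
  have c1 := cL _ _ mA (measurableU _ _ mB mB').
  have c2 : (fun Q => Q A (B `|` B')) @ U --> (L A B + L A B' : R).
    apply: cvg_trans (cvgD (cL _ _ mA mB) (cL _ _ mA mB')).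
    by apply: near_eq_cvg; apply: filterS Ubi => Q [_ _ Q2]; rewrite [RHS]Q2.
  exact: cvg_unique c1 c2.
- split => [A mA|B mB]; apply/ler_addgt0Pr => e e0.
    by apply: (cvgr_to_le (cL A setT mA measurableT)); exact: (FU _ (F_lam mA e0)).
  by apply: (cvgr_to_le (cL setT B measurableT mB)); exact: (FU _ (F_rho mB e0)).
Qed.

End bicontent_limit.

(** * Approaching an orthant *)

Section approachability.
Context (R : realType) (T : finType).
Variables (V : set (T -> R)) (D : R).
Hypothesis V_convex : forall v s a, V v -> V s -> 0 <= a <= 1 ->
  V (fun t => a * v t + (1 - a) * s t).
Hypothesis V_bounded : forall v t, V v -> `|v t| <= D.
Hypothesis V_orthant : forall w : T -> R, (forall t, 0 <= w t) ->
  exists2 s, V s & \sum_t w t * s t <= 0.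

Let pos (x : R) := Num.max x 0.

Let pos_ge0 x : 0 <= pos x. Proof. by rewrite /pos le_max lexx orbT. Qed.
Let le_pos x : x <= pos x. Proof. by rewrite /pos le_max lexx. Qed.

(** Blackwell's argument: averaging in a point chosen against the positive part
    of the current average lets its squared norm decay like [1 / n]. *)
Let average n : exists2 v, V v &
  \sum_t pos (v t) ^+ 2 <= (#|T|%:R * D ^+ 2) / n.+1%:R.
Proof.
have sq_D v t : V v -> v t ^+ 2 <= D ^+ 2.
  move=> Vv; rewrite -(real_normK (num_real (v t))).
  by rewrite lerXn2r// ?nnegrE ?(le_trans _ (V_bounded t Vv)) ?V_bounded.
elim: n => [|n [v Vv IH]].
  have [//|s Vs _] := V_orthant (w := fun=> 0).
  exists s => //; rewrite divr1.
  apply: (@le_trans _ _ (\sum_(t : T) D ^+ 2)); last first.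
    by rewrite sumr_const mulr_natl.
  apply: ler_sum => t _; apply: le_trans (sq_D _ t Vs).
  rewrite /pos; case: (leP (s t) 0) => // st; first by rewrite expr0n/= sqr_ge0.
have [s Vs s0] := V_orthant (fun t => pos_ge0 (v t)).
set N : R := n.+1%:R in IH *.
have N0 : 0 < N by rewrite /N ltr0n.
have NE : n.+2%:R = N + 1 by rewrite /N -[n.+2]addn1 natrD.
exists (fun t => N / (N + 1) * v t + (1 - N / (N + 1)) * s t).
  apply: V_convex => //; apply/andP; split; first by apply: divr_ge0; lra.
  by rewrite ler_pdivrMr; lra.
have step t : pos (N / (N + 1) * v t + (1 - N / (N + 1)) * s t) ^+ 2 <=
    ((N * pos (v t)) ^+ 2 + 2 * N * (pos (v t) * s t) + D ^+ 2) / (N + 1) ^+ 2.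
  have -> : N / (N + 1) * v t + (1 - N / (N + 1)) * s t =
      (N * v t + s t) / (N + 1) by field; lra.
  set u := N * v t + s t.
  have uu : u <= N * pos (v t) + s t by rewrite lerD2r ler_pM2l.
  apply: (@le_trans _ _ ((N * pos (v t) + s t) ^+ 2 / (N + 1) ^+ 2)); last first.
    have N1 : 0 < (N + 1) ^- 2 by rewrite invr_gt0 exprn_gt0//; lra.
    rewrite ler_pM2r//; have := sq_D _ t Vs.
    set a := pos (v t); set b := s t; set D2 := D ^+ 2; nra.
  rewrite -expr_div_n /pos; case: (leP (u / (N + 1)) 0) => [_|u0].
    by rewrite expr0n/= sqr_ge0.
  rewrite lerXn2r// ?nnegrE; last by rewrite ler_pM2r// invr_gt0; lra.
    exact: ltW.
  apply: divr_ge0; last by lra.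
  by apply: le_trans uu; move: u0; rewrite pmulr_lgt0 ?invr_gt0; lra.
apply: le_trans (ler_sum _ (fun t _ => step t)) _.
rewrite -mulr_suml !big_split /= -mulr_sumr sumr_const.
under eq_bigr do rewrite exprMn.
rewrite -mulr_sumr NE ler_pdivrMr ?exprn_gt0//; last by lra.
move: IH; rewrite ler_pdivlMr// => IH.
have : 2 * N * \sum_t pos (v t) * s t <= 0 by rewrite mulr_ge0_le0//; lra.
have -> : #|T|%:R * D ^+ 2 / (N + 1) * (N + 1) ^+ 2 = (N + 1) * (#|T|%:R * D ^+ 2).
  by field; lra.
rewrite -[D ^+ 2 *+ _]mulr_natl.
have : N * (N * \sum_t pos (v t) ^+ 2) <= N * (#|T|%:R * D ^+ 2).
  by rewrite ler_pM2l// mulrC.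
lra.
Qed.

Lemma approach_orthant e : 0 < e -> exists2 v, V v & forall t, v t <= e.
Proof.
move=> e0; set K := #|T|%:R * D ^+ 2.
have K0 : 0 <= K by rewrite mulr_ge0// sqr_ge0.
pose n := Num.truncn (K / e ^+ 2).
have [v Vv vn] := average n; exists v => // t.
have e20 : 0 < e ^+ 2 by rewrite exprn_gt0.
have vt : pos (v t) ^+ 2 <= e ^+ 2.
  apply: (@le_trans _ _ (\sum_t pos (v t) ^+ 2)).
    rewrite (bigD1 t)//= lerDl; apply: sumr_ge0 => i _; exact: sqr_ge0.
  apply: le_trans vn _; rewrite -/K ler_pdivrMr ?ltr0n// mulrC.
  by rewrite -ler_pdivrMr// ltW// truncnS_gt.
apply: le_trans (le_pos _) _.
by rewrite -(@ler_pXn2r _ 2)// nnegrE// ltW.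
Qed.

End approachability.

(** * Duality for couplings with dominated marginals *)

Section finite_partition.
Context d (X : measurableType d) (R : realType) (T : finType).

Definition finite_measurable (i : X -> T) : Prop :=
  forall t, measurable (i @^-1` [set t]).

Lemma finite_measurable_preimage (i : X -> T) (P : pred T) :
  finite_measurable i -> measurable [set x | P (i x)].
Proof.
move=> mi; rewrite (_ : [set x | _] = \bigcup_(t in [set t | P t]) i @^-1` [set t]).
  by apply: fin_bigcup_measurable => // t _; exact: mi.
by apply/seteqP; split => [x Px|x [t /= Pt] /= ->//]; exists (i x).
Qed.

Lemma finite_measurable_comp (T' : finType) (i : X -> T) (g : T -> T') :
  finite_measurable i -> forall t, measurable ((g \o i) @^-1` [set t]).
Proof.
move=> mi t; rewrite (_ : _ @^-1` _ = [set x | g (i x) == t]).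
  exact: (finite_measurable_preimage (fun s => g s == t)).
by apply/seteqP; split => x /= /eqP.
Qed.

Lemma finite_measurable_ffun (b : X -> T -> bool) :
  (forall t, measurable [set x | b x t]) ->
  forall f, measurable ((fun x => [ffun t => b x t]) @^-1` [set f]).
Proof.
move=> mb f; rewrite (_ : _ @^-1` _ = \bigcap_(t in [set: T])
    (if f t then [set x | b x t] else ~` [set x | b x t])).
  by apply: fin_bigcap_measurable => // t _; case: ifP => // _; exact: measurableC.
apply/seteqP; split => [x <- t _|x bx].
  by rewrite ffunE; case: ifPn => //= h h'; move: h; rewrite h'.
apply/ffunP => t; rewrite ffunE; have := bx t I.
by case: (f t) => //= h; apply/negbTE/negP.
Qed.

Lemma additive_on_fibers (m : set X -> R) (i : X -> T) (P : pred T) :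
  additive_on_measurable m -> finite_measurable i ->
  m [set x | P (i x)] = \sum_(t | P t) m (i @^-1` [set t]).
Proof.
move=> addm mi.
have m0 : m set0 = 0.
  have := addm _ _ measurable0 measurable0 (setI0 _).
  by rewrite setU0 => /eqP; rewrite -subr_eq0 opprD addNKr oppr_eq0 => /eqP.
have key (s : seq T) : uniq s ->
    m [set x | i x \in s] = \sum_(t <- s) m (i @^-1` [set t]).
  elim: s => [_|t s IH /= /andP[ts us]].
    by rewrite big_nil -[RHS]m0; congr m; apply/seteqP; split.
  rewrite big_cons -IH// -addm//; last 2 first.
  - exact: (finite_measurable_preimage (fun x => x \in s)).
  - by apply/seteqP; split => // x [/= ->]; exact/negP.
  by congr m; apply/seteqP; split => x /=;
    rewrite inE; [move=> /orP[/eqP|]; [left|right]|move=> [->|->]; rewrite ?eqxx ?orbT].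
rewrite -big_filter -key; last by rewrite filter_uniq// index_enum_uniq.
by congr m; apply/seteqP; split => x /=; rewrite mem_filter mem_index_enum andbT.
Qed.

End finite_partition.

Lemma fine_measure_additive d (X : measurableType d) (R : realType)
    (mu : {finite_measure set X -> \bar R}) :
  additive_on_measurable (fine \o mu).
Proof.
move=> A B mA mB AB /=.
by rewrite -(fine_measureUI mu mA mB) AB measure0 addr0.
Qed.

Section cover_duality.
Context d1 d2 (X : measurableType d1) (Y : measurableType d2) (R : realType).
Variables (mu : {finite_measure set X -> \bar R})
  (nu : {finite_measure set Y -> \bar R}).

Let count_lt (a x : R) N : 0 < a -> 0 <= x ->
  \sum_(m < N) (a * m%:R < x)%R%:R <= x / a + 1 :> R.
Proof.
move=> a0 x0; elim: N => [|N IH].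
  by rewrite big_ord0 addr_ge0// divr_ge0// ltW.
rewrite big_ord_recr /=; case: ltP => [Nx|_]; last by rewrite addr0.
apply: (@le_trans _ _ (\sum_(m < N) 1 + 1)).
  by rewrite lerD2r; apply: ler_sum => m _; case: (_ < x).
by rewrite sumr_const card_ord lerD2r ler_pdivlMr// mulrC ltW.
Qed.

(** Weak duality between covers by sets and by functions: a fractional cover is
    an average of covers by its level sets, here in the form of a Riemann sum. *)
Lemma cover_cap_fractional (T1 T2 : finType) (i : X -> T1) (j : Y -> T2)
    (K : set (X * Y)) (c tau : R) (f : T1 -> R) (g : T2 -> R) :
  finite_measurable i -> finite_measurable j -> c <= cover_cap mu nu K ->
  0 <= c -> 0 <= tau -> (forall t, 0 <= f t) -> (forall t, 0 <= g t) ->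
  (forall z, K z -> tau <= f (i z.1) + g (j z.2)) ->
  c * tau <= \sum_t f t * fine (mu (i @^-1` [set t])) +
             \sum_t g t * fine (nu (j @^-1` [set t])).
Proof.
move=> mi mj cK c0; rewrite le_eqVlt => /predU1P[<- f0 g0 _|tau0 f0 g0 fgK].
  by rewrite mulr0 addr_ge0//; apply: sumr_ge0 => t _;
    rewrite mulr_ge0// fine_measure_ge0.
set S := \sum_t _ + _.
pose M := fine (mu setT) + fine (nu setT).
suff key N : N.+1%:R * (c * tau) <= N.+1%:R * S + tau * M.
  apply/ler_addgt0Pr => e e0.
  have := key (Num.truncn (tau * M / e)).
  have := truncnS_gt (tau * M / e).
  set N : R := _.+1%:R => NE; have N0 : 0 < N by rewrite ltr0n.
  move: NE; rewrite ltr_pdivrMr// => NE NS.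
  rewrite -(ler_pM2l N0); nra.
pose a := tau / N.+1%:R.
have N0 : 0 < N.+1%:R :> R by rewrite ltr0n.
have a0 : 0 < a by rewrite divr_gt0.
pose p t := fine (mu (i @^-1` [set t])); pose q t := fine (nu (j @^-1` [set t])).
have p0 t : 0 <= p t by exact: fine_measure_ge0.
have q0 t : 0 <= q t by exact: fine_measure_ge0.
have level (m : 'I_N.+1) : c <= \sum_t p t * (a * m%:R < f t)%R%:R +
    \sum_t q t * (a * (rev_ord m)%:R < g t)%R%:R.
  pose Mm := [set x | a * m%:R < f (i x)].
  pose Nm := [set y | a * (rev_ord m)%:R < g (j y)].
  have mMm : measurable Mm by exact: (finite_measurable_preimage (fun t => a * m%:R < f t)).
  have mNm : measurable Nm by exact: (finite_measurable_preimage (fun t => a * (rev_ord m)%:R < g t)).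
  apply: (le_trans cK); apply: (le_trans (cover_cap_le mu nu mMm mNm _)).
    move=> z /fgK fgz; have [|fz] := ltP (a * m%:R) (f (i z.1)); first by left.
    right; rewrite /Nm /=; apply: (@lt_le_trans _ _ (tau - a * m%:R)); last by lra.
    have -> : tau = a * N.+1%:R by rewrite /a divfK// gt_eqF.
    rewrite -mulrBr ltr_pM2l// natrB ?ltn_ord//.
    by rewrite -[m.+1]addn1 natrD; lra.
  rewrite /cover_cost lerD//.
    have := additive_on_fibers (fun t => a * m%:R < f t) (fine_measure_additive mu) mi.
    rewrite /= -/Mm => ->; rewrite big_mkcond /=; apply: ler_sum => t _.
    by case: ifP; rewrite ?mulr1 ?mulr0.
  have := additive_on_fibers (fun t => a * (rev_ord m)%:R < g t) (fine_measure_additive nu) mj.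
  rewrite /= -/Nm => ->; rewrite big_mkcond /=; apply: ler_sum => t _.
  by case: ifP; rewrite ?mulr1 ?mulr0.
have : \sum_(m < N.+1) c <= \sum_(m < N.+1)
    (\sum_t p t * (a * m%:R < f t)%R%:R + \sum_t q t * (a * (rev_ord m)%:R < g t)%R%:R).
  by apply: ler_sum => m _; exact: level.
rewrite sumr_const card_ord big_split /=.
rewrite [X in _ <= X + _]exchange_big [X in _ <= _ + X]exchange_big /=.
have sumM : \sum_t p t + \sum_t q t = M.
  have -> : \sum_t p t = fine (mu setT).
    by rewrite -(additive_on_fibers predT (fine_measure_additive mu) mi);
      congr (fine (mu _)); apply/seteqP.
  by rewrite -(additive_on_fibers predT (fine_measure_additive nu) mj);
    congr (_ + fine (nu _)); apply/seteqP.
have bf : \sum_t \sum_(m < N.+1) p t * (a * m%:R < f t)%R%:R <= \sum_t p t * (f t / a + 1).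
  by apply: ler_sum => t _; rewrite -mulr_sumr ler_wpM2l// count_lt.
have bg : \sum_t \sum_(m < N.+1) q t * (a * (rev_ord m)%:R < g t)%R%:R <=
    \sum_t q t * (g t / a + 1).
  apply: ler_sum => t _; rewrite -mulr_sumr ler_wpM2l//.
  rewrite (reindex_inj rev_ord_inj).
  under eq_bigr do rewrite rev_ordK.
  exact: count_lt.
move=> le1; have {le1 bf bg} le2 := le_trans le1 (lerD bf bg).
have split_sum (T : finType) (r h : T -> R) :
    \sum_t r t * (h t / a + 1) = (\sum_t h t * r t) / a + \sum_t r t.
  by rewrite mulr_suml -big_split; apply: eq_bigr => t _; rewrite mulrDr mulr1 mulrA (mulrC (r t)).
move: le2; rewrite !split_sum addrACA -mulrDl sumM -/S.
rewrite -(ler_pM2r tau0) mulrDl.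
have -> : S / a * tau = N.+1%:R * S by rewrite /a; field; rewrite !gt_eqF.
by rewrite (mulrC M) -[c *+ _]mulr_natl -mulrA.
Qed.

End cover_duality.

Section kernel_joint_measure.
Context d1 d2 (X : measurableType d1) (Y : measurableType d2) (R : realType).

Lemma kernel_joint_measure (lam : {measure set X -> \bar R})
    (k : R.-pker X ~> Y) : exists P : {measure set (X * Y) -> \bar R},
  forall S, P S = (\int[lam]_x k x (xsection S x))%E.
Proof.
pose P S := (\int[lam]_x k x (xsection S x))%E.
have P0 : P set0 = 0%E by rewrite [LHS]integral0_eq// => x _; rewrite xsection0.
have Pge0 S : (0 <= P S)%E by apply: integral_ge0.
have Padd : semi_sigma_additive P.
  move=> F mF tF mUF.
  rewrite [X in _ --> X](_ : _ = (\sum_(n <oo) P (F n))%E).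
    by apply/cvg_closeP; split; [exact: is_cvg_nneseries|rewrite closeE].
  rewrite -integral_nneseries//; last first.
    by move=> n; apply: measurable_fun_xsection_finite_kernel; rewrite inE.
  apply: eq_integral => x _; apply/esym/cvg_lim => //=; rewrite xsection_bigcup.
  apply: (measure_sigma_additive _ (trivIset_xsection tF)) => n.
  exact: measurable_xsection.
pose M : {measure set (X * Y) -> \bar R} :=
  HB.pack P (isMeasure.Build _ (X * Y)%type R P P0 Pge0 Padd).
by exists M.
Qed.

End kernel_joint_measure.

Section measure_of_bicontent.
Context d (X : measurableType d) (R : realType).

Lemma bicontent_measure (L : set X -> set (measurableTypeR R) -> R)
    (lam : {finite_measure set X -> \bar R}) (rho : fmeasR R) :
  bicontent L -> (forall A, measurable A -> L A setT <= fine (lam A)) ->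
  (forall B, measurable B -> L setT B <= fine (rho B)) ->
  exists P : {measure set (X * measurableTypeR R) -> \bar R},
    forall A B, measurable A -> measurable B -> P (A `*` B) = (L A B)%:E.
Proof.
move=> biL Llam Lrho; have [L0 L1 L2] := biL.
have [lam1 lam1E] : exists lam1 : {finite_measure set X -> \bar R},
    forall A, measurable A -> lam1 A = (L A setT)%:E.
  apply: (dominated_content_measure (lam := lam)) => [|A mA|A mA].
  - exact: L1.
  - exact: L0.
  - exact: Llam.
have [|k kL] := @bicontent_kernel _ _ _ L lam1 rho biL _ Lrho.
  by move=> A mA; rewrite lam1E.
have [P PE] := kernel_joint_measure lam1 k.
exists P => A B mA mB; rewrite PE -kL// [RHS]integral_mkcond.
apply: eq_integral => x _; rewrite patchE; case: ifPn => xA.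
  by rewrite in_xsectionX.
by rewrite notin_xsectionX// measure0.
Qed.

End measure_of_bicontent.

Section carried.
Context d1 d2 (X : measurableType d1) (Y : measurableType d2) (R : realType).

Definition carried (K : set (X * Y)) (c : R) (Q : set X -> set Y -> R) : Prop :=
  [/\ bicontent Q, Q setT setT = c &
      forall A B, (A `*` B) `&` K = set0 -> Q A B = 0].

Lemma carried_convex K c Q1 Q2 a : carried K c Q1 -> carried K c Q2 ->
  0 <= a <= 1 -> carried K c (fun A B => a * Q1 A B + (1 - a) * Q2 A B).
Proof.
move=> [[p1 l1 r1] t1 s1] [[p2 l2 r2] t2 s2] /andP[a0 a1]; split; first split.
- by move=> A B mA mB; rewrite addr_ge0// mulr_ge0 ?p1 ?p2// subr_ge0.
- by move=> B mB A A' mA mA' AA'; rewrite l1// l2//; ring.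
- by move=> A mA B B' mB mB' BB'; rewrite r1// r2//; ring.
- by rewrite t1 t2; ring.
- by move=> A B AB; rewrite s1// s2// !mulr0 addr0.
Qed.

Let indic_setU (T : Type) (A B : set T) (x : T) : A `&` B = set0 ->
  \1_(A `|` B) x = \1_A x + \1_B x :> R.
Proof.
move=> AB; rewrite !indicE in_setU.
case: (boolP (x \in A)) => [/set_mem xA|_]; last by rewrite add0r.
rewrite memNset ?addr0// => xB.
by have : (A `&` B) x by []; rewrite AB.
Qed.

Lemma carried_point K c z : 0 <= c -> K z ->
  carried K c (fun A B => c * (\1_A z.1 * \1_B z.2)).
Proof.
move=> c0 Kz; split; first split.
- by move=> A B _ _; rewrite mulr_ge0// mulr_ge0.
- by move=> B _ A A' _ _ AA'; rewrite indic_setU//; ring.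
- by move=> A _ B B' _ _ BB'; rewrite indic_setU//; ring.
- by rewrite !indicT !mulr1.
- move=> A B AB; rewrite !indicE; case: (boolP (z.1 \in A)) => [/set_mem zA|];
    last by rewrite mul0r mulr0.
  case: (boolP (z.2 \in B)) => [/set_mem zB|]; last by rewrite mulr0 mulr0.
  by have : ((A `*` B) `&` K) z by []; rewrite AB.
Qed.

End carried.

Section finite_duality.
Context d1 d2 (X : measurableType d1) (Y : measurableType d2) (R : realType).
Variables (mu : {finite_measure set X -> \bar R})
  (nu : {finite_measure set Y -> \bar R}).
Variables (K : set (X * Y)) (c : R).
Hypotheses (c0 : 0 < c) (cK : c <= cover_cap mu nu K).

Lemma carried_approx_partition (T1 T2 : finType) (i : X -> T1) (j : Y -> T2) e :
  finite_measurable i -> finite_measurable j -> 0 < e ->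
  exists Q, [/\ carried K c Q,
    forall t, Q (i @^-1` [set t]) setT <= fine (mu (i @^-1` [set t])) + e &
    forall t, Q setT (j @^-1` [set t]) <= fine (nu (j @^-1` [set t])) + e].
Proof.
move=> mi mj e0.
have [z0 Kz0] : K !=set0.
  apply/set0P/eqP => K0; move: cK; apply/negP; rewrite -ltNge.
  apply: le_lt_trans c0; apply: le_trans (cover_cap_le mu nu measurable0 measurable0 _) _.
    by move=> z; rewrite K0.
  by rewrite /cover_cost !measure0 addr0.
pose vec (Q : set X -> set Y -> R) (t : T1 + T2) : R := match t with
  | inl t => Q (i @^-1` [set t]) setT - fine (mu (i @^-1` [set t]))
  | inr t => Q setT (j @^-1` [set t]) - fine (nu (j @^-1` [set t])) end.
pose V := [set v | exists2 Q, carried K c Q & v = vec Q].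
suff [v [Q cQ ->] vQ] : exists2 v, V v & forall t, v t <= e.
  exists Q; split => // t; rewrite -lerBlDl.
    exact: (vQ (inl t)).
  exact: (vQ (inr t)).
apply: (@approach_orthant R _ V (c + fine (mu setT) + fine (nu setT))) => //.
- move=> _ _ a [Q1 cQ1 ->] [Q2 cQ2 ->] a01.
  exists (fun A B => a * Q1 A B + (1 - a) * Q2 A B); first exact: carried_convex.
  by apply/funext => -[t|t] /=; ring.
- move=> _ t [Q cQ ->]; have [bQ QT _] := cQ; have [Q0 _ _] := bQ.
  have [mup nup] := (fine_measure_ge0 mu setT, fine_measure_ge0 nu setT).
  case: t => t /=.
    have := Q0 _ _ (mi t) measurableT.
    have := bicontent_mono bQ (mi t) measurableT measurableT measurableT (@subsetT _ _) (@subsetT _ _).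
    have := fine_measure_ge0 mu (i @^-1` [set t]).
    have := le_fine_measure mu (mi t) measurableT (@subsetT _ _).
    by rewrite QT => *; rewrite ler_norml; lra.
  have := Q0 _ _ measurableT (mj t).
  have := bicontent_mono bQ measurableT measurableT (mj t) measurableT (@subsetT _ _) (@subsetT _ _).
  have := fine_measure_ge0 nu (j @^-1` [set t]).
  have := le_fine_measure nu (mj t) measurableT (@subsetT _ _).
  by rewrite QT => *; rewrite ler_norml; lra.
- move=> w w0; pose f t := w (inl t); pose g t := w (inr t).
  pose hit (p : T1 * T2) := `[< exists2 z, K z & (i z.1, j z.2) = p >].
  have hit0 : hit (i z0.1, j z0.2) by apply/asboolP; exists z0.
  (* the cell met by [K] where the price is least *)
  case: (arg_minP (fun p : T1 * T2 => f p.1 + g p.2) hit0) => p /asboolP[z Kz zp] pmin.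
  exists (vec (fun A B => c * (\1_A z.1 * \1_B z.2))).
    by exists (fun A B => c * (\1_A z.1 * \1_B z.2)) => //; exact: (carried_point (ltW c0)).
  have pmin' z' : K z' -> f p.1 + g p.2 <= f (i z'.1) + g (j z'.2).
    by move=> Kz'; apply: (pmin (i z'.1, j z'.2)); apply/asboolP; exists z'.
  have := cover_cap_fractional mi mj cK (ltW c0) (addr_ge0 (w0 (inl p.1)) (w0 (inr p.2)))
    (fun t => w0 (inl t)) (fun t => w0 (inr t)) pmin'.
  have -> : \sum_t w t * vec (fun A B => c * (\1_A z.1 * \1_B z.2)) t =
      (c * f p.1 - \sum_t f t * fine (mu (i @^-1` [set t]))) +
      (c * g p.2 - \sum_t g t * fine (nu (j @^-1` [set t]))).
    rewrite big_sumType /=; congr (_ + _).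
      under eq_bigr do rewrite mulrBr.
      rewrite sumrB (bigD1 p.1)//= big1 ?addr0.
        rewrite indicT mulr1 indicE mem_set ?mulr1 1?mulrC//.
        by rewrite -zp.
      move=> t tp; rewrite indicE memNset ?mul0r ?mulr0//= => it.
      by move: tp; rewrite -zp /= it eqxx.
    under eq_bigr do rewrite mulrBr.
    rewrite sumrB (bigD1 p.2)//= big1 ?addr0.
      rewrite indicT mul1r indicE mem_set ?mulr1 1?mulrC//.
      by rewrite -zp.
    move=> t tp; rewrite indicT mul1r indicE memNset ?mulr0//= => it.
    by move: tp; rewrite -zp /= it eqxx.
  by rewrite -/(f p.1) -/(g p.2); lra.
Qed.

End finite_duality.

Section membership_partition.
Context d (X : measurableType d) (R : realType).
Variables (A : nat -> set X) (n : nat).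
Hypothesis mA : forall k, measurable (A k).

Definition membership (x : X) : {ffun 'I_n -> bool} := [ffun k => x \in A (val k)].

Lemma finite_measurable_membership : finite_measurable membership.
Proof.
apply: finite_measurable_ffun => k.
rewrite (_ : [set x | _] = A k)//.
by apply/seteqP; split => x /=; [exact: set_mem|exact: mem_set].
Qed.

Lemma membershipE k (kn : (k < n)%N) :
  A k = [set x | membership x (Ordinal kn)].
Proof.
by apply/seteqP; split => x; rewrite /= ffunE /=; [exact: mem_set|exact: set_mem].
Qed.

End membership_partition.

Section kellerer.
Context d (X : measurableType d) (R : realType).
Variables (mu : {finite_measure set X -> \bar R}) (nu : fmeasR R).
Implicit Type K : set (X * measurableTypeR R).

Lemma carried_approx_sets K (c : R) (A : nat -> set X)
    (B : nat -> set (measurableTypeR R)) n (e : R) :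
  0 < c -> c <= cover_cap mu nu K ->
  (forall k, measurable (A k)) -> (forall k, measurable (B k)) -> 0 < e ->
  exists Q, [/\ carried K c Q,
    forall k, (k < n)%N -> Q (A k) setT <= fine (mu (A k)) + e &
    forall k, (k < n)%N -> Q setT (B k) <= fine (nu (B k)) + e].
Proof.
move=> c0 cK mA mB e0.
pose T : finType := {ffun 'I_n -> bool}.
have T0 : 0 < #|T|%:R :> R by rewrite ltr0n; apply/card_gt0P; exists [ffun=> true].
have e'0 : 0 < e / #|T|%:R by rewrite divr_gt0.
have mi := finite_measurable_membership (n := n) mA.
have mj := finite_measurable_membership (n := n) mB.
have [Q [cQ Qi Qj]] := carried_approx_partition c0 cK mi mj e'0.
have [[Q0 Q1 Q2] _ _] := cQ.
have sum_e (P : pred T) : \sum_(t | P t) (e / #|T|%:R) <= e.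
  rewrite sumr_const -[leRHS](divfK (lt0r_neq0 T0)).
  by rewrite -(mulr_natr (e / _)) ler_wpM2l ?(ltW e'0)// ler_nat max_card.
exists Q; split => // k kn.
  rewrite (membershipE A kn).
  rewrite (additive_on_fibers (fun t : T => t (Ordinal kn)) (Q1 _ measurableT) mi).
  have /= -> := additive_on_fibers (fun t : T => t (Ordinal kn)) (fine_measure_additive mu) mi.
  apply: le_trans (ler_sum _ (fun t _ => Qi t)) _.
  by rewrite big_split lerD2l.
rewrite (membershipE B kn).
rewrite (additive_on_fibers (fun t : T => t (Ordinal kn)) (Q2 _ measurableT) mj).
have /= -> := additive_on_fibers (fun t : T => t (Ordinal kn)) (fine_measure_additive nu) mj.
apply: le_trans (ler_sum _ (fun t _ => Qj t)) _.
by rewrite big_split lerD2l.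
Qed.

Section decreasing.
Variables (K : nat -> set (X * measurableTypeR R)) (c : R).
Hypotheses (rK : forall n, rect_closed (K n)) (dK : forall n, K n.+1 `<=` K n).
Hypotheses (c0 : 0 < c) (cK : forall n, c <= cover_cap mu nu (K n)).

(** Rectangles missing some [K n] are null for all late approximations, hence for
    the limit; the complement of the intersection is a countable union of these. *)
Lemma kellerer_closed : exists pi : {measure set (X * measurableTypeR R) -> \bar R},
  [/\ forall A, measurable A -> (pi (A `*` setT) <= mu A)%E,
      forall B, measurable B -> (pi (setT `*` B) <= nu B)%E,
      pi setT = c%:E & pi (~` \bigcap_n K n) = 0%E].
Proof.
pose ok (i : set X + set (measurableTypeR R)) :=
  match i with inl A => measurable A | inr B => measurable B end.
pose C i e (Q : set X -> set (measurableTypeR R) -> R) := match i with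
  | inl A => Q A setT <= fine (mu A) + e
  | inr B => Q setT B <= fine (nu B) + e end.
have [] := @finite_constraints_filter R _ _ (fun n => carried (K n) c) ok C.
- move=> n Q [bQ QT QK]; split => // A B AB; apply: QK.
  by apply/seteqP; split => // z [? /dK ?]; rewrite -AB.
- by move=> [A|B] e e' ee' Q /= /le_trans; apply; rewrite lerD2l.
- by exists (inl setT) => /=.
- move=> n a e oka e0.
  pose A k := if a k is inl A then A else set0.
  pose B k := if a k is inr B then B else set0.
  have mA k : measurable (A k) by rewrite /A; have := oka k; case: (a k).
  have mB k : measurable (B k) by rewrite /B; have := oka k; case: (a k).
  have [Q [cQ QA QB]] := carried_approx_sets n c0 (cK n) mA mB e0.
  exists Q => // k kn; have := QA k kn; have := QB k kn; rewrite /A /B.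
  by case: (a k).
move=> F [FF F_n F_C].
have F_bi : F (@bicontent _ _ X (measurableTypeR R) R).
  by apply: filterS (F_n 0%N) => Q [].
have F_mu A (e : R) (mA : measurable A) (e0 : 0 < e) := F_C (inl A) e mA e0.
have F_nu B (e : R) (mB : measurable B) (e0 : 0 < e) := F_C (inr B) e mB e0.
have [U [L [UU FU biL cL [Lmu Lnu]]]] := bicontent_limit FF F_bi F_mu F_nu.
have PU : ProperFilter U by case: UU.
have [pi piE] := bicontent_measure biL Lmu Lnu.
exists pi; split.
- by move=> A mA; rewrite piE// -fine_measureK// lee_fin Lmu.
- by move=> B mB; rewrite piE// -fine_measureK// lee_fin Lnu.
- rewrite -setXTT piE//; congr EFin.
  have h : (fun Q => Q setT setT) @ U --> c.
    by apply: cvg_near_cst; apply: FU; apply: filterS (F_n 0%N) => Q [].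
  exact: cvg_unique (cL _ _ measurableT measurableT) h.
- rewrite setC_bigcap; apply/eqP; rewrite -measure_le0.
  have [A /choice[B AB]] := choice rK.
  have AB0 n m : pi (A n m `*` B n m) = 0%E.
    have [mA mB CK] := AB n; rewrite piE//; congr EFin.
    have h : (fun Q => Q (A n m) (B n m)) @ U --> (0 : R).
      apply: cvg_near_cst; apply: FU; apply: filterS (F_n n) => Q [_ _ QK].
      apply/QK/seteqP; split => // z [ABz Kz].
      by have : (~` K n) z by rewrite CK; exists m.
    exact: cvg_unique (cL _ _ (mA m) (mB m)) h.
  rewrite measure_le0; apply/eqP/negligibleP.
    apply: bigcupT_measurable => n; have [mA mB ->] := AB n.
    by apply: bigcupT_measurable => m; exact: measurableX.
  apply: negligible_bigcup => n; have [mA mB ->] := AB n.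
  apply: negligible_bigcup => m; apply/negligibleP; last exact: AB0.
  exact: measurableX.
Qed.

End decreasing.

Lemma kellerer (B : set (X * measurableTypeR R)) : measurable B ->
  (exists M N, [/\ mu.-negligible M, nu.-negligible N & covers M N B]) \/
  (exists2 pi : {measure set (X * measurableTypeR R) -> \bar R},
     [/\ forall A, measurable A -> (pi (A `*` setT) <= mu A)%E,
      forall B, measurable B -> (pi (setT `*` B) <= nu B)%E,
      (0 < pi setT)%E & (pi setT < +oo)%E] & pi (~` B) = 0%E).
Proof.
move=> mB; have [M [N [mM mN MNB le]]] := cover_cap_attained mu nu B.
have [cap0|cap0] := leP (cover_cap mu nu B) 0.
  left; exists M, N; have := le_trans le cap0; rewrite /cover_cost.
  have := fine_measure_ge0 mu M; have := fine_measure_ge0 nu N => N0 M0 MN0.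
  split => //.
    apply/negligibleP => //; transitivity (fine (mu M))%:E.
      by rewrite fine_measureK.
    by congr EFin; lra.
  apply/negligibleP => //; transitivity (fine (nu N))%:E.
    by rewrite fine_measureK.
  by congr EFin; lra.
right; pose c := cover_cap mu nu B / 2.
have c0 : 0 < c by rewrite divr_gt0.
have cB : c < cover_cap mu nu B by rewrite /c; lra.
have inc (A : nat -> set (X * measurableTypeR R)) L : nondecreasing_seq A ->
    (forall n, cover_cap mu nu (A n) <= L) -> cover_cap mu nu (\bigcup_n A n) <= L.
  move=> ndA AL; have [M' [N' [mM' mN' cov cost]]] := cover_bigcup ndA AL.
  exact: le_trans (cover_cap_le mu nu mM' mN' cov) cost.
have [K [rK dK cK KB]] := suslin_capacitable (@le_cover_cap _ _ _ _ _ mu nu) inc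
  (measurable_suslin mB) cB.
have [pi [pi1 pi2 piT piK]] := kellerer_closed rK dK c0 cK.
exists pi; first by split => //; rewrite piT ?lte_fin ?ltry.
have mK : measurable (~` \bigcap_n K n).
  rewrite setC_bigcap; apply: bigcupT_measurable => n.
  have [A [B' [mA mB' ->]]] := rK n.
  by apply: bigcupT_measurable => m; exact: measurableX.
apply/eqP; rewrite -measure_le0 -piK; apply: le_measure; rewrite ?inE//.
  exact: measurableC.
exact: subsetC.
Qed.

End kellerer.

(** * First moments as limits of finite sums *)

Section integral_approximation.
Context d (T : measurableType d) (R : realType).
Implicit Types (nu : {finite_measure set T -> \bar R})
  (kap : {measure set T -> \bar R}).

Lemma le_measure_integrable (nu : {measure set T -> \bar R}) kap (f : T -> \bar R) :
  (forall B, measurable B -> (kap B <= nu B)%E) ->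
  nu.-integrable setT f -> kap.-integrable setT f.
Proof.
move=> le_kn /integrableP[mf fi]; apply/integrableP; split => //.
apply: le_lt_trans fi; apply: ge0_le_measure_integral => //.
exact: measurableT_comp.
Qed.

Import HBNNSimple.

Let ge0_approx nu (f : T -> R) e : (forall x, 0 <= f x) ->
  nu.-integrable setT (EFin \o f) -> 0 < e ->
  exists (I : finType) (c : I -> R) (B : I -> set T), (forall k, measurable (B k)) /\
  forall kap, (forall B, measurable B -> (kap B <= nu B)%E) ->
    `|\int[kap]_x f x - \sum_k c k * fine (kap (B k))| <= e.
Proof.
move=> f0 intf e0.
have mf : measurable_fun setT (EFin \o f) := measurable_int nu intf.
pose s := nnsfun_approx measurableT mf.
have s_le n x : s n x <= f x.
  rewrite -lee_fin.
  have cv : (EFin \o s^~ x) m @[m --> \oo] --> (EFin \o f) x.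
    by apply: cvg_nnsfun_approx => // y _; rewrite lee_fin.
  rewrite -[leRHS](cvg_lim _ cv)//; apply: lime_ge; first by apply/cvg_ex; eexists; exact: cv.
  exists n => // m /= nm; rewrite lee_fin.
  by have /lefP := @nd_nnsfun_approx _ _ _ _ measurableT _ mf _ _ nm; exact.
have int_s kap n : kap.-integrable setT (EFin \o f) -> kap.-integrable setT (EFin \o s n).
  apply: le_integrable => //; first exact/measurable_EFinP.
  by move=> x _; rewrite /= lee_fin !ger0_norm// f0.
have [n sn] : exists n, \int[nu]_x f x - \int[nu]_x s n x <= e.
  have cv : (\int[nu]_x (s n x)%:E)%E @[n --> \oo] --> (\int[nu]_x (f x)%:E)%E.
    rewrite (eq_integral (fun x => limn (fun n => (s n x)%:E))); last first.
      move=> x _; apply/esym/cvg_lim => //.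
      by apply: (cvg_nnsfun_approx measurableT mf) => // y _; rewrite lee_fin.
    apply: cvg_monotone_convergence => //.
    - by move=> m; apply/measurable_EFinP.
    - by move=> m x _; rewrite lee_fin.
    - move=> x _ m p mp; rewrite lee_fin.
      by have /lefP := @nd_nnsfun_approx _ _ _ _ measurableT _ mf _ _ mp; exact.
  have fi : (\int[nu]_x (f x)%:E)%E \is a fin_num by exact: integrable_fin_num.
  move: cv; rewrite -(fineK fi) => /fine_cvg /cvgrPdist_le /(_ _ e0)[n _ /(_ n (leqnn n))].
  move=> h; exists n; move: h; rewrite /Rintegral /=.
  exact/le_trans/ler_norm.
pose l := finmap.enum_fset (fset_set (range (s n))).
exists ('I_(size l)), (fun k : 'I_(size l) => l`_k), (fun k : 'I_(size l) => s n @^-1` [set l`_k]).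
split => // kap le_kn.
have intfk := le_measure_integrable le_kn intf.
have -> : \sum_(k < size l) l`_k * fine (kap (s n @^-1` [set l`_k])) =
    \int[kap]_x s n x.
  rewrite /Rintegral integralT_nnsfun sintegralE fsbig_finite//=.
  rewrite -sum_fine => [|r _]; last first.
    rewrite fin_numM// ge0_fin_numE//; apply: le_lt_trans (le_kn _ _) _ => //.
    by rewrite -ge0_fin_numE// fin_num_measure.
  rewrite [RHS](big_nth 0) big_mkord; apply: eq_bigr => k _.
  rewrite fineM// ge0_fin_numE//; apply: le_lt_trans (le_kn _ _) _ => //.
  by rewrite -ge0_fin_numE// fin_num_measure.
rewrite -RintegralB//; last exact: int_s.
rewrite ger0_norm; last by apply: Rintegral_ge0 => x _; rewrite subr_ge0.
apply: le_trans sn; rewrite -RintegralB//; last exact: int_s.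
have intB (m : {measure set T -> \bar R}) : m.-integrable setT (EFin \o f) ->
    m.-integrable setT (EFin \o (fun x => f x - s n x)).
  move=> intm; rewrite (_ : _ \o _ = (EFin \o f) \- (EFin \o s n))%E//.
  by apply: integrableB => //; exact: int_s.
apply: fine_le; [exact: integrable_fin_num (intB _ _)|exact: integrable_fin_num (intB _ _)|].
apply: ge0_le_measure_integral => //.
  by move=> x; rewrite lee_fin subr_ge0.
by apply/measurable_EFinP/measurable_funB => //; exact/measurable_EFinP.
Qed.


(** One finite sum approximates the integral for all dominated measures at once:
    integrals of such measures are thereby linear in the measure and continuous
    for convergence on each measurable set. *)
Lemma integrable_approx nu (f : T -> R) e :
  nu.-integrable setT (EFin \o f) -> 0 < e ->
  exists (I : finType) (c : I -> R) (B : I -> set T), (forall k, measurable (B k)) /\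
  forall kap, (forall B, measurable B -> (kap B <= nu B)%E) ->
    `|\int[kap]_x f x - \sum_k c k * fine (kap (B k))| <= e.
Proof.
move=> intf e0; have e20 : 0 < e / 2 by rewrite divr_gt0.
pose p x := Num.max (f x) 0; pose q x := Num.max (- f x) 0.
have mf : measurable_fun setT f by apply/measurable_EFinP; exact: measurable_int intf.
have intp : nu.-integrable setT (EFin \o p).
  apply: le_integrable intf => //.
    by apply/measurable_EFinP; exact: measurable_maxr.
  by move=> x _; rewrite /p lee_fin; case: (leP (f x) 0) => // _; rewrite normr0.
have intq : nu.-integrable setT (EFin \o q).
  apply: le_integrable intf => //.
    by apply/measurable_EFinP/measurable_maxr => //; exact: measurableT_comp.
  by move=> x _; rewrite /q lee_fin; case: (leP (- f x) 0) => // _; rewrite ?normr0 ?normrN.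
have p0 x : 0 <= p x by rewrite /p le_max lexx orbT.
have q0 x : 0 <= q x by rewrite /q le_max lexx orbT.
have [I [c [B [mB cB]]]] := ge0_approx p0 intp e20.
have [J [c' [B' [mB' cB']]]] := ge0_approx q0 intq e20.
exists (I + J)%type, (fun k => match k with inl i => c i | inr j => - c' j end),
  (fun k => match k with inl i => B i | inr j => B' j end).
split=> [[i|j]//|kap kn].
have -> : \int[kap]_x f x = \int[kap]_x p x - \int[kap]_x q x.
  rewrite -RintegralB//; [|exact: le_measure_integrable intp|exact: le_measure_integrable intq].
  apply: eq_Rintegral => x _; rewrite /p /q.
  by case: (leP (f x) 0); case: (leP (- f x) 0); lra.
rewrite big_sumType /=.
have -> : \sum_i - c' i * fine (kap (B' i)) = - \sum_i c' i * fine (kap (B' i)).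
  by rewrite -sumrN; apply: eq_bigr => j _; rewrite mulNr.
have := cB _ kn; have := cB' _ kn.
by rewrite !ler_norml; lra.
Qed.

End integral_approximation.

Section integrals_and_measures.
Context d (T : measurableType d) (R : realType).

Lemma eq_from_approx (x y k : R) : (forall e, 0 < e -> `|x - y| <= k * e) -> x = y.
Proof.
move=> xy; apply/eqP; rewrite -subr_eq0 -normr_eq0; apply/eqP.
apply/eqP; rewrite eq_le normr_ge0 andbT; apply/ler_addgt0Pr => e e0.
have k0 : 0 < `|k| + 1 by apply: ltr_pwDr.
have := xy (e / (`|k| + 1)) (divr_gt0 e0 k0) => /le_trans; apply.
rewrite add0r mulrCA -[leRHS]mulr1 ler_wpM2l ?(ltW e0)// ler_pdivrMr// mul1r.
by rewrite (le_trans (ler_norm _))// lerDl.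
Qed.

Lemma Rintegral_measureD (kap : {finite_measure set T -> \bar R})
    (kap1 kap2 : {measure set T -> \bar R}) (f : T -> R) :
  (forall B, measurable B -> kap B = (kap1 B + kap2 B)%E) ->
  kap.-integrable setT (EFin \o f) ->
  \int[kap]_x f x = \int[kap1]_x f x + \int[kap2]_x f x.
Proof.
move=> kE intf; apply: (@eq_from_approx _ _ 3) => e e0.
have [I [c [B [mB cB]]]] := integrable_approx intf e0.
have le1 C : measurable C -> (kap1 C <= kap C)%E by move=> mC; rewrite kE// leeDl.
have le2 C : measurable C -> (kap2 C <= kap C)%E by move=> mC; rewrite kE// leeDr.
have := cB _ le1; have := cB _ le2; have := cB kap (fun _ _ => lexx _).
have fin m C : measurable C -> (m C <= kap C)%E -> (0 <= m C)%E -> m C \is a fin_num.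
  move=> mC mk m0; rewrite ge0_fin_numE// (le_lt_trans mk)//.
  by rewrite -ge0_fin_numE// fin_num_measure.
have -> : \sum_k c k * fine (kap (B k)) =
    \sum_k c k * fine (kap1 (B k)) + \sum_k c k * fine (kap2 (B k)).
  rewrite -big_split; apply: eq_bigr => k _; rewrite kE// fineD ?mulrDr//.
    by apply: fin (le1 _ _) _.
  by apply: fin (le2 _ _) _.
rewrite !ler_norml; lra.
Qed.

Lemma Rintegral_restricted_measure (mu kap : {measure set T -> \bar R}) (D : set T)
    (f : T -> R) : measurable D ->
  (forall B, measurable B -> kap B = mu (D `&` B)) ->
  mu.-integrable setT (EFin \o f) ->
  \int[kap]_x f x = \int[mu]_(x in D) f x.
Proof.
move=> mD kE intf; rewrite /Rintegral; congr fine.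
have intk : kap.-integrable setT (EFin \o f).
  apply: le_measure_integrable intf => B mB; rewrite kE//.
  by apply: le_measure; rewrite ?inE//; exact: measurableI.
have mDC : measurable (~` D) by exact: measurableC.
rewrite (negligible_integral mDC measurableT intk) ?setTD ?setCK; last first.
  by rewrite kE// setICr measure0.
by apply: eq_measure_integral => A mA AD; rewrite kE// setIidr.
Qed.

Lemma integrable_step_affine (mu : {finite_measure set T -> \bar R}) (I : finType)
    (i : T -> I) (v w : I -> R) (f : T -> R) :
  finite_measurable i -> mu.-integrable setT (EFin \o f) ->
  mu.-integrable setT (fun x => (v (i x) + w (i x) * f x)%:E).
Proof.
move=> mi intf.
have -> : (fun x => (v (i x) + w (i x) * f x)%:E) = (fun x =>
    (\sum_t (((fun x => (v t + w t * f x)%:E) \_ (i @^-1` [set t])) x))%E).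
  apply/funext => x; rewrite (bigD1 (i x))//= big1 ?adde0.
    by rewrite patchE mem_set.
  by move=> t tx; rewrite patchE memNset//= => it; move: tx; rewrite it eqxx.
apply: integrable_sum => // t _.
apply/(integrable_mkcond _ (mi t)).
apply: (@integrableS _ _ _ _ setT) => //.
under eq_fun do rewrite EFinD EFinM.
apply: integrableD => //; first exact: finite_measure_integrable_cst.
exact: integrableZl.
Qed.

Lemma Rintegral_step_affine (mu : {finite_measure set T -> \bar R}) (I : finType)
    (i : T -> I) (v w : I -> R) (f : T -> R) :
  finite_measurable i -> mu.-integrable setT (EFin \o f) ->
  \int[mu]_x (v (i x) + w (i x) * f x) =
  \sum_t (v t * fine (mu (i @^-1` [set t])) + w t * \int[mu]_(x in i @^-1` [set t]) f x).
Proof.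
move=> mi intf.
have intt t D : measurable D -> mu.-integrable D (EFin \o (fun x => v t + w t * f x)).
  move=> mD; apply: (@integrableS _ _ _ _ setT) => //.
  rewrite (_ : _ \o _ = (fun=> (v t)%:E) \+ (fun x => (w t)%:E * (EFin \o f) x))%E//.
  apply: integrableD => //; first exact: finite_measure_integrable_cst.
  exact: integrableZl.
have -> : \int[mu]_x (v (i x) + w (i x) * f x) =
    fine (\int[mu]_x \sum_t (((fun x => (v t + w t * f x)%:E) \_ (i @^-1` [set t])) x))%E.
  congr fine; apply: eq_integral => x _; rewrite (bigD1 (i x))//= big1 ?adde0.
    by rewrite patchE mem_set.
  by move=> t tx; rewrite patchE memNset//= => it; move: tx; rewrite it eqxx.
rewrite integral_sum//; last first.
  by move=> t; apply/(integrable_mkcond _ (mi t)); exact: intt.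
rewrite -sum_fine; last first.
  move=> t _; rewrite -integral_mkcond; apply: integrable_fin_num => //; exact: intt.
apply: eq_bigr => t _; rewrite -integral_mkcond.
rewrite -[LHS]/(\int[mu]_(x in i @^-1` [set t]) (v t + w t * f x)).
have intD : mu.-integrable (i @^-1` [set t]) (EFin \o f).
  exact: (@integrableS _ _ _ _ setT).
rewrite RintegralD//; last 2 first.
- exact: finite_measure_integrable_cst.
- by rewrite (_ : _ \o _ = fun x => (w t)%:E * (EFin \o f) x)%E//; exact: integrableZl.
by rewrite Rintegral_cst// RintegralZl.
Qed.

End integrals_and_measures.

Section image_measures.
Context d1 d2 (X : measurableType d1) (Y : measurableType d2) (R : realType).
Variables (P : {measure set X -> \bar R}) (f : X -> Y) (kap : {measure set Y -> \bar R}).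
Hypothesis mf : measurable_fun setT f.
Hypothesis kapE : forall B, measurable B -> kap B = P (f @^-1` B).

Lemma ge0_integral_image (h : Y -> \bar R) : (forall y, (0 <= h y)%E) ->
  measurable_fun setT h -> (\int[kap]_y h y = \int[P]_x h (f x))%E.
Proof.
move=> h0 mh.
transitivity (\int[pushforward P f]_y h y)%E.
  by apply: eq_measure_integral => B mB _; rewrite kapE.
by rewrite ge0_integral_pushforward.
Qed.

Lemma integrable_image (h : Y -> R) : kap.-integrable setT (EFin \o h) ->
  P.-integrable setT (EFin \o (h \o f)).
Proof.
move=> /integrableP[mh hoo]; apply/integrableP; split.
  by apply/measurable_EFinP/measurableT_comp => //; exact/measurable_EFinP.
rewrite ge0_integral_image// in hoo; exact: measurableT_comp.
Qed.

Lemma Rintegral_image (h : Y -> R) : kap.-integrable setT (EFin \o h) ->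
  \int[kap]_y h y = \int[P]_x h (f x).
Proof.
move=> inth; rewrite /Rintegral; congr fine.
have mh : measurable_fun setT (EFin \o h) := measurable_int kap inth.
transitivity (\int[pushforward P f]_y (h y)%:E)%E.
  by apply: eq_measure_integral => B mB _; rewrite kapE.
rewrite integral_pushforward//; exact: integrable_image.
Qed.

End image_measures.

(** * Martingale couplings above a given measure *)

Lemma setX_setUr T T' (A : set T) (B B' : set T') :
  A `*` (B `|` B') = (A `*` B) `|` (A `*` B').
Proof. by rewrite predeqE => -[x y] /=; tauto. Qed.

Lemma setX_setUl T T' (A A' : set T) (B : set T') :
  (A `|` A') `*` B = (A `*` B) `|` (A' `*` B).
Proof. by rewrite predeqE => -[x y] /=; tauto. Qed.

Section strassen.
Context (R : realType).
Variables (mu nu : fmeasR R).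
Hypotheses (mu1 : finite_first_moment mu) (nu1 : finite_first_moment nu).
Variable pi : {finite_measure set (measurableTypeR R * measurableTypeR R)%type -> \bar R}.
Hypothesis pi_nu : forall B, measurable B -> (pi (setT `*` B) <= nu B)%E.
Hypothesis duality : forall (T : finType) (i j : R -> T) (v w : T -> R),
  finite_measurable (i : measurableTypeR R -> T) ->
  finite_measurable (j : measurableTypeR R -> T) ->
  (forall y t, v (j y) + w (j y) * y <= v t + w t * y) ->
  \int[nu]_y (v (j y) + w (j y) * y) +
  \int[pi]_z (v (i z.1) + w (i z.1) * z.2) -
  \int[pi]_z (v (j z.2) + w (j z.2) * z.2) <=
  \int[mu]_x (v (i x) + w (i x) * x).

Let X := measurableTypeR R.

Let good (Q : set X -> set X -> R) : Prop := [/\ bicontent Q,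
  forall B, measurable B -> Q setT B = fine (nu B) &
  forall A B, measurable A -> measurable B -> fine (pi (A `*` B)) <= Q A B].

Let mom (Q : set X -> set X -> R) (A : set X) : R :=
  if pselect (exists kap : fmeasR R, forall B, measurable B -> kap B = (Q A B)%:E)
    is left kP then \int[sval (cid kP)]_y y else 0.

Let good_le_nu Q A B : good Q -> measurable A -> measurable B ->
  Q A B <= fine (nu B).
Proof. by move=> [bQ QT _] mA mB; rewrite -QT//; exact: (bicontent_mono bQ). Qed.

Let momP Q A : good Q -> measurable A -> exists kap : fmeasR R,
  (forall B, measurable B -> kap B = (Q A B)%:E) /\ mom Q A = \int[kap]_y y.
Proof.
move=> gQ mA; rewrite /mom; case: pselect => [kP|[]]; first by exists (sval (cid kP)); case: cid.
have [[Q0 _ Q2] _ _] := gQ.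
by apply: (dominated_content_measure (lam := nu)) => [|B mB|B mB];
  [exact: Q2|exact: Q0|exact: good_le_nu].
Qed.

Let mom_approx e : 0 < e -> exists (I : finType) (c : I -> R) (B : I -> set X),
  (forall k, measurable (B k)) /\ forall Q A, good Q -> measurable A ->
    `|mom Q A - \sum_k c k * Q A (B k)| <= e /\
    forall kap : {measure set X -> \bar R},
      (forall C, measurable C -> kap C = (Q A C)%:E) ->
      `|\int[kap]_y y - \sum_k c k * Q A (B k)| <= e.
Proof.
move=> e0; have [I [c [B [mB cB]]]] := @integrable_approx _ X R nu (fun y : X => y : R) e nu1 e0.
exists I, c, B; split => // Q A gQ mA.
have main (kap : {measure set X -> \bar R}) :
    (forall C, measurable C -> kap C = (Q A C)%:E) ->
    `|\int[kap]_y y - \sum_k c k * Q A (B k)| <= e.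
  move=> kE; have := cB kap; rewrite (eq_bigr (fun k => c k * Q A (B k))); last first.
    by move=> k _; rewrite kE.
  apply=> C mC; rewrite kE// -(fine_measureK nu mC) lee_fin; exact: good_le_nu.
by split => //; have [kap [kE ->]] := momP gQ mA; exact: main.
Qed.

Let mom_measure Q A (kap : {measure set X -> \bar R}) : good Q -> measurable A ->
  (forall C, measurable C -> kap C = (Q A C)%:E) -> mom Q A = \int[kap]_y y.
Proof.
move=> gQ mA kE; apply: (@eq_from_approx _ _ _ 2) => e e0.
have [I [c [B [mB /(_ Q A gQ mA)[h1 /(_ kap kE) h2]]]]] := mom_approx e0.
by move: h1 h2; rewrite !ler_norml; lra.
Qed.

Let good_convex Q1 Q2 a : good Q1 -> good Q2 -> 0 <= a <= 1 ->
  good (fun A B => a * Q1 A B + (1 - a) * Q2 A B).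
Proof.
move=> [[p1 l1 r1] t1 s1] [[p2 l2 r2] t2 s2] /andP[a0 a1]; split; first split.
- by move=> A B mA mB; rewrite addr_ge0// mulr_ge0 ?p1 ?p2// subr_ge0.
- by move=> B mB A A' mA mA' AA'; rewrite l1// l2//; ring.
- by move=> A mA B B' mB mB' BB'; rewrite r1// r2//; ring.
- by move=> B mB; rewrite t1// t2//; ring.
- move=> A B mA mB; have := s1 _ _ mA mB; have := s2 _ _ mA mB; nra.
Qed.

Let mom_convex Q1 Q2 a A : good Q1 -> good Q2 -> 0 <= a <= 1 -> measurable A ->
  mom (fun A B => a * Q1 A B + (1 - a) * Q2 A B) A = a * mom Q1 A + (1 - a) * mom Q2 A.
Proof.
move=> g1 g2 a01 mA; apply: (@eq_from_approx _ _ _ 2) => e e0.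
have [I [c [B [mB cB]]]] := mom_approx e0.
have [h1 _] := cB _ _ g1 mA; have [h2 _] := cB _ _ g2 mA.
have [h _] := cB _ _ (good_convex g1 g2 a01) mA.
move: h; have -> : \sum_k c k * (a * Q1 A (B k) + (1 - a) * Q2 A (B k)) =
    a * \sum_k c k * Q1 A (B k) + (1 - a) * \sum_k c k * Q2 A (B k).
  by rewrite !mulr_sumr -big_split; apply: eq_bigr => k _ /=; ring.
move: a01 h1 h2 => /andP[a0 a1]; rewrite !ler_norml.
set s1 := \sum_k _; set s2 := \sum_k _; move=> /andP[h1 h1'] /andP[h2 h2'] /andP[h h'].
by apply/andP; split; nra.
Qed.

Let mom_additive Q : good Q -> additive_on_measurable (mom Q).
Proof.
move=> gQ A A' mA mA' AA'; apply: (@eq_from_approx _ _ _ 3) => e e0.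
have [I [c [B [mB cB]]]] := mom_approx e0.
have [h1 _] := cB _ _ gQ mA; have [h2 _] := cB _ _ gQ mA'.
have [h _] := cB _ _ gQ (measurableU _ _ mA mA').
move: h; have -> : \sum_k c k * Q (A `|` A') (B k) =
    \sum_k c k * Q A (B k) + \sum_k c k * Q A' (B k).
  have [[_ Q1 _] _ _] := gQ.
  by rewrite -big_split; apply: eq_bigr => k _ /=; rewrite Q1// mulrDr.
by move: h1 h2; rewrite !ler_norml; lra.
Qed.

Let mom_bounded Q A : good Q -> measurable A -> `|mom Q A| <= \int[nu]_y `|y|.
Proof.
move=> gQ mA; have [kap [kE ->]] := momP gQ mA.
have le_kn C : measurable C -> (kap C <= nu C)%E.
  by move=> mC; rewrite kE// -(fine_measureK nu mC) lee_fin; exact: good_le_nu.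
have intk : kap.-integrable setT (EFin \o (fun y : X => y : R)) :=
  le_measure_integrable le_kn nu1.
apply: le_trans (le_normr_Rintegral measurableT intk) _.
have intn := integrable_norm nu1.
have intkn : kap.-integrable setT (EFin \o (fun y : X => `|y : R|)) :=
  le_measure_integrable le_kn intn.
apply: fine_le; [exact: integrable_fin_num intkn|exact: integrable_fin_num intn|].
apply: ge0_le_measure_integral => //.
exact: (measurable_int nu intn).
Qed.


Let rest : exists rho : fmeasR R, forall B, measurable B ->
  rho B = (fine (nu B) - fine (pi (setT `*` B)))%:E.
Proof.
have le_pn B : measurable B -> fine (pi (setT `*` B)) <= fine (nu B).
  move=> mB; have mX := measurableX (@measurableT _ X) mB.
  by apply: fine_le; [exact: fin_num_measure|exact: fin_num_measure|exact: pi_nu].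
apply: (dominated_content_measure (lam := nu)) => [A B mA mB AB|B mB|B mB].
- have := fine_measure_additive nu mA mB AB => /= ->.
  have -> : (setT `*` (A `|` B) : set (X * X)) = (setT `*` A) `|` (setT `*` B).
    by rewrite setX_setUr.
  have := fine_measure_additive pi (measurableX measurableT mA) (measurableX measurableT mB).
  move=> /= ->; first by ring.
  by apply/seteqP; split => // z [[_ zA] [_ zB]]; have : (A `&` B) z.2 by []; rewrite AB.
- by rewrite subr_ge0 le_pn.
- by rewrite lerBlDr lerDl fine_measure_ge0.
Qed.

Let int_snd : pi.-integrable setT (EFin \o (fun z : X * X => z.2 : R)).
Proof.
have [kap kapE] := pushforward_measure_exists pi (measurable_snd : measurable_fun setT (@snd X X)).
apply: (@integrable_image _ _ _ _ R pi snd kap measurable_snd (fun B _ => kapE B) (fun y : X => y : R)).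
apply: (le_measure_integrable _ nu1) => B mB; rewrite kapE -setTX; exact: pi_nu.
Qed.

Section assignment.
Variable rho : fmeasR R.
Hypothesis rhoE : forall B, measurable B ->
  rho B = (fine (nu B) - fine (pi (setT `*` B)))%:E.
Variables (T : finType) (i j : X -> T) (a : T -> X).
Hypotheses (mi : finite_measurable i) (mj : finite_measurable j) (ia : cancel a i).

(** Mass of the rest of [nu] at [y] is sent to the representative of cell [j y]. *)
Let assigned (A B : set X) : R :=
  fine (pi (A `*` B)) + \sum_t \1_A (a t) * fine (rho (B `&` j @^-1` [set t])).

Let rho_le_nu B : measurable B -> (rho B <= nu B)%E.
Proof.
move=> mB; rewrite rhoE// -(fine_measureK nu mB) lee_fin lerBlDr lerDl.
by rewrite fine_measure_ge0.
Qed.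

Let assigned_good : good assigned.
Proof.
have indic0 (A : set X) x : 0 <= \1_A x :> R by rewrite indicE.
have mBj B t : measurable B -> measurable (B `&` j @^-1` [set t]).
  by move=> mB; exact: measurableI.
split; first split.
- move=> A B mA mB; rewrite addr_ge0 ?fine_measure_ge0//.
  by apply: sumr_ge0 => t _; rewrite mulr_ge0// fine_measure_ge0.
- move=> B mB A A' mA mA' AA'; rewrite /assigned.
  have -> : (A `|` A') `*` B = (A `*` B) `|` (A' `*` B).
    by rewrite setX_setUl.
  have := fine_measure_additive pi (measurableX mA mB) (measurableX mA' mB) => /= ->; last first.
    by apply/seteqP; split => // z [[zA _] [zA' _]]; have : (A `&` A') z.1 by []; rewrite AA'.
  rewrite addrACA -big_split /=; congr (_ + _); apply: eq_bigr => t _.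
  rewrite -mulrDl; congr (_ * _); rewrite !indicE in_setU.
  case: (boolP (a t \in A)) => [/set_mem tA|_]; last by rewrite add0r.
  by rewrite memNset ?addr0// => tA'; have : (A `&` A') (a t) by []; rewrite AA'.
- move=> A mA B B' mB mB' BB'; rewrite /assigned.
  have -> : A `*` (B `|` B') = (A `*` B) `|` (A `*` B').
    by rewrite setX_setUr.
  have := fine_measure_additive pi (measurableX mA mB) (measurableX mA mB') => /= ->; last first.
    by apply/seteqP; split => // z [[_ zB] [_ zB']]; have : (B `&` B') z.2 by []; rewrite BB'.
  rewrite addrACA -big_split /=; congr (_ + _); apply: eq_bigr => t _.
  rewrite -mulrDr setIUl; congr (_ * _).
  have := fine_measure_additive rho (mBj _ t mB) (mBj _ t mB') => /= ->//.
  by apply/seteqP; split => // z [[zB _] [zB' _]]; have : (B `&` B') z by []; rewrite BB'.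
- move=> B mB; rewrite /assigned.
  under eq_bigr do rewrite indicT mul1r.
  have addB : additive_on_measurable (fun C => fine (rho (B `&` C))).
    move=> C C' mC mC' CC'; rewrite setIUr.
    have := fine_measure_additive rho (measurableI _ _ mB mC) (measurableI _ _ mB mC').
    move=> /= ->//; apply/seteqP; split => // z [[_ zC] [_ zC']].
    by have : (C `&` C') z by []; rewrite CC'.
  rewrite -(additive_on_fibers predT addB mj) (_ : [set x | _] = setT) ?setIT; last first.
    by apply/seteqP.
  by rewrite rhoE//= addrC subrK.
- move=> A B mA mB; rewrite lerDl; apply: sumr_ge0 => t _.
  by rewrite mulr_ge0// fine_measure_ge0.
Qed.

Let assigned_cell t B : assigned (i @^-1` [set t]) B =
  fine (pi ((i @^-1` [set t]) `*` B)) + fine (rho (B `&` j @^-1` [set t])).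
Proof.
rewrite /assigned (bigD1 t)//= big1 ?addr0.
  by rewrite indicE mem_set ?mul1r//= ia.
by move=> s st; rewrite indicE memNset ?mul0r//= ia => /eqP; exact/negP.
Qed.

Let mom_assigned t : mom assigned (i @^-1` [set t]) =
  \int[pi]_(z in (i @^-1` [set t]) `*` setT) z.2 + \int[rho]_(y in j @^-1` [set t]) y.
Proof.
have mX : measurable ((i @^-1` [set t]) `*` setT : set (X * X)) by exact: measurableX.
have [kap [kapE ->]] := momP assigned_good (mi t).
have [k1 k1E] := pushforward_measure_exists (mrestr pi mX)
  (measurable_snd : measurable_fun setT (@snd X X)).
have k1E' B : measurable B -> k1 B = pi ((i @^-1` [set t]) `*` B).
  move=> mB; rewrite k1E /mrestr; congr (pi _).
  by apply/seteqP; split => [z [? [? _]]|z [? ?]].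
pose k2 : {measure set X -> \bar R} := mrestr rho (mj t).
have kD B : measurable B -> kap B = (k1 B + k2 B)%E.
  move=> mB; rewrite kapE// assigned_cell EFinD k1E'// /k2 /= /mrestr.
  by rewrite !fineK ?fin_num_measure//; [exact: measurableI|exact: measurableX].
have intk : kap.-integrable setT (EFin \o (fun y : X => y : R)).
  have le_kn C : measurable C -> (kap C <= nu C)%E.
    by move=> mC; rewrite kapE// -(fine_measureK nu mC) lee_fin (good_le_nu assigned_good).
  exact: le_measure_integrable le_kn nu1.
rewrite (Rintegral_measureD kD intk); congr (_ + _).
  have intk1 : k1.-integrable setT (EFin \o (fun y : X => y : R)).
    have le_k B : measurable B -> (k1 B <= kap B)%E by move=> mB; rewrite kD// leeDl.
    exact: le_measure_integrable le_k intk.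
  rewrite (@Rintegral_image _ _ _ _ R (mrestr pi mX) snd k1 measurable_snd (fun B _ => k1E B)
    (fun y : X => y : R) intk1).
  by apply: Rintegral_restricted_measure => // B mB; rewrite /mrestr setIC.
apply: Rintegral_restricted_measure => //; first by move=> B mB; rewrite /k2/= /mrestr setIC.
exact: le_measure_integrable rho_le_nu nu1.
Qed.

Let int_nu_split (v w : T -> R) : \int[nu]_y (v (j y) + w (j y) * y) =
  \int[rho]_y (v (j y) + w (j y) * y) + \int[pi]_z (v (j z.2) + w (j z.2) * z.2).
Proof.
have [kap kapE] := pushforward_measure_exists pi (measurable_snd : measurable_fun setT (@snd X X)).
have nuD B : measurable B -> nu B = (rho B + kap B)%E.
  move=> mB; have mX := measurableX (@measurableT _ X) mB.
  rewrite rhoE// kapE -setTX -[X in (_ + X)%E](fine_measureK pi mX) -EFinD subrK.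
  by rewrite fine_measureK.
have intn := integrable_step_affine v w mj nu1.
rewrite (Rintegral_measureD nuD intn); congr (_ + _).
have kap_le B : measurable B -> (kap B <= nu B)%E by move=> mB; rewrite nuD// leeDr.
by rewrite (@Rintegral_image _ _ _ _ R pi snd kap measurable_snd (fun B _ => kapE B)
  _ (le_measure_integrable kap_le intn)).
Qed.

Lemma assigned_cost (v w : T -> R) : (forall y t, v (j y) + w (j y) * y <= v t + w t * y) ->
  exists2 Q, good Q &
  \sum_t (v t * (Q (i @^-1` [set t]) setT - fine (mu (i @^-1` [set t]))) +
          w t * (mom Q (i @^-1` [set t]) - \int[mu]_(x in i @^-1` [set t]) x)) <= 0.
Proof.
move=> jmin; exists assigned; first exact: assigned_good.
have DK x y z : x + y + z - y = x + z :> R by lra.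
have := duality mi mj jmin; rewrite int_nu_split DK.
rewrite (Rintegral_step_affine v w mj (le_measure_integrable rho_le_nu nu1)).
rewrite (Rintegral_step_affine v w mi mu1).
have mif : finite_measurable (i \o fst : X * X -> T).
  by move=> t; rewrite comp_preimage -setXT; exact: measurableX.
rewrite (@Rintegral_step_affine _ _ _ pi T (i \o fst) v w (fun z => z.2 : R) mif int_snd).
rewrite -subr_le0 -big_split -sumrB /=.
congr (_ <= 0); apply: eq_bigr => t _.
rewrite assigned_cell mom_assigned setTI.
have -> : (i \o fst) @^-1` [set t] = (i @^-1` [set t]) `*` [set: X].
  by apply/seteqP; split => [z|z []].
by ring.
Qed.

End assignment.

(** The best response against prices [v, w] assigns [y] to a cell minimizing
    [v t + w t * y]. *)
Let affine_argmin (T : finType) (t0 : T) (v w : T -> R) : exists j : X -> T,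
  finite_measurable j /\ forall y t, v (j y) + w (j y) * y <= v t + w t * y.
Proof.
pose b (y : X) (p : T * T) := v p.1 + w p.1 * y <= v p.2 + w p.2 * y.
pose g (c : {ffun T * T -> bool}) := odflt t0 [pick t | [forall s, c (t, s)]].
exists (g \o (fun y => [ffun p => b y p])); split.
  apply: finite_measurable_comp; apply: finite_measurable_ffun => p.
  rewrite -[X in measurable X]setTI /b.
  apply: (@measurable_fun_ler _ X R setT) => //.
    by apply: measurable_funD => //; exact: measurable_funM.
  by apply: measurable_funD => //; exact: measurable_funM.
move=> y t /=; rewrite /g; case: pickP => [s /forallP/(_ t)|]; first by rewrite ffunE.
have [s _ smin] := arg_minP (fun t => v t + w t * y) (isT : predT t0).
by move/(_ s); rewrite (introT forallP)// => r; rewrite ffunE /b /= smin.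
Qed.

Let strassen_partition (T : finType) (i : X -> T) (a : T -> X) e :
  finite_measurable i -> cancel a i -> 0 < e -> exists2 Q, good Q & forall t,
    `|Q (i @^-1` [set t]) setT - fine (mu (i @^-1` [set t]))| <= e /\
    `|mom Q (i @^-1` [set t]) - \int[mu]_(x in i @^-1` [set t]) x| <= e.
Proof.
move=> mi ia e0; have [rho rhoE] := rest.
pose cell t := i @^-1` [set t].
pose dmass (Q : set X -> set X -> R) t := Q (cell t) setT - fine (mu (cell t)).
pose dmom (Q : set X -> set X -> R) t := mom Q (cell t) - \int[mu]_(x in cell t) x.
pose vec Q (s : (T + T) + (T + T)) : R := match s with
  | inl (inl t) => dmass Q t | inl (inr t) => - dmass Q t
  | inr (inl t) => dmom Q t | inr (inr t) => - dmom Q t end.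
pose V := [set u | exists2 Q, good Q & u = vec Q].
suff [u [Q gQ ->] uQ] : exists2 u, V u & forall s, u s <= e.
  exists Q => // t; rewrite !ler_norml.
  have := uQ (inl (inl t)); have := uQ (inl (inr t)).
  have := uQ (inr (inl t)); have := uQ (inr (inr t)).
  by rewrite /= /dmass /dmom /cell; split; lra.
pose D := \sum_t `|\int[mu]_(x in cell t) x| + \int[nu]_y `|y| +
  fine (mu setT) + fine (nu setT).
apply: (@approach_orthant R _ V D) => //.
- move=> _ _ c [Q1 g1 ->] [Q2 g2 ->] c01.
  exists (fun A B => c * Q1 A B + (1 - c) * Q2 A B); first exact: good_convex.
  have E1 t : dmass (fun A B => c * Q1 A B + (1 - c) * Q2 A B) t =
      c * dmass Q1 t + (1 - c) * dmass Q2 t by rewrite /dmass; ring.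
  have E2 t : dmom (fun A B => c * Q1 A B + (1 - c) * Q2 A B) t =
      c * dmom Q1 t + (1 - c) * dmom Q2 t.
    by rewrite /dmom mom_convex//; [ring|exact: mi].
  by apply/funext => -[[t|t]|[t|t]] /=; rewrite ?E1 ?E2; ring.
- move=> _ s [Q gQ ->]; have [[Q0 _ _] _ _] := gQ.
  have S0 : 0 <= \sum_t `|\int[mu]_(x in cell t) x| by exact: sumr_ge0.
  have N0 : 0 <= \int[nu]_y `|y| by exact: Rintegral_ge0.
  have [M0 M1] := (fine_measure_ge0 mu setT, fine_measure_ge0 nu setT).
  have B1 t : `|dmass Q t| <= D.
    have := Q0 _ _ (mi t) measurableT; have := good_le_nu gQ (mi t) measurableT.
    have := fine_measure_ge0 mu (cell t).
    have := le_fine_measure mu (mi t) measurableT (@subsetT _ _).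
    by rewrite ler_norml /dmass /D -/(cell t); lra.
  have B2 t : `|dmom Q t| <= D.
    have := mom_bounded gQ (mi t); rewrite -/(cell t).
    have : `|\int[mu]_(x in cell t) x| <= \sum_t `|\int[mu]_(x in cell t) x|.
      by rewrite (bigD1 t)//= lerDl sumr_ge0.
    have := ler_normB (mom Q (cell t)) (\int[mu]_(x in cell t) x).
    by rewrite /dmom /D; lra.
  by case: s => -[t|t] /=; rewrite ?normrN.
- move=> p p0.
  pose v t := p (inl (inl t)) - p (inl (inr t)).
  pose w t := p (inr (inl t)) - p (inr (inr t)).
  have [j [mj jmin]] := affine_argmin (i 0) v w.
  have [Q gQ Q0] := assigned_cost rhoE mi mj ia jmin.
  exists (vec Q); first by exists Q.
  apply: le_trans Q0; rewrite !big_sumType /= -!big_split /=.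
  by apply: ler_sum => t _; rewrite /v /w /dmass /dmom /cell; lra.
Qed.

Let strassen_sets n (A : nat -> set X) e : (forall k, measurable (A k)) -> 0 < e ->
  exists2 Q, good Q & forall k, (k < n)%N ->
    `|Q (A k) setT - fine (mu (A k))| <= e /\
    `|mom Q (A k) - \int[mu]_(x in A k) x| <= e.
Proof.
move=> mA e0.
pose T0 : finType := {ffun 'I_n -> bool}.
pose hit (t : T0) := `[< exists x, membership A n x = t >].
pose T : finType := {t : T0 | hit t}.
have hitP x : hit (membership A n x) by apply/asboolP; exists x.
pose i x : T := exist (fun t : T0 => hit t) (membership A n x) (hitP x).
have /choice[a aP] (t : T) : exists x, i x = t.
  have /asboolP[x xt] := valP t; exists x; exact: val_inj.
have mi : finite_measurable i.
  move=> t; rewrite (_ : _ @^-1` _ = membership A n @^-1` [set val t]).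
    exact: finite_measurable_membership.
  by apply/seteqP; split => x /=; [move=> <-|move=> xt; exact: val_inj].
have T1 : 0 < #|T|%:R :> R by rewrite ltr0n; apply/card_gt0P; exists (i 0).
have [Q gQ Qt] := strassen_partition mi aP (divr_gt0 e0 T1).
exists Q => // k kn; have [[_ Q1 _] _ _] := gQ.
pose S : pred T := fun t => val t (Ordinal kn).
have AE : A k = [set x | S (i x)] by rewrite (membershipE A kn).
have int_add : additive_on_measurable (fun B : set X => \int[mu]_(x in B) x).
  move=> B C mB mC BC; rewrite Rintegral_setU//; last by rewrite disj_set2E BC.
  by apply: integrableS mu1 => //; exact: measurableU.
have sumE (f : T -> R) : (forall t, `|f t| <= e / #|T|%:R) -> `|\sum_(t | S t) f t| <= e.
  move=> fe; apply: le_trans (ler_norm_sum _ _ _) _.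
  apply: le_trans (ler_sum _ (fun t _ => fe t)) _.
  rewrite sumr_const -[leRHS](divfK (lt0r_neq0 T1)).
  rewrite -(mulr_natr (e / _)) ler_wpM2l ?(ltW (divr_gt0 e0 T1))// ler_nat.
  exact: max_card.
rewrite AE; split.
  rewrite (additive_on_fibers S (Q1 _ measurableT) mi).
  have /= -> := additive_on_fibers S (fine_measure_additive mu) mi.
  by rewrite -sumrB; apply: (sumE (fun t => _)) => t; have [] := Qt t.
rewrite (additive_on_fibers S (mom_additive gQ) mi).
rewrite (additive_on_fibers S int_add mi).
by rewrite -sumrB; apply: (sumE (fun t => _)) => t; have [] := Qt t.
Qed.

Let strassen_limit : exists2 L, good L & forall A, measurable A ->
  L A setT = fine (mu A) /\ mom L A = \int[mu]_(x in A) x.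
Proof.
pose C A e Q := `|Q A setT - fine (mu A)| <= e /\
  `|mom Q A - \int[mu]_(x in A) x| <= e.
have [] := @finite_constraints_filter R _ _ (fun=> good) [set A : set X | measurable A] C.
- by move=> n Q.
- by move=> A e e' ee' Q [h1 h2]; split; [apply: le_trans ee'|apply: le_trans ee'].
- by exists setT => /=.
- by move=> n A e mA e0; exact: strassen_sets.
move=> F [FF F_good F_C].
have F_bi : F (@bicontent _ _ X X R) by apply: filterS (F_good 0%N) => Q [].
have F_mu A (e : R) : measurable A -> 0 < e -> F [set Q | Q A setT <= fine (mu A) + e].
  move=> mA e0; apply: filterS (F_C A e mA e0) => Q [+ _].
  by rewrite /= ler_norml; lra.
have F_nu B (e : R) : measurable B -> 0 < e -> F [set Q | Q setT B <= fine (nu B) + e].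
  move=> mB e0; apply: filterS (F_good 0%N) => Q [_ QT _].
  by rewrite /= QT// lerDl ltW.
have [U [L [UU FU biL cL _]]] := bicontent_limit FF F_bi F_mu F_nu.
have PU : ProperFilter U by case: UU.
have gL : good L.
  split => //.
    move=> B mB; have h : (fun Q => Q setT B) @ U --> fine (nu B).
      by apply: cvg_near_cst; apply: FU; apply: filterS (F_good 0%N) => Q [_ + _]; exact.
    exact: cvg_unique (cL _ _ measurableT mB) h.
  move=> A B mA mB; apply: (cvgr_to_ge (cL A B mA mB)).
  by apply: FU; apply: filterS (F_good 0%N) => Q [_ _]; exact.
exists L => // A mA; split.
  have h : (fun Q => Q A setT) @ U --> fine (mu A).
    apply/cvgrPdist_le => e e0; apply: FU; apply: filterS (F_C A e mA e0) => Q [+ _].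
    by rewrite distrC.
  exact: cvg_unique (cL _ _ mA measurableT) h.
apply: (@eq_from_approx _ _ _ 3) => e e0.
have [I [c [B [mB cB]]]] := mom_approx e0.
have [h _] := cB _ _ gL mA.
suff : `|\sum_k c k * L A (B k) - \int[mu]_(x in A) x| <= 2 * e.
  by move: h; rewrite !ler_norml; lra.
have cS : (fun Q => `|\sum_k c k * Q A (B k) - \int[mu]_(x in A) x|) @ U -->
    `|\sum_k c k * L A (B k) - \int[mu]_(x in A) x|.
  apply: cvg_norm; apply: cvgB; last exact: cvg_cst.
  apply: cvg_big => [|k _]; first exact: add_continuous.
  by apply: cvgM; [exact: cvg_cst|exact: cL].
apply: (cvgr_to_le cS); apply: FU.
apply: filterS2 (F_good 0%N) (F_C A e mA e0) => Q gQ [_ QA].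
have [h' _] := cB _ _ gQ mA.
by move: h' QA; rewrite !ler_norml; lra.
Qed.

(** The slack [L - pi] is itself a measure, so that [pi <= P] passes from
    rectangles to all measurable sets. *)
Lemma strassen_measure :
  exists (P : {measure set (X * X)%type -> \bar R}) (k : R.-pker X ~> X),
  [/\ forall S, P S = (\int[mu]_x k x (xsection S x))%E,
      forall B, measurable B -> P (setT `*` B) = nu B,
      forall S, measurable S -> (pi S <= P S)%E &
      forall A (kap : {measure set X -> \bar R}), measurable A ->
        (forall B, measurable B -> kap B = P (A `*` B)) ->
        \int[kap]_y y = \int[mu]_(x in A) x].
Proof.
have [L gL Lmu] := strassen_limit.
have [biL LT Lpi] := gL; have [L0 L1 L2] := biL.
have Lmu_le A : measurable A -> L A setT <= fine (mu A) by move=> mA; rewrite (Lmu A mA).1.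
have LT_le B : measurable B -> L setT B <= fine (nu B) by move=> mB; rewrite LT.
have [k kL] := @bicontent_kernel _ _ _ L mu nu biL (fun A mA => (Lmu A mA).1) LT_le.
have [P PE] := kernel_joint_measure mu k.
have PL A B : measurable A -> measurable B -> P (A `*` B) = (L A B)%:E.
  move=> mA mB; rewrite PE -kL// [RHS]integral_mkcond.
  apply: eq_integral => x _; rewrite patchE; case: ifPn => xA.
    by rewrite in_xsectionX.
  by rewrite notin_xsectionX// measure0.
exists P, k; split => //.
- by move=> B mB; rewrite PL// LT// fine_measureK.
- pose D A B := L A B - fine (pi (A `*` B)).
  have biD : bicontent D.
    split.
    - by move=> A B mA mB; rewrite subr_ge0 Lpi.
    - move=> B mB A A' mA mA' AA'; rewrite /D L1// setX_setUl.
      have /= -> := fine_measure_additive pi (measurableX mA mB) (measurableX mA' mB).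
        by ring.
      by apply/seteqP; split => // z [[zA _] [zA' _]]; have : (A `&` A') z.1 by []; rewrite AA'.
    - move=> A mA B B' mB mB' BB'; rewrite /D L2// setX_setUr.
      have /= -> := fine_measure_additive pi (measurableX mA mB) (measurableX mA mB').
        by ring.
      by apply/seteqP; split => // z [[_ zB] [_ zB']]; have : (B `&` B') z.2 by []; rewrite BB'.
  have D_le A B : D A B <= L A B by rewrite lerBlDr lerDl fine_measure_ge0.
  have [P' P'E] := @bicontent_measure _ _ _ D mu nu biD
    (fun A mA => le_trans (D_le _ _) (Lmu_le _ mA))
    (fun B mB => le_trans (D_le _ _) (LT_le _ mB)).
  have PS S : measurable S -> P S = measure_add pi P' S.
    apply: (@measure_unique _ R (X * X)%type
      [set S | exists A B, [/\ measurable A, measurable B & S = A `*` B]] (fun=> setT)) => //.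
    - rewrite measurable_prod_measurableType; congr (<<s _ >>).
      apply/seteqP; split => [_ [A mA [B mB <-]]|_ [A [B [mA mB ->]]]]; first by exists A, B.
      by exists A => //; exists B.
    - move=> _ _ [A [B [mA mB ->]]] [A' [B' [mA' mB' ->]]].
      exists (A `&` A'), (B `&` B'); split; [exact: measurableI|exact: measurableI|].
      by rewrite setXI.
    - by exists setT, setT; split => //; rewrite setXTT.
    - by rewrite bigcup_const.
    - move=> _ [A [B [mA mB ->]]].
      transitivity (pi (A `*` B) + P' (A `*` B))%E; last exact/esym/measure_addE.
      rewrite PL// P'E// -(fine_measureK pi (measurableX mA mB)) -EFinD.
      by rewrite /D addrC subrK.
    - by move=> _; rewrite -setXTT PL// ltry.
  move=> S mS; have -> : P S = (pi S + P' S)%E by rewrite PS//; exact: measure_addE.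
  by rewrite leeDl.
- move=> A kap mA kapE; rewrite -(mom_measure gL mA) ?(Lmu A mA).2// => C mC.
  by rewrite kapE// PL.
Qed.

End strassen.

Section kernel_integration.
Context d1 d2 (X : measurableType d1) (Y : measurableType d2) (R : realType).
Local Open Scope ereal_scope.

Lemma ge0_integral_restricted_measure (mu kap : {measure set X -> \bar R}) (D : set X)
    (f : X -> \bar R) : measurable D ->
  (forall B, measurable B -> kap B = mu (D `&` B)) ->
  (forall x, 0 <= f x) -> measurable_fun setT f ->
  \int[kap]_x f x = \int[mu]_(x in D) f x.
Proof.
move=> mD kE f0 mf.
have mDC : measurable (~` D) by exact: measurableC.
rewrite (ge0_negligible_integral mDC measurableT)// ?setTD ?setCK; last first.
  by rewrite kE// setICr measure0.
by apply: eq_measure_integral => A mA AD; rewrite kE// setIidr.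
Qed.

Lemma kernel_tonelli (lam : {finite_measure set X -> \bar R}) (k : R.-pker X ~> Y)
    (A : set X) (kap : {measure set Y -> \bar R}) (h : Y -> \bar R) :
  measurable A -> (forall B, measurable B -> kap B = \int[lam]_(x in A) k x B) ->
  (forall y, 0 <= h y) -> measurable_fun setT h ->
  \int[kap]_y h y = \int[lam]_(x in A) \int[k x]_y h y.
Proof.
move=> mA kapE h0 mh.
pose l0 : unit -> {measure set X -> \bar R} := fun=> mrestr lam mA.
have ml0 U : measurable U -> measurable_fun setT (l0 ^~ U) by move=> mU; exact: measurable_cst.
have ul0 : measure_fam_uub l0.
  exists (fine (lam A) + 1)%R => x; rewrite /l0 /= /mrestr setTI.
  by rewrite EFinD fineK ?fin_num_measure// lteDl ?fin_num_measure// lte01.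
pose l1 : R.-ker unit ~> X := HB.pack l0 (isKernel.Build _ _ _ _ R l0 ml0).
pose l : R.-fker unit ~> X := HB.pack l0 l1 (Kernel_isFinite.Build _ _ _ _ R l1 ul0).
pose k0 : unit * X -> {measure set Y -> \bar R} := fun z => k z.2.
have mk0 U : measurable U -> measurable_fun setT (k0 ^~ U).
  move=> mU; apply: (measurableT_comp (measurable_kernel k U mU)).
  exact: measurable_snd.
have k01 z : k0 z setT = 1 by rewrite /k0 prob_kernel.
pose k1 : R.-ker (unit * X)%type ~> Y := HB.pack k0 (isKernel.Build _ _ _ _ R k0 mk0).
pose k2 : R.-pker (unit * X)%type ~> Y :=
  HB.pack k0 k1 (Kernel_isProbability.Build _ _ _ _ R k1 k01).
have mkh : measurable_fun setT (fun x => \int[k x]_y h y).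
  by apply: measurable_fun_integral_kernel => //= U mU; exact: measurable_kernel.
transitivity (\int[kcomp l k2 tt]_y h y).
  apply: eq_measure_integral => B mB _; rewrite kapE// /kcomp.
  apply/esym; apply: (@ge0_integral_restricted_measure lam (mrestr lam mA) A (k ^~ B)) => //.
  - by move=> C mC; rewrite setIC.
  - exact: measurable_kernel.
rewrite integral_kcomp//.
apply: (@ge0_integral_restricted_measure lam (mrestr lam mA) A (fun x => \int[k x]_y h y)) => //.
- by move=> C mC; rewrite setIC.
- by move=> x; exact: integral_ge0.
Qed.

Lemma kernel_fubini (lam : {finite_measure set X -> \bar R}) (k : R.-pker X ~> Y)
    (A : set X) (kap : {measure set Y -> \bar R}) (h : Y -> \bar R) :
  measurable A -> (forall B, measurable B -> kap B = \int[lam]_(x in A) k x B) ->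
  kap.-integrable setT h ->
  lam.-integrable A (fun x => \int[k x]_y h y) /\
  \int[kap]_y h y = \int[lam]_(x in A) \int[k x]_y h y.
Proof.
move=> mA kapE inth; have mh : measurable_fun setT h := measurable_int kap inth.
have part (g : Y -> \bar R) : (forall y, 0 <= g y) -> kap.-integrable setT g ->
    lam.-integrable A (fun x => \int[k x]_y g y) /\
    \int[kap]_y g y = \int[lam]_(x in A) \int[k x]_y g y.
  move=> g0 intg; have mg : measurable_fun setT g := measurable_int kap intg.
  have E := kernel_tonelli mA kapE g0 mg; split => //; apply/integrableP; split.
    apply: measurable_funTS.
    by apply: measurable_fun_integral_kernel => //= U mU; exact: measurable_kernel.
  under eq_integral do rewrite gee0_abs ?integral_ge0//.
  rewrite -E; have /integrableP[_] := intg.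
  by under eq_integral do rewrite gee0_abs//.
have [ip Ep] := part _ (fun y => funepos_ge0 h y) (integrable_funepos measurableT inth).
have [iq Eq] := part _ (fun y => funeneg_ge0 h y) (integrable_funeneg measurableT inth).
under [X in lam.-integrable A X]eq_fun do rewrite integralE.
under [X in _ = X]eq_integral do rewrite integralE.
by split; [exact: integrableB|rewrite integralE integralB// Ep Eq].
Qed.

End kernel_integration.

Section strassen_martingale.
Context (R : realType).
Variables (mu nu : fmeasR R).
Hypotheses (mu1 : finite_first_moment mu) (nu1 : finite_first_moment nu).
Let X := measurableTypeR R.

Lemma disintegration_rect (P : {measure set (X * X)%type -> \bar R}) (k : R.-pker X ~> X) A B :
  disintegration mu P k -> measurable A -> measurable B ->
  P (A `*` B) = (\int[mu]_(x in A) k x B)%E.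
Proof.
move=> PE mA mB; rewrite PE; last exact: measurableX.
rewrite [RHS]integral_mkcond.
apply: eq_integral => x _; rewrite patchE; case: ifPn => xA.
  by rewrite in_xsectionX.
by rewrite notin_xsectionX// measure0.
Qed.

Lemma rect_measure_exists (P : {measure set (X * X)%type -> \bar R}) A : measurable A ->
  exists kap : {measure set X -> \bar R}, forall B, measurable B -> kap B = P (A `*` B).
Proof.
move=> mA; have mX : measurable (A `*` setT : set (X * X)) by exact: measurableX.
have [kap kapE] := pushforward_measure_exists (mrestr P mX)
  (measurable_snd : measurable_fun setT (@snd X X)).
exists kap => B mB; rewrite kapE /mrestr; congr (P _).
by apply/seteqP; split => [z [? [? _]]|z [? ?]].
Qed.

Lemma strassen (pi : {finite_measure set (X * X)%type -> \bar R}) :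
  (forall B, measurable B -> (pi (setT `*` B) <= nu B)%E) ->
  (forall (T : finType) (i j : R -> T) (v w : T -> R),
    finite_measurable (i : X -> T) -> finite_measurable (j : X -> T) ->
    (forall y t, v (j y) + w (j y) * y <= v t + w t * y) ->
    \int[nu]_y (v (j y) + w (j y) * y) +
    \int[pi]_z (v (i z.1) + w (i z.1) * z.2) -
    \int[pi]_z (v (j z.2) + w (j z.2) * z.2) <=
    \int[mu]_x (v (i x) + w (i x) * x)) ->
  exists2 P : {measure set (X * X)%type -> \bar R}, martingale_measure mu nu P &
    forall S, measurable S -> (pi S <= P S)%E.
Proof.
move=> pi_nu dual.
have [P [k [PE Pnu piP mean]]] := strassen_measure mu1 nu1 pi_nu dual.
exists P => //.
have disP : disintegration mu P k by move=> S _.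
split.
- move=> A mA; rewrite /pushforward -setXT (disintegration_rect disP)//.
  under eq_integral do rewrite prob_kernel.
  by rewrite integral_cst//= mul1e.
- by move=> B mB; rewrite /pushforward -setTX Pnu.
exists k => //.
have meanE A : measurable A -> mu.-integrable A (fun x => \int[k x]_y y%:E)%E /\
    (\int[mu]_(x in A) \int[k x]_y y%:E = \int[mu]_(x in A) x%:E)%E.
  move=> mA; have [kap kapP] := rect_measure_exists P mA.
  have kapE B : measurable B -> kap B = (\int[mu]_(x in A) k x B)%E.
    by move=> mB; rewrite kapP// (disintegration_rect disP).
  have kap_nu B : measurable B -> (kap B <= nu B)%E.
    by move=> mB; rewrite kapP// -Pnu// le_measure ?inE//;
      [exact: measurableX|exact: measurableX|exact: setSX].
  have intk : kap.-integrable setT (EFin \o (fun y : X => y : R)) :=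
    le_measure_integrable kap_nu nu1.
  have [ik Ek] := kernel_fubini mA kapE intk.
  split => //.
  have mu1A : mu.-integrable A (EFin \o (fun y : X => y : R)).
    exact: integrableS mu1.
  rewrite -Ek -(fineK (integrable_fin_num measurableT intk)).
  rewrite -(fineK (integrable_fin_num mA mu1A)); congr EFin; exact: mean mA kapP.
have [ikT _] := meanE _ measurableT.
have aeE : ae_eq mu setT (fun x => \int[k x]_y y%:E)%E EFin.
  apply: (integral_ae_eq measurableT ikT); first exact: (measurable_int mu mu1).
  by move=> E _ mE; have [_ ->] := meanE E mE.
by move: aeE; apply: filterS => x h; exact: h.
Qed.

End strassen_martingale.

(** * Potentials and the components of an open set *)

Section potential.
Context (R : realType).
Implicit Types mu nu : fmeasR R.
Let X := measurableTypeR R.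

Lemma integrable_dist mu (c : R) : finite_first_moment mu ->
  mu.-integrable setT (fun t : X => `|t - c|%:E).
Proof.
move=> mu1; have : mu.-integrable setT (fun t : X => t%:E - c%:E)%E.
  by apply: integrableB => //; exact: finite_measure_integrable_cst.
exact: (@integrable_norm _ _ _ mu setT (fun t : X => t - c : R)).
Qed.

Lemma potentialE mu (c : R) : finite_first_moment mu ->
  potential mu c = (\int[mu]_t `|t - c|)%:E.
Proof.
move=> mu1; rewrite /potential /Rintegral fineK//.
exact: integrable_fin_num (integrable_dist c mu1).
Qed.

Lemma le_potential_shift mu (x y : R) : finite_first_moment mu ->
  \int[mu]_t `|t - x| <= \int[mu]_t `|t - y| + `|y - x| * fine (mu setT).
Proof.
move=> mu1; rewrite -(Rintegral_cst mu measurableT).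
have iy := integrable_dist y mu1.
have ic := finite_measure_integrable_cst mu `|y - x| measurableT.
rewrite -(RintegralD measurableT iy ic).
apply: (@le_Rintegral _ _ _ mu setT (fun t : X => `|t - x|)
  (fun t : X => `|t - y| + `|y - x|)) => //.
- exact: integrable_dist.
- exact: (integrableD measurableT iy ic).
- by move=> t _; rewrite (le_trans _ (ler_normD _ _))// addrA subrK.
Qed.

Lemma open_potential_lt mu nu : finite_first_moment mu -> finite_first_moment nu ->
  open [set x : R | (potential mu x < potential nu x)%E].
Proof.
move=> mu1 nu1; rewrite openE => x /=; rewrite !potentialE// lte_fin => lt_x.
pose M := fine (mu setT) + fine (nu setT) + 1.
have M0 : 0 < M by rewrite ltr_wpDl// addr_ge0// fine_measure_ge0.
pose d := \int[nu]_t `|t - x| - \int[mu]_t `|t - x|.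
have d0 : 0 < d by rewrite subr_gt0.
apply/nbhs_ballP; exists (d / M); first exact: divr_gt0.
move=> y; rewrite /ball /= => xy; rewrite !potentialE// lte_fin.
have := le_potential_shift y x mu1; have := le_potential_shift x y nu1.
rewrite (distrC y x).
have : `|x - y| * M < d by rewrite -ltr_pdivlMr.
by have := normr_ge0 (x - y); rewrite /d /M; lra.
Qed.

End potential.

Section components.
Context (R : realType).
Variable U : set R.
Hypothesis oU : open U.
Implicit Types I : set R.

Lemma component_sub I : components U I -> I `<=` U.
Proof. by move=> [x _ <-]; exact: connected_component_sub. Qed.

Lemma component_interval I : components U I -> is_interval I.
Proof.
by move=> [x _ <-]; apply/connected_intervalP; exact: component_connected.
Qed.

Lemma component_mem I x : components U I -> I x -> I = connected_component U x.
Proof. by move=> [y _ <-]; exact: same_connected_component. Qed.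

Lemma component_eq I J x : components U I -> components U J -> I x -> J x -> I = J.
Proof. by move=> cI cJ Ix Jx; rewrite (component_mem cI Ix) (component_mem cJ Jx). Qed.

Lemma component_ball I y e : components U I -> I y ->
  (forall z, `|y - z| < e -> U z) -> forall z, `|y - z| < e -> I z.
Proof.
move=> cI Iy yU z yz; have e0 : 0 < e by apply: le_lt_trans yz.
rewrite (component_mem cI Iy).
apply: (@connected_component_max _ _ (ball y e)) => //; first exact: ballxx.
apply/connected_intervalP => a b; rewrite /ball /= => ya yb c /andP[ac cb].
by move: ya yb; rewrite /ball_ /= !ltr_norml; lra.
Qed.

Lemma open_distP x : U x -> exists2 e, 0 < e & forall z, `|x - z| < e -> U z.
Proof.
move=> Ux; have /nbhs_ballP[e e0 eU] := open_nbhs_nbhs (conj oU Ux).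
by exists e => // z xz; apply: eU.
Qed.

(** An end of a component lies outside the set: otherwise the component would
    extend beyond it. *)
Lemma component_inf I q x : components U I -> I q -> ~ I x -> x < q ->
  [/\ has_lbound I, x <= inf I, ~ U (inf I), forall y, I y -> inf I < y &
      forall y, inf I < y -> y <= q -> I y].
Proof.
move=> cI Iq nIx xq; have itvI := component_interval cI.
have xI y : I y -> x < y.
  move=> Iy; rewrite ltNge; apply/negP => yx; apply: nIx.
  by apply: (itvI y q) => //; rewrite yx ltW.
have lbI : has_lbound I by exists x => y /xI /ltW.
have hiI : has_inf I by split => //; exists q.
have nU : ~ U (inf I).
  move=> /open_distP[e e0 eU]; have [y Iy ye] := inf_adherent e0 hiI.
  have yinf : inf I <= y by exact: ge_inf.
  have : connected_component U y (inf I - e / 2).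
    apply: (@connected_component_max _ _ `](inf I - e), (inf I + e)[%classic).
    - by rewrite /= in_itv /=; apply/andP; split; lra.
    - by move=> z; rewrite /= in_itv /= => ?; apply: eU; rewrite ltr_norml; lra.
    - by apply/connected_intervalP; exact: interval_is_interval.
    - by rewrite /= in_itv /=; apply/andP; split; lra.
  by rewrite -(component_mem cI Iy) => /(ge_inf lbI); lra.
split => //.
- by apply: lb_le_inf; [exists q|move=> y /xI /ltW].
- move=> y Iy; rewrite lt_neqAle ge_inf// andbT; apply/eqP => yE.
  by apply: nU; rewrite yE; exact: component_sub Iy.
- move=> y infy yq; have yI0 : 0 < y - inf I by rewrite subr_gt0.
  have [z Iz zy] := inf_adherent yI0 hiI.
  by apply: (itvI z q) => //; apply/andP; split => //; lra.
Qed.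

Lemma component_sup I q x : components U I -> I q -> ~ I x -> q < x ->
  [/\ has_ubound I, sup I <= x, ~ U (sup I), forall y, I y -> y < sup I &
      forall y, y < sup I -> q <= y -> I y].
Proof.
move=> cI Iq nIx xq; have itvI := component_interval cI.
have xI y : I y -> y < x.
  move=> Iy; rewrite ltNge; apply/negP => yx; apply: nIx.
  by apply: (itvI q y) => //; rewrite yx ltW.
have lbI : has_ubound I by exists x => y /xI /ltW.
have hiI : has_sup I by split => //; exists q.
have nU : ~ U (sup I).
  move=> /open_distP[e e0 eU]; have [y Iy ye] := sup_adherent e0 hiI.
  have ysup : y <= sup I by exact: ub_le_sup.
  have : connected_component U y (sup I + e / 2).
    apply: (@connected_component_max _ _ `](sup I - e), (sup I + e)[%classic).
    - by rewrite /= in_itv /=; apply/andP; split; lra.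
    - by move=> z; rewrite /= in_itv /= => ?; apply: eU; rewrite ltr_norml; lra.
    - by apply/connected_intervalP; exact: interval_is_interval.
    - by rewrite /= in_itv /=; apply/andP; split; lra.
  by rewrite -(component_mem cI Iy) => /(ub_le_sup lbI); lra.
split => //.
- by apply: ge_sup; [exists q|move=> y /xI /ltW].
- move=> y Iy; rewrite lt_neqAle ub_le_sup// andbT; apply/eqP => yE.
  by apply: nU; rewrite -yE; exact: component_sub Iy.
- move=> y ysup yq; have yI0 : 0 < sup I - y by rewrite subr_gt0.
  have [z Iz zy] := sup_adherent yI0 hiI.
  by apply: (itvI q z) => //; apply/andP; split => //; lra.
Qed.

Lemma component_rat I : components U I -> exists q : rat, I (ratr q).
Proof.
move=> cI; have [x Ux xI] := cI.
have Ix : I x by rewrite -xI; exact: connected_component_refl.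
have [e e0 eU] := open_distP Ux.
have /rat_in_itvoo[q] : x < x + e by rewrite ltrDl.
rewrite in_itv /= => /andP[xq qe]; exists q.
by apply: (component_ball cI Ix eU); rewrite distrC ger0_norm; lra.
Qed.

End components.

(** * Martingale measures do not cross points of equal potential *)

Section finite_measures.
Context d (T : measurableType d) (R : realType).

Lemma finite_measure_exists (m : {measure set T -> \bar R}) : (m setT < +oo)%E ->
  exists M : {finite_measure set T -> \bar R}, forall A, M A = m A.
Proof.
move=> moo; have H : fin_num_fun m.
  move=> A mA; rewrite ge0_fin_numE//.
  by apply: le_lt_trans moo; rewrite le_measure ?inE.
pose f A := m A.
pose M0 := isMeasure.Build _ T R f (measure0 m) (measure_ge0 m)
  (@measure_semi_sigma_additive _ _ _ m).
pose M1 : {measure set T -> \bar R} := HB.pack f M0.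
pose M2 := Measure_isFinite.Build _ T R M1 H.
pose M : {finite_measure set T -> \bar R} := HB.pack (M1 : set T -> \bar R) M1 M2.
by exists M.
Qed.

Lemma null_of_Rintegral_eq0 (m : {measure set T -> \bar R}) (f : T -> R) S :
  m.-integrable setT (EFin \o f) -> (forall x, 0 <= f x) -> \int[m]_x f x = 0 ->
  measurable S -> (forall x, S x -> 0 < f x) -> m S = 0%E.
Proof.
move=> intf f0 int0 mS Sf; have mf := measurable_int m intf.
have E0 : (\int[m]_x `|(EFin \o f) x| = 0)%E.
  under eq_integral do rewrite /= ger0_norm//.
  by rewrite -(fineK (integrable_fin_num measurableT intf)) -[fine _]/(Rintegral m setT f) int0.
have [N [mN N0 fN]] : ae_eq m setT (EFin \o f) (cst 0%E).
  exact/(ae_eq_integral_abs m measurableT mf).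
apply: (subset_measure0 mS mN _ N0) => x Sx; apply: fN => /= /(_ I)[fx0].
by have := Sf x Sx; rewrite fx0 ltxx.
Qed.

End finite_measures.

Section centered_coupling.
Context (R : realType).
Variables (mu nu : fmeasR R).
Hypotheses (mu1 : finite_first_moment mu) (nu1 : finite_first_moment nu).
Let X := measurableTypeR R.

(** The martingale property without kernels: the conditional mean of the second
    coordinate is tested on the sets [A `*` setT]. *)
Definition centered_coupling (P : {finite_measure set (X * X)%type -> \bar R}) :=
  [/\ forall A, measurable A -> P (A `*` setT) = mu A,
      forall B, measurable B -> P (setT `*` B) = nu B &
      forall A, measurable A ->
        \int[P]_(z in A `*` setT) z.2 = \int[mu]_(x in A) x].

Lemma coupling_integrable_snd (P : {measure set (X * X)%type -> \bar R}) (h : X -> R) :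
  (forall B, measurable B -> P (setT `*` B) = nu B) -> nu.-integrable setT (EFin \o h) ->
  P.-integrable setT (EFin \o (fun z : X * X => h z.2)) /\
  \int[nu]_y h y = \int[P]_z h z.2.
Proof.
move=> Pnu inth; have PE B : measurable B -> nu B = P (snd @^-1` B).
  by move=> mB; rewrite -setTX Pnu.
split; first exact: (integrable_image measurable_snd PE inth).
exact: (Rintegral_image measurable_snd PE inth).
Qed.

Lemma coupling_integrable_fst (P : {measure set (X * X)%type -> \bar R}) (h : X -> R) :
  (forall A, measurable A -> P (A `*` setT) = mu A) -> mu.-integrable setT (EFin \o h) ->
  P.-integrable setT (EFin \o (fun z : X * X => h z.1)) /\
  \int[mu]_y h y = \int[P]_z h z.1.
Proof.
move=> Pnu inth; have PE B : measurable B -> mu B = P (fst @^-1` B).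
  by move=> mB; rewrite -setXT Pnu.
split; first exact: (integrable_image measurable_fst PE inth).
exact: (Rintegral_image measurable_fst PE inth).
Qed.

Lemma martingale_mean (k : R.-pker X ~> X) (P : {measure set (X * X)%type -> \bar R}) A
    (kap : {measure set X -> \bar R}) :
  disintegration mu P k -> {ae mu, forall x, \int[k x]_y y%:E = x%:E}%E ->
  (forall B, measurable B -> P (setT `*` B) = nu B) -> measurable A ->
  (forall B, measurable B -> kap B = P (A `*` B)) ->
  kap.-integrable setT (fun y : X => y%:E) /\ \int[kap]_y y = \int[mu]_(x in A) x.
Proof.
move=> PE kmean Pnu mA kapP.
have kap_nu B : measurable B -> (kap B <= nu B)%E.
  by move=> mB; rewrite kapP// -Pnu// le_measure ?inE//;
    [exact: measurableX|exact: measurableX|exact: setSX].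
have intk : kap.-integrable setT (fun y : X => y%:E) := le_measure_integrable kap_nu nu1.
split => //; rewrite /Rintegral; congr fine.
have kapE B : measurable B -> kap B = (\int[mu]_(x in A) k x B)%E.
  by move=> mB; rewrite kapP// (disintegration_rect PE).
have [ik ->] := kernel_fubini mA kapE intk.
have mid : measurable_fun A (fun x : X => x%:E).
  by apply: measurable_funTS; exact: (measurable_int mu mu1).
apply: (ae_eq_integral _ _ mA (measurable_int mu ik) mid).
by apply: filterS kmean => x h _.
Qed.

Lemma martingale_centered (P : {measure set (X * X)%type -> \bar R}) :
  martingale_measure mu nu P -> exists P' : {finite_measure set (X * X)%type -> \bar R},
    (forall S, P' S = P S) /\ centered_coupling P'.
Proof.
move=> [Pmu Pnu [k PE kmean]].
have Pmu' A : measurable A -> P (A `*` setT) = mu A by move=> mA; rewrite -Pmu// /pushforward -setXT.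
have Pnu' B : measurable B -> P (setT `*` B) = nu B by move=> mB; rewrite -Pnu// /pushforward -setTX.
have [|P' P'E] := @finite_measure_exists _ _ _ P.
  by rewrite -setXTT Pmu'// ltey_eq fin_num_measure.
exists P'; split => //; split => [A mA|B mB|A mA]; rewrite ?P'E//; first exact: Pmu'.
  exact: Pnu'.
have mX : measurable (A `*` setT : set (X * X)) by exact: measurableX.
have [kap kapE] := pushforward_measure_exists (mrestr P' mX)
  (measurable_snd : measurable_fun setT (@snd X X)).
have kapP B : measurable B -> kap B = P (A `*` B).
  move=> mB; rewrite kapE /mrestr -P'E; congr (P' _).
  by apply/seteqP; split => [z [? [? _]]|z [? ?]].
have [intk <-] := martingale_mean PE kmean Pnu' mA kapP.
rewrite (Rintegral_image measurable_snd (fun B _ => kapE B) intk).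
apply/esym/Rintegral_restricted_measure => //; first by move=> B mB; rewrite /mrestr setIC.
by apply: (coupling_integrable_snd (P := P') _ nu1).1 => B mB; exact: etrans (P'E _) (Pnu' _ mB).
Qed.

Section no_crossing.
Variable P : {finite_measure set (X * X)%type -> \bar R}.
Hypothesis cP : centered_coupling P.

Lemma centered_step (T : finType) (i : X -> T) (v w : T -> R) : finite_measurable i ->
  P.-integrable setT (fun z => (v (i z.1) + w (i z.1) * z.2)%:E) /\
  \int[P]_z (v (i z.1) + w (i z.1) * z.2) = \int[mu]_x (v (i x) + w (i x) * x).
Proof.
move=> mi; have [Pmu Pnu Pmean] := cP.
have mif : finite_measurable (i \o fst : X * X -> T).
  by move=> t; rewrite comp_preimage -setXT; exact: measurableX.
have [i2 _] := coupling_integrable_snd (h := id) Pnu nu1.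
split; first exact: (integrable_step_affine v w mif i2).
rewrite (@Rintegral_step_affine _ _ _ P T (i \o fst) v w (fun z => z.2 : R) mif i2).
rewrite (Rintegral_step_affine v w mi mu1).
apply: eq_bigr => t _.
have -> : (i \o fst) @^-1` [set t] = (i @^-1` [set t]) `*` [set: X].
  by apply/seteqP; split => [z|z []].
by rewrite Pmu ?Pmean//; exact: mi.
Qed.

(** With [s = -1] on [A] and [s = 1] off [A], both [|y - c|] and [s(x) (y - c)]
    integrate to the common potential at [c], so [y - c] almost surely has the
    sign of [s(x)]. *)
Lemma no_crossing A (c : R) : measurable A -> (forall x, x < c -> A x) ->
  (forall x, A x -> x <= c) -> potential mu c = potential nu c ->
  P (A `*` `]c, +oo[%classic) = 0%E /\ P (~` A `*` `]-oo, c[%classic) = 0%E.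
Proof.
move=> mA ltA leA; rewrite !potentialE// => -[pot_eq].
have [Pmu Pnu Pmean] := cP.
pose i (x : X) := x \in A.
have mi : finite_measurable i.
  move=> [|].
    rewrite (_ : _ @^-1` _ = A)//.
    by apply/seteqP; split => x /=; [exact: set_mem|exact: mem_set].
  rewrite (_ : _ @^-1` _ = ~` A); first exact: measurableC.
  apply/seteqP; split => x /=; last by move=> nAx; rewrite /i memNset.
  by move=> ix Ax; move: ix; rewrite /i mem_set.
pose w (b : bool) : R := if b then -1 else 1.
pose v b := - (w b * c).
have [is_ Es] := centered_step v w mi.
have [id Ed] := coupling_integrable_snd Pnu (integrable_dist c nu1).
have vwE b y : v b + w b * y = w b * (y - c) by rewrite /v; ring.
have dE x : v (i x) + w (i x) * x = `|x - c|.
  rewrite vwE /w /i; case: ifPn => [/set_mem/leA xc|/negP xA].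
    by rewrite ler0_norm ?subr_le0// mulN1r.
  rewrite mul1r ger0_norm// subr_ge0 leNgt; apply/negP => /ltA xA'.
  by apply: xA; exact: mem_set.
have le1 b y : w b * (y - c) <= `|y - c|.
  by rewrite /w; case: b; rewrite ?mulN1r ?mul1r ?ler_norm// -normrN ler_norm.
pose f (z : X * X) := `|z.2 - c| - (v (i z.1) + w (i z.1) * z.2).
have intf : P.-integrable setT (EFin \o f) := integrableB measurableT id is_.
have f0 z : 0 <= f z by rewrite /f vwE subr_ge0.
have int0 : \int[P]_z f z = 0.
  rewrite /f RintegralB// Es -Ed -pot_eq.
  have -> : \int[mu]_x (v (i x) + w (i x) * x) = \int[mu]_x `|x - c|.
    by apply: eq_Rintegral => x _; exact: dE.
  by rewrite subrr.
split; apply: (null_of_Rintegral_eq0 intf f0 int0) => [|[x y] [] /=].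
- exact: measurableX.
- rewrite in_itv /= andbT /f /= vwE /i /w => /mem_set -> cy.
  by rewrite ger0_norm; lra.
- by apply: measurableX => //; exact: measurableC.
- rewrite in_itv /= /f /= vwE /i /w => nAx yc; rewrite (memNset (nAx : ~ A x)).
  by rewrite ler0_norm; lra.
Qed.

End no_crossing.

End centered_coupling.

(** * Convex functions and their support lines *)

Section support_lines.
Context (R : realType).
Let X := measurableTypeR R.

Definition supported (s psi : R -> R) := forall c z, psi c + s c * (z - c) <= psi z.

Lemma supported_convex (s psi : R -> R) : supported s psi ->
  convex_function [set: R^o] psi.
Proof.
move=> sup_psi t x y _ _; rewrite [leRHS]convRE; set c := (X in psi X).
have cE : c = t%:inum * (x : R) + (1 - t%:inum) * (y : R) by [].
have t0 : 0 <= t%:inum :> R by [].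
have t1 : 0 <= 1 - t%:inum :> R by rewrite subr_ge0.
have := sup_psi c x; have := sup_psi c y.
move=> /(ler_wpM2l t1) hy /(ler_wpM2l t0) hx; apply: le_trans (lerD hx hy).
rewrite cE /unstable.onem le_eqVlt; apply/orP; left; apply/eqP; ring.
Qed.

Lemma convex_supported (psi : R -> R) : convex_function [set: R^o] psi ->
  exists s, supported s psi.
Proof.
move=> cpsi.
have three x c y : x < c -> c < y -> (psi c - psi x) / (c - x) <= (psi y - psi c) / (y - c).
  move=> xc cy; have yx : 0 < y - x by lra.
  pose t := (y - c) / (y - x).
  have t0 : 0 <= t by rewrite divr_ge0 ?(ltW yx)//; lra.
  have t1 : t <= 1 by rewrite ler_pdivrMr//; lra.
  have := cpsi (Itv01 t0 t1) x y; rewrite !inE => /(_ I I).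
  rewrite !convRE /= /unstable.onem.
  have -> : conv (Itv01 t0 t1) (x : convex_lmodType R^o) y = c.
    transitivity (t * x + (1 - t) * y); first by [].
    by rewrite /t; field; lra.
  have E : (y - x) * t = y - c by rewrite /t; field; lra.
  move=> /(ler_wpM2l (ltW yx)).
  have -> : (y - x) * (t * psi x + (1 - t) * psi y) = ((y - x) * t) * psi x + (y - x - (y - x) * t) * psi y by ring.
  rewrite E ler_pdivrMr ?subr_gt0// mulrAC ler_pdivlMr ?subr_gt0//; lra.
have /choice[s sP] c : exists s, forall z, psi c + s * (z - c) <= psi z.
  pose Q := [set r | exists2 x, x < c & r = (psi c - psi x) / (c - x)].
  have ubQ y : c < y -> ubound Q ((psi y - psi c) / (y - c)).
    by move=> cy _ [x xc ->]; exact: three.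
  have Q0 : Q !=set0 by exists ((psi c - psi (c - 1)) / (c - (c - 1))), (c - 1) => //; lra.
  exists (sup Q) => z; have [zc|cz|<-] := ltgtP z c; last by rewrite subrr mulr0 addr0.
    have : (psi c - psi z) / (c - z) <= sup Q.
      apply: ub_le_sup; last by exists z.
      by exists ((psi (c + 1) - psi c) / (c + 1 - c)); apply: ubQ; lra.
    by rewrite ler_pdivrMr; lra.
  have : sup Q <= (psi z - psi c) / (z - c) by apply: ge_sup => //; exact: ubQ.
  by rewrite ler_pdivlMr; lra.
by exists s => c z; exact: sP.
Qed.

Lemma supported_measurable (s psi : R -> R) : supported s psi ->
  measurable_fun setT (psi : X -> X).
Proof.
move=> sup_psi mT; apply: (measurability _ (RGenOInfty.measurableE R)) => //.
move=> _ [_ [a ->] <-]; rewrite setTI.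
rewrite (_ : _ @^-1` _ = ~` [set x : X | psi x <= a]); last first.
  by apply/seteqP; split => x /=; rewrite in_itv /= andbT ltNge; move/negP.
apply: measurableC; apply: is_interval_measurable => x y /= xa ya z /andP[xz zy].
have [s0|s0] := leP 0 (s z).
  have h : 0 <= s z * (y - z) by rewrite mulr_ge0// subr_ge0.
  by have := sup_psi z y; lra.
have h : 0 <= s z * (x - z) by rewrite mulr_le0 ?(ltW s0)// subr_le0.
by have := sup_psi z x; lra.
Qed.

Lemma supported_affine (a b : R) : supported (fun=> b) (fun x => a + b * x).
Proof. by move=> c z; lra. Qed.

Lemma supported_dist (c : R) : supported (fun x => if x <= c then -1 else 1) (fun x => `|x - c|).
Proof.
move=> x z /=; have [xc|xc] := leP x c.
  rewrite (ler0_norm (_ : x - c <= 0)) ?subr_le0//.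
  by have := ler_norm (- (z - c)); rewrite normrN; lra.
rewrite (ger0_norm (_ : 0 <= x - c)) ?subr_ge0 ?(ltW xc)//.
by have := ler_norm (z - c); lra.
Qed.

Lemma supported_integrable (mu : fmeasR R) (s psi : R -> R) (K : R) : finite_first_moment mu ->
  supported s psi -> (forall x, `|s x| <= K) -> mu.-integrable setT (fun x : X => (psi x)%:E).
Proof.
move=> mu1 sup_psi sK.
have idom : mu.-integrable setT (EFin \o (fun x : X => `|psi 0| + K * `|x|)).
  have i0 := finite_measure_integrable_cst mu `|psi 0| measurableT.
  have i1 := integrable_norm (mu1 : mu.-integrable setT (EFin \o (fun x : X => x : R))).
  have := integrableD measurableT i0 (integrableZl measurableT K i1).
  by apply: eq_integrable => // x _ /=; rewrite EFinD EFinM.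
apply: (le_integrable measurableT _ _ idom).
  have mp := supported_measurable sup_psi.
  apply/measurable_EFinP; exact: mp.
move=> x _ /=; rewrite lee_fin.
have K0 : 0 <= K by apply: le_trans (sK 0).
rewrite [leRHS]ger0_norm; last by rewrite addr_ge0// mulr_ge0.
have b c : `|s c * x| <= K * `|x| by rewrite normrM ler_wpM2r.
have := sup_psi 0 x; have := sup_psi x 0; rewrite !subr0 sub0r mulrN.
have := b 0; have := b x; have := ler_norm (psi 0); have := ler_norm (- psi 0).
by rewrite normrN !ler_norml; lra.
Qed.

Lemma supported_convex_order (mu nu : fmeasR R) (s psi : R -> R) (K : R) :
  finite_first_moment mu -> finite_first_moment nu -> convex_order mu nu ->
  supported s psi -> (forall x, `|s x| <= K) ->
  \int[mu]_x psi x <= \int[nu]_x psi x.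
Proof.
move=> mu1 nu1 cmn sup_psi sK; apply: fine_le.
- exact: integrable_fin_num (supported_integrable mu1 sup_psi sK).
- exact: integrable_fin_num (supported_integrable nu1 sup_psi sK).
- exact: cmn (supported_convex sup_psi).
Qed.

Lemma Rintegral_affine (m : fmeasR R) (a b : R) : finite_first_moment m ->
  \int[m]_x (a + b * x) = a * fine (m setT) + b * \int[m]_x x.
Proof.
move=> m1; have ia := finite_measure_integrable_cst m a measurableT.
have ib : m.-integrable setT (EFin \o (fun x : X => b * x)).
  exact: (integrableZl measurableT b m1).
have -> : \int[m]_x (a + b * x) = \int[m]_x a + \int[m]_x (b * x).
  exact: (RintegralD measurableT ia ib).
by rewrite Rintegral_cst// (RintegralZl b measurableT m1).
Qed.

Lemma convex_order_potential (mu nu : fmeasR R) (c : R) : convex_order mu nu ->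
  (potential mu c <= potential nu c)%E.
Proof. by move=> cmn; exact: cmn (supported_convex (@supported_dist c)). Qed.

(** Affine functions are convex together with their opposites. *)
Lemma convex_order_affine (mu nu : fmeasR R) (a b : R) :
  finite_first_moment mu -> finite_first_moment nu -> convex_order mu nu ->
  \int[mu]_x (a + b * x) = \int[nu]_x (a + b * x).
Proof.
move=> mu1 nu1 cmn.
have le a' b' := supported_convex_order mu1 nu1 cmn (supported_affine a' b') (fun=> lexx `|b'|).
have int (m : fmeasR R) : finite_first_moment m -> m.-integrable setT (fun x : X => (a + b * x)%:E).
  by move=> m1; exact: supported_integrable m1 (supported_affine a b) (fun=> lexx `|b|).
apply/eqP; rewrite eq_le le /=.
have := le (- a) (- b).
have opp (m : fmeasR R) : finite_first_moment m ->
    \int[m]_x (- a + - b * x) = - \int[m]_x (a + b * x).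
  move=> m1; transitivity (\int[m]_x (-1 * (a + b * x))).
    by apply: eq_Rintegral => x _; ring.
  by have := RintegralZl (-1) measurableT (int m m1); rewrite mulN1r.
by rewrite !opp// lerN2.
Qed.

Lemma convex_order_mass (mu nu : fmeasR R) :
  finite_first_moment mu -> finite_first_moment nu -> convex_order mu nu ->
  mu setT = nu setT.
Proof.
move=> mu1 nu1 cmn; have := convex_order_affine 1 0 mu1 nu1 cmn.
rewrite -(fine_measureK mu measurableT) -(fine_measureK nu measurableT).
by rewrite !Rintegral_affine// !mul1r !mul0r !addr0 => ->.
Qed.

End support_lines.

(** * Convex order along a kernel *)

Section jensen.
Context (R : realType).
Let X := measurableTypeR R.
Local Open Scope ereal_scope.

Lemma integral_ge0_add_integrable d (T : measurableType d) (m : {measure set T -> \bar R})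
    (f g : T -> R) : (forall x, (0 <= f x)%R) -> measurable_fun setT f ->
  m.-integrable setT (EFin \o g) ->
  \int[m]_x (f x + g x)%:E = \int[m]_x (f x)%:E + \int[m]_x (g x)%:E.
Proof.
move=> f0 mf intg; have mg : measurable_fun setT (EFin \o g) := measurable_int m intg.
have mfE : measurable_fun setT (EFin \o f) by exact/measurable_EFinP.
have mfg : measurable_fun setT (EFin \o (fun x => f x + g x)%R).
  by apply/measurable_EFinP/measurable_funD => //; exact/measurable_EFinP.
have [foo|foo] := ltP (\int[m]_x (f x)%:E) +oo.
  have intf : m.-integrable setT (EFin \o f).
    apply/integrableP; split => //.
    by under eq_integral do rewrite /= ger0_norm//.
  by rewrite -integralD.
have fE : \int[m]_x (f x)%:E = +oo by apply/eqP; rewrite -leye_eq.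
have gfin := integrable_fin_num measurableT intg.
rewrite fE addye; last by move: gfin; rewrite fin_numE => /andP[].
have intgn := integrable_funeneg measurableT intg.
have gnfin := integrable_fin_num measurableT intgn.
rewrite integralE; set fg := (fun x : T => (f x + g x)%:E).
have neg_fin : \int[m]_x fg^\- x < +oo.
  apply: le_lt_trans (_ : _ <= \int[m]_x (EFin \o g)^\- x) _; last first.
    by rewrite ltey_eq gnfin.
  apply: ge0_le_integral => //; first exact: measurable_funeneg.
    exact: measurable_funeneg.
  move=> x _; rewrite !funenegE /fg /= -?EFinN -!EFin_max lee_fin.
  by rewrite ge_max !le_max lexx orbT andbT lerN2 lerDr f0.
suff -> : \int[m]_x fg^\+ x = +oo.
  rewrite addye// eqe_oppLR /=.
  by rewrite -ltey.
apply/eqP; rewrite -leye_eq -fE leNgt; apply/negP => fgoo.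
have : \int[m]_x (f x)%:E <= \int[m]_x (fg^\+ x + (EFin \o g)^\- x).
  apply: ge0_le_integral => //.
  - by move=> x _; rewrite lee_fin.
  - by apply: emeasurable_funD; [exact: measurable_funepos|exact: measurable_funeneg].
  move=> x _; rewrite funeposE funenegE /fg /= -?EFinN -!EFin_max -EFinD lee_fin.
  have h1 : (f x + g x <= Num.max (f x + g x) 0)%R by rewrite le_max lexx.
  have h2 : (- g x <= Num.max (- g x) 0)%R by rewrite le_max lexx.
  by lra.
rewrite ge0_integralD//; [|exact: measurable_funepos|exact: measurable_funeneg].
rewrite leNgt fE => /negP; apply; rewrite lte_add_pinfty//; last by rewrite ltey_eq gnfin.
by rewrite -fE.
Qed.

Lemma fin_num_integrable d (T : measurableType d) (m : {measure set T -> \bar R})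
    (f : T -> \bar R) : measurable_fun setT f -> \int[m]_x f x \is a fin_num ->
  m.-integrable setT f.
Proof.
move=> mf; rewrite integralE fin_numB => /andP[fp fn].
apply/integrableP; split => //.
rewrite (eq_integral (fun x => f^\+ x + f^\- x)); last first.
  by move=> x _; have /(congr1 (@^~ x)) := fune_abse f.
rewrite ge0_integralD//; [|exact: measurable_funepos|exact: measurable_funeneg].
by rewrite lte_add_pinfty// ltey_eq ?fp ?fn.
Qed.

Lemma kernel_jensen (m : {measure set X -> \bar R}) (x : R) (s psi : R -> R) : m setT = 1 ->
  supported s psi -> (forall y, (0 <= psi y)%R) -> \int[m]_y y%:E = x%:E ->
  (psi x)%:E <= \int[m]_y (psi y)%:E.
Proof.
move=> mT sup_psi psi0 mx.
have mpsi : measurable_fun setT (fun y : X => (psi y)%:E).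
  apply/measurable_EFinP; exact: (supported_measurable sup_psi).
have mid : measurable_fun setT (fun y : X => y%:E) by exact/measurable_EFinP.
have iid : m.-integrable setT (fun y : X => y%:E).
  by apply: fin_num_integrable => //; rewrite mx.
pose a := (psi x - s x * x)%R.
have ia : m.-integrable setT (EFin \o cst a).
  apply/integrableP; split; first exact: (measurable_cst a%:E).
  by rewrite [ltLHS](_ : _ = \int[m]_y (cst `|a|%:E) y)// integral_cst// mT mule1 ltry.
have isid := integrableZl measurableT (s x) iid.
have il := integrableD measurableT ia isid.
pose g (y : X) := (a + s x * y)%R.
have ig : m.-integrable setT (EFin \o g) by [].
have gE : \int[m]_y (g y)%:E = (psi x)%:E.
  transitivity (\int[m]_y ((EFin \o cst a) y + (s x)%:E * y%:E)); first by [].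
  rewrite (integralD measurableT ia isid) integralZl// mx.
  rewrite -[X in X + _]/(\int[m]_y (cst a%:E) y) integral_cst//= mT mule1.
  by rewrite -EFinM -EFinD /a subrK.
rewrite -gE integralE; apply: (@le_trans _ _ (\int[m]_y (EFin \o g)^\+ y)).
  have gn0 : 0 <= \int[m]_y (EFin \o g)^\- y by exact: integral_ge0.
  by rewrite leeBlDr ?leeDl// (integrable_fin_num measurableT (integrable_funeneg measurableT ig)).
apply: ge0_le_integral => //.
- by apply: measurable_funepos; exact: (measurable_int m ig).
- move=> y _; rewrite funeposE /= -EFin_max lee_fin ge_max psi0 andbT.
  by have := sup_psi x y; rewrite /g /a; lra.
Qed.

Section kernel_order.
Variables (mu nu : fmeasR R).
Hypotheses (mu1 : finite_first_moment mu) (nu1 : finite_first_moment nu).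

(** Jensen's inequality for the kernel, applied to [phi] minus an affine minorant. *)
Lemma convex_order_kernel (k : R.-pker X ~> X) (P : {measure set (X * X)%type -> \bar R})
    (A : set X) (mA : measurable A) (kap : fmeasR R) :
  disintegration mu P k -> {ae mu, forall x, \int[k x]_y y%:E = x%:E} ->
  (forall B, measurable B -> P (setT `*` B) = nu B) ->
  (forall B, measurable B -> kap B = P (A `*` B)) ->
  finite_first_moment kap /\ convex_order (mrestr mu mA) kap.
Proof.
move=> PE kmean Pnu kapP.
have [kap1 kmean1] := martingale_mean mu1 nu1 PE kmean Pnu mA kapP.
split => // phi /convex_supported[s sup_phi].
have kapE B : measurable B -> kap B = \int[mu]_(x in A) k x B.
  by move=> mB; rewrite kapP// (disintegration_rect PE).
have mrE B : measurable B -> mrestr mu mA B = mu (A `&` B) by move=> mB; rewrite /mrestr setIC.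
pose l (y : X) : R := (phi 0 + s 0 * y)%R.
pose psi (y : X) : R := (phi y - l y)%R.
have psi0 y : (0 <= psi y)%R by rewrite /psi /l; have := sup_phi 0%R y; lra.
have sup_psi : supported (fun c => s c - s 0)%R psi.
  by move=> c z; rewrite /psi /l; have := sup_phi c z; lra.
have mpsi : measurable_fun setT (psi : X -> X) := supported_measurable sup_psi.
have il (m : fmeasR R) : finite_first_moment m -> m.-integrable setT (EFin \o l).
  by move=> m1; exact: supported_integrable m1 (supported_affine _ _) (fun=> lexx `|s 0|%R).
have mr1 : finite_first_moment (mrestr mu mA).
  apply: (le_measure_integrable (nu := mu)) mu1 => B mB.
  by rewrite /= /mrestr le_measure ?inE//; exact: measurableI.
have phiE (m : fmeasR R) : finite_first_moment m ->
    \int[m]_x (phi x)%:E = \int[m]_x (psi x)%:E + \int[m]_x (l x)%:E.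
  move=> m1; rewrite -(integral_ge0_add_integrable psi0 mpsi (il m m1)).
  by apply: eq_integral => x _; rewrite /psi subrK.
have psiE0 y : 0 <= (psi y)%:E by rewrite lee_fin.
have mpsiE : measurable_fun setT (fun y : X => (psi y)%:E) by exact/measurable_EFinP.
rewrite !phiE//; apply: leeD.
  rewrite (ge0_integral_restricted_measure mA mrE psiE0 mpsiE).
  rewrite (kernel_tonelli mA kapE psiE0 mpsiE).
  apply: ae_ge0_le_integral => //.
  - exact: measurable_funTS.
  - by move=> x _; exact: integral_ge0.
  - apply: measurable_funTS.
    by apply: measurable_fun_integral_kernel => //= U mU; exact: measurable_kernel.
  - apply: filterS kmean => x kx _.
    exact: (kernel_jensen (prob_kernel x) sup_psi psi0 kx).
have lE (m : fmeasR R) : finite_first_moment m -> \int[m]_x (l x)%:E =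
    (phi 0 * fine (m setT) + s 0 * Rintegral m setT (fun x : X => x))%R%:E.
  move=> m1; rewrite -(Rintegral_affine _ _ m1) /Rintegral fineK//.
  exact: integrable_fin_num (il m m1).
rewrite !lE// kmean1 (Rintegral_restricted_measure mA mrE mu1).
rewrite kapE//; under eq_integral do rewrite prob_kernel.
by rewrite integral_cst//= mul1e /mrestr setTI.
Qed.

End kernel_order.

End jensen.

(** * Where a martingale coupling lives *)

Section crossings.
Context (R : realType).
Variables (mu nu : fmeasR R).
Hypotheses (mu1 : finite_first_moment mu) (nu1 : finite_first_moment nu).
Hypothesis cmn : convex_order mu nu.
Let X := measurableTypeR R.

Definition gap : set R := [set x | (potential mu x < potential nu x)%E].

Lemma open_gap : open gap. Proof. exact: open_potential_lt. Qed.

Lemma eq_potential c : ~ gap c -> potential mu c = potential nu c.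
Proof.
move=> nc; apply/eqP; rewrite eq_le convex_order_potential// leNgt.
exact/negP.
Qed.

Definition crossing (c : R) : set (X * X) :=
  [set z | z.1 <= c < z.2] `|` [set z | z.2 < c <= z.1].

(** Rational points and ends of components suffice to separate any two points
    that no coupling can join. *)
Definition barrier (q : rat) : set R :=
  [set ratr q; inf (connected_component gap (ratr q)); sup (connected_component gap (ratr q))]
  `\` gap.

Definition crossings : set (X * X) :=
  \bigcup_q \bigcup_(c in barrier q) crossing c.

Lemma crossing_null (P : {finite_measure set (X * X)%type -> \bar R}) c :
  centered_coupling mu nu P -> ~ gap c -> P.-negligible (crossing c).
Proof.
move=> cP /eq_potential eq_c.
have [m1 m2] : measurable (`]-oo, c[%classic : set X) /\ measurable (`]-oo, c]%classic : set X) by [].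
have [||N1 _] := no_crossing mu1 nu1 cP m2 _ _ eq_c.
- by move=> x xc; rewrite /= in_itv /= ltW.
- by move=> x; rewrite /= in_itv.
have [||_ N2] := no_crossing mu1 nu1 cP m1 _ _ eq_c.
- by move=> x xc; rewrite /= in_itv.
- by move=> x; rewrite /= in_itv => /ltW.
apply: negligibleU.
  exists (`]-oo, c]%classic `*` `]c, +oo[%classic); split => //; first exact: measurableX.
  by move=> z /andP[zc cz]; split; rewrite /= in_itv /= ?andbT.
exists ((~` `]-oo, c[%classic) `*` `]-oo, c[%classic); split => //.
  by apply: measurableX => //; exact: measurableC.
move=> z /andP[zc cz]; split; rewrite /= in_itv //=.
by apply/negP; rewrite -leNgt.
Qed.

Lemma negligible_bigcup_countable d (T : measurableType d) (m : {measure set T -> \bar R})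
    (I : countType) (F : I -> set T) :
  (forall i, m.-negligible (F i)) -> m.-negligible (\bigcup_i F i).
Proof.
move=> F0; apply: (@negligibleS _ _ _ m (\bigcup_n oapp F set0 (unpickle n))).
  by move=> x [i _ Fx]; exists (pickle i) => //; rewrite pickleK.
apply: negligible_bigcup => n; case: (unpickle n) => //=; exact: negligible_set0.
Qed.

Lemma crossings_null (P : {finite_measure set (X * X)%type -> \bar R}) :
  centered_coupling mu nu P -> P.-negligible crossings.
Proof.
move=> cP; apply: negligible_bigcup_countable => q.
have one c : P.-negligible [set z | ~ gap c /\ crossing c z].
  have [gc|ngc] := pselect (gap c).
    by apply: negligibleS (negligible_set0 P) => z [].
  by apply: negligibleS (crossing_null cP ngc) => z [].
apply: negligibleS (negligibleU (negligibleU (one (ratr q))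
  (one (inf (connected_component gap (ratr q))))) (one (sup (connected_component gap (ratr q))))).
by move=> z [c [[[]|]-> nc] cz]; [left; left|left; right|right].
Qed.

Lemma uncrossed x y : ~ crossings (x, y) -> x != y -> exists I, [/\ components gap I, I x &
  [\/ I y, has_lbound I /\ y = inf I | has_ubound I /\ y = sup I]].
Proof.
have oG := open_gap.
move=> ncr; have cr q c : barrier q c -> x <= c < y -> False.
  by move=> qc xy; apply: ncr; exists q => //; exists c => //; left.
have cr' q c : barrier q c -> y < c <= x -> False.
  by move=> qc xy; apply: ncr; exists q => //; exists c => //; right.
rewrite neq_lt => /orP[|] /rat_in_itvoo[q]; rewrite in_itv /= => /andP[lo hi].
- have [gq|ngq] := pselect (gap (ratr q)); last first.
    by exfalso; apply: (cr q (ratr q)); [split => //; left; left|rewrite (ltW lo)].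
  set I := connected_component gap (ratr q).
  have cI : components gap I by exists (ratr q).
  have Iq : I (ratr q) by exact: connected_component_refl.
  have Ix : I x.
    apply: contrapT => nIx; have [_ xi ni /(_ _ Iq) iq _] := component_inf oG cI Iq nIx lo.
    by apply: (cr q (inf I)); [split => //; left; right|rewrite xi (lt_trans iq)].
  exists I; split => //; have [Iy|nIy] := pselect (I y); first by constructor 1.
  constructor 3; have [us sy ns sI _] := component_sup oG cI Iq nIy hi.
  split => //; apply/eqP; rewrite eq_le sy andbT leNgt; apply/negP => lt_sy.
  by apply: (cr q (sup I)); [split => //; right|rewrite lt_sy ltW// sI].
- have [gq|ngq] := pselect (gap (ratr q)); last first.
    by exfalso; apply: (cr' q (ratr q)); [split => //; left; left|rewrite lo ltW].
  set I := connected_component gap (ratr q).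
  have cI : components gap I by exists (ratr q).
  have Iq : I (ratr q) by exact: connected_component_refl.
  have Ix : I x.
    apply: contrapT => nIx; have [_ xi ni /(_ _ Iq) iq _] := component_sup oG cI Iq nIx hi.
    by apply: (cr' q (sup I)); [split => //; right|rewrite xi (lt_trans lo)].
  exists I; split => //; have [Iy|nIy] := pselect (I y); first by constructor 1.
  constructor 2; have [us sy ns sI _] := component_inf oG cI Iq nIy lo.
  split => //; apply/eqP; rewrite eq_le sy /= leNgt; apply/negP => lt_sy.
  by apply: (cr' q (inf I)); [split => //; left; right|rewrite lt_sy ltW// sI].
Qed.

End crossings.

(** * Decompositions into irreducible components *)

Section series_of_measures.
Context d (T : measurableType d) (R : realType).
Local Open Scope ereal_scope.

Lemma nneseries_eq_termwise (a b : nat -> \bar R) : (forall n, 0 <= b n) ->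
  (forall n, b n <= a n) -> \sum_(n <oo) b n = \sum_(n <oo) a n ->
  \sum_(n <oo) a n < +oo -> forall n, a n = b n.
Proof.
move=> b0 ba E aoo n; have a0 k : 0 <= a k by exact: le_trans (ba k).
move: E aoo; rewrite (@nneseriesD1 _ b n xpredT (fun k _ => b0 k) isT).
rewrite (@nneseriesD1 _ a n xpredT (fun k _ => a0 k) isT).
set sb := \sum_(0 <= k <oo | _) b k; set sa := \sum_(0 <= k <oo | _) a k => E aoo.
have sab : sb <= sa by apply: lee_nneseries => k _ //; exact: ba.
have sa0 : 0 <= sa by apply: nneseries_ge0 => k _ _; exact: a0.
have sb0 : 0 <= sb by apply: nneseries_ge0 => k _ _; exact: b0.
have fa : a n \is a fin_num.
  by rewrite ge0_fin_numE//; apply: le_lt_trans aoo; rewrite leeDl.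
have fs : sa \is a fin_num.
  by rewrite ge0_fin_numE//; apply: le_lt_trans aoo; rewrite leeDr.
have fsb : sb \is a fin_num by rewrite ge0_fin_numE//; apply: le_lt_trans sab _; rewrite ltey_eq fs.
have fb : b n \is a fin_num by rewrite ge0_fin_numE//; apply: le_lt_trans (ba n) _; rewrite ltey_eq fa.
move: (ba n) sab E; rewrite -(fineK fa) -(fineK fb) -(fineK fs) -(fineK fsb).
rewrite !lee_fin -!EFinD => h1 h2 [h3]; congr EFin; lra.
Qed.

Lemma ge0_integral_series_decomposition (m m0 : {measure set T -> \bar R})
    (ms : nat -> {measure set T -> \bar R}) (f : T -> \bar R) :
  (forall A, measurable A -> m A = m0 A + \sum_(n <oo) ms n A) ->
  (forall x, 0 <= f x) -> measurable_fun setT f ->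
  \int[m]_x f x = \int[m0]_x f x + \sum_(n <oo) \int[ms n]_x f x.
Proof.
move=> mE f0 mf.
transitivity (\int[measure_add m0 (mseries ms 0)]_x f x).
  by apply: eq_measure_integral => A mA _; rewrite mE//; exact/esym/measure_addE.
by rewrite ge0_integral_measure_add// ge0_integral_measure_series.
Qed.

End series_of_measures.

Section equal_potential.
Context (R : realType).
Implicit Types m : fmeasR R.
Let X := measurableTypeR R.

(** Equality of the potentials at [e] tests the convex function [|x - e|], and
    affine functions are always tested with equality. *)
Lemma equal_potential_null m m' (w e : R) : finite_first_moment m -> finite_first_moment m' ->
  convex_order m m' -> (w == 1) || (w == -1) -> potential m e = potential m' e ->
  m [set x | 0 < w * (x - e)] = 0%E -> m' [set x | 0 < w * (x - e)] = 0%E.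
Proof.
move=> m1 m1' cmm w1; rewrite !potentialE// => -[pE] m0.
have mS : measurable [set x : X | 0 < w * (x - e)].
  rewrite -[X in measurable X]setTI; apply: (@measurable_fun_ltr _ X R setT) => //.
  by apply: measurable_funM => //; exact: measurable_funB.
pose f (x : X) := `|x - e| + w * (x - e).
have f0 x : 0 <= f x.
  have := ler_norm (x - e); have := ler_norm (- (x - e)); rewrite normrN /f.
  by case/orP: w1 => /eqP ->; lra.
have ia (l : fmeasR R) : finite_first_moment l ->
    l.-integrable setT (EFin \o (fun x : X => - (w * e) + w * x)).
  by move=> l1; exact: supported_integrable l1 (supported_affine _ _) (fun=> lexx `|w|).
have fE (l : fmeasR R) : finite_first_moment l -> l.-integrable setT (EFin \o f) /\
    \int[l]_x f x = \int[l]_x `|x - e| + \int[l]_x (- (w * e) + w * x).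
  move=> l1; have id := integrable_dist e l1.
  have -> : f = (fun x => `|x - e| + (- (w * e) + w * x)) by apply/funext => x; rewrite /f; ring.
  split; first exact: (integrableD measurableT id (ia l l1)).
  exact: (RintegralD measurableT id (ia l l1)).
have [intf' E'] := fE m' m1'; have [intf E] := fE m m1.
apply: (null_of_Rintegral_eq0 intf' f0 _ mS); last first.
  by move=> x /= wx; rewrite /f ltr_wpDl.
rewrite E' -pE -(convex_order_affine _ _ m1 m1' cmm) -E.
suff : (\int[m]_x `|(EFin \o f) x| = 0)%E.
  under eq_integral do rewrite /= ger0_norm//.
  by move=> /(congr1 fine).
apply/(ae_eq_integral_abs m measurableT (measurable_int m intf)).
exists [set x | 0 < w * (x - e)]; split => //.
move=> x /= nf; rewrite ltNge; apply/negP => wx; apply: nf => _; congr EFin.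
move: wx; rewrite /f; case/orP: w1 => /eqP -> h.
  by rewrite ler0_norm; lra.
by rewrite ger0_norm; lra.
Qed.

End equal_potential.

Section component_enumeration.
Context (R : realType).
Variable U : set R.
Hypothesis oU : open U.
Let X := measurableTypeR R.

Lemma component_enum : exists c : nat -> option (set R),
  [/\ forall n I, c n = Some I -> components U I,
      forall I, components U I -> exists n, c n = Some I &
      forall n m I, c n = Some I -> c m = Some I -> n = m].
Proof.
have /choice[q qP] I : exists q : rat, components U I -> I (ratr q).
  have [/(component_rat oU)[q Iq]|nI] := pselect (components U I); first by exists q.
  by exists 0.
pose c n := if pickle_inv n is Some p then
  (let I := connected_component U (ratr p) in
   if `[< U (ratr p) /\ q I = p >] then Some I else None) else None.
have cP n I : c n = Some I -> components U I /\ n = pickle (q I).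
  rewrite /c; case E : (pickle_inv n) => [p|//]; case: ifP => // /asboolP[Up qp] [<-].
  split; first by exists (ratr p).
  by rewrite qp; have := @pickle_invK rat n; rewrite E.
exists c; split.
- by move=> n I /cP[].
- move=> I cI; exists (pickle (q I)); rewrite /c pickleK_inv.
  by rewrite -(component_mem cI (qP I cI)) asboolT//; split=> //; exact: component_sub cI _ (qP I cI).
- by move=> n m I /cP[_ ->] /cP[_ ->].
Qed.

End component_enumeration.

Section decomposition.
Context (R : realType).
Variables (mu nu : fmeasR R).
Hypotheses (mu1 : finite_first_moment mu) (nu1 : finite_first_moment nu).
Hypothesis cmn : convex_order mu nu.
Let X := measurableTypeR R.
Let U := gap mu nu.
Let oU : open U := open_gap mu1 nu1.

Lemma bigcup_components : \bigcup_(I in irr_comp mu nu) I = U.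
Proof.
apply/seteqP; split => [x [I cI Ix]|x Ux]; first exact: (component_sub cI Ix).
by exists (connected_component U x); [exists x|exact: connected_component_refl].
Qed.

Lemma measurable_gap : measurable (U : set X).
Proof. exact: open_measurable. Qed.

Section enumerated.
Variable c : nat -> option (set R).
Hypotheses (c_comp : forall n I, c n = Some I -> components U I)
  (c_all : forall I, components U I -> exists n, c n = Some I)
  (c_inj : forall n m I, c n = Some I -> c m = Some I -> n = m).

Let K n : set X := oapp id set0 (c n).

Let mK n : measurable (K n).
Proof.
rewrite /K; case E : (c n) => [I|]; last exact: measurable0.
exact: measurable_components (c_comp E).
Qed.

Let KE n I : c n = Some I -> K n = I. Proof. by rewrite /K => ->. Qed.

Let trivK : trivIset setT K.
Proof.
move=> n m _ _ [x []]; rewrite /K.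
case En : (c n) => [I|//]; case Em : (c m) => [J|//] /= Ix Jx.
have IJ := component_eq (c_comp En) (c_comp Em) Ix Jx.
by apply: (c_inj En); rewrite IJ.
Qed.

Let bigcupK : \bigcup_n K n = U.
Proof.
apply/seteqP; split => [x [n _]|x Ux].
  by rewrite /K; case E : (c n) => [I|//] /= Ix; exact: (component_sub (c_comp E) Ix).
have [n cn] := c_all (ex_intro2 _ _ x Ux erefl).
by exists n => //; rewrite (KE cn); exact: connected_component_refl.
Qed.

Lemma measure_split_components (m : {measure set X -> \bar R}) A : measurable A ->
  m A = (m (A `&` ~` U) + \sum_(n <oo) m (A `&` K n))%E.
Proof.
move=> mA; have mU := measurable_gap.
have -> : (\sum_(n <oo) m (A `&` K n) = m (A `&` U))%E.
  rewrite -bigcupK setI_bigcupr (@measure_semi_bigcup _ _ _ m (fun n => A `&` K n))//.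
  - by move=> n; exact: measurableI.
  - exact: trivIset_setIl.
  - by apply: bigcup_measurable => n _; exact: measurableI.
rewrite addeC -measureU//.
- by rewrite -setIUr setUv setIT.
- exact: measurableI.
- by apply: measurableI => //; exact: measurableC.
- by apply/seteqP; split => x // [[_ ?] [_]].
Qed.

Lemma esum_components (f : set R -> \bar R) : (forall I, 0 <= f I)%E ->
  (\esum_(I in irr_comp mu nu) f I = \sum_(n <oo) oapp f 0 (c n))%E.
Proof.
move=> f0; pose D := [set n | exists I, c n = Some I].
rewrite (@reindex_esum _ _ _ D _ (fun n => odflt set0 (c n))); last first.
  split.
  - by move=> n [I cn] /=; rewrite cn; exact: c_comp cn.
  - by move=> n m /set_mem[I cn] /set_mem[J cm]; rewrite cn cm /= => IJ; apply: (c_inj cn); rewrite IJ.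
  - by move=> I /c_all[n cn]; exists n; [exists I|rewrite cn].
rewrite esum_mkcond nneseries_esumT; last by move=> n; case: (c n) => /=.
apply: eq_esum => n _; case: ifPn => [/set_mem[I ->]//|/negP nD].
by case E : (c n) => [I|//]; exfalso; apply: nD; apply/mem_set; exists I.
Qed.

Section any_decomposition.
Variable nu_ : set R -> fmeasR R.
Hypothesis dec : irr_decomposition mu nu nu_.

Let mu0 : fmeasR R := mrestr mu (measurableC measurable_gap).
Let mun n : fmeasR R := mrestr mu (mK n).
Let nun n : fmeasR R := oapp nu_ mzero (c n).

Let mu_series A : measurable A -> mu A = (mu0 A + \sum_(n <oo) mun n A)%E.
Proof. exact: measure_split_components. Qed.

Let nu_series A : measurable A -> nu A = (mu0 A + \sum_(n <oo) nun n A)%E.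
Proof.
move=> mA; have [-> // _ _] := dec; rewrite bigcup_components esum_components//.
by congr (_ + _)%E; apply: eq_eseriesr => n _; rewrite /nun; case: (c n).
Qed.

Let mun1 n : finite_first_moment (mun n).
Proof.
apply: (le_measure_integrable (nu := mu)) mu1 => B mB.
by rewrite /= /mrestr le_measure ?inE//; exact: measurableI.
Qed.

Let nunP n : finite_first_moment (nun n) /\ convex_order (mun n) (nun n).
Proof.
have [_ nu_1 cnu_] := dec; rewrite /nun; case E : (c n) => [I|] /=.
  split; first exact: nu_1 (c_comp E).
  have := cnu_ I (c_comp E) => cI phi /cI; congr (_ <= _)%E.
  by apply: eq_measure_integral => A mA _; rewrite /= /mrestr (KE E).
have E0 (f : X -> \bar R) : (\int[mun n]_x f x = 0)%E.
  transitivity (\int[mzero]_(x in [set: X]) f x)%E; last by rewrite integral_measure_zero.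
  by apply: eq_measure_integral => A mA _; rewrite /= /mrestr /K E setI0 measure0.
split; first by rewrite /finite_first_moment; apply/integrableP; split => //;
  [exact/measurable_EFinP|rewrite integral_measure_zero].
by move=> phi _; rewrite E0 integral_measure_zero.
Qed.

Let potential_nun n e : ~ U e -> potential (mun n) e = potential (nun n) e.
Proof.
move=> nUe; have d0 (x : X) : (0 <= `|x - e|%:E)%E by rewrite lee_fin.
have md : measurable_fun setT (fun x : X => `|x - e|%:E).
  exact: (measurable_int _ (integrable_dist e mu1)).
have pm m : finite_first_moment m -> potential m e \is a fin_num by move=> m1; rewrite potentialE.
have Emu := ge0_integral_series_decomposition mu_series d0 md.
have Enu := ge0_integral_series_decomposition nu_series d0 md.
have mu0_1 : finite_first_moment mu0.
  apply: (le_measure_integrable (nu := mu)) mu1 => B mB.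
  by rewrite /= /mrestr le_measure ?inE//;
    exact: (measurableI _ _ mB (measurableC measurable_gap)).
have pE : (\sum_(n <oo) potential (mun n) e = \sum_(n <oo) potential (nun n) e)%E.
  have := eq_potential cmn nUe; rewrite /potential Emu Enu.
  set p := (\int[mu0]_x _)%E; have pfin : p \is a fin_num by exact: (pm _ mu0_1).
  by move=> /(congr1 (fun z => z - p)%E); rewrite ![(p + _)%E]addeC !addeK.
apply/esym; apply: (nneseries_eq_termwise _ _ pE) => [k|k|].
- exact: integral_ge0.
- by have [_ /(convex_order_potential e)] := nunP k.
- have : (potential nu e < +oo)%E by rewrite ltey_eq pm.
  by apply: le_lt_trans; rewrite /potential Enu leeDr// integral_ge0.
Qed.

Lemma decomposition_mass I : irr_comp mu nu I -> nu_ I setT = mu I.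
Proof.
move=> /c_all[n cn]; have [n1 cn1] := nunP n.
have := convex_order_mass (mun1 n) n1 cn1.
by rewrite /nun cn /= /mrestr setTI (KE cn) => ->.
Qed.

Lemma decomposition_side I (w e : R) : irr_comp mu nu I -> (w == 1) || (w == -1) ->
  ~ U e -> (forall x, I x -> w * (x - e) <= 0) ->
  nu_ I [set x | 0 < w * (x - e)] = 0%E.
Proof.
move=> /c_all[n cn] w1 nUe Ie; have [n1 cn1] := nunP n.
have := equal_potential_null (mun1 n) n1 cn1 w1 (potential_nun n nUe).
rewrite {1}/nun cn /=; apply.
rewrite /mrestr (KE cn) (_ : _ `&` _ = set0) ?measure0//.
by apply/seteqP; split => // x [/= + /Ie]; rewrite ltNge => /negP.
Qed.

(** [w = 1] is the half-line to the right of [e], [w = -1] the one to the left.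
    Every component other than [I] keeps its [nu_]-mass on its own side of [e],
    so [nu - mu] on the half-line is what [nu_ I] puts on its end [e]. *)
Lemma decomposition_end I (w e : R) : irr_comp mu nu I -> (w == 1) || (w == -1) ->
  ~ U e -> (forall x, I x -> w * (x - e) < 0) ->
  (forall J, irr_comp mu nu J -> J <> I -> (forall x, J x -> 0 < w * (x - e)) \/
     exists e', [/\ ~ U e', w * (e' - e) < 0 & forall x, J x -> w * (x - e') <= 0]) ->
  nu [set x | 0 <= w * (x - e)] =
  (mu [set x | (0 <= w * (x - e))%R] + nu_ I [set e])%E.
Proof.
move=> cI w1 nUe Ie sepI; set H := [set x | 0 <= w * (x - e)].
have w0 : w != 0 by case/orP: w1 => /eqP ->; rewrite ?oppr_eq0 oner_eq0.
have mlt e' : measurable [set x : X | 0 < w * (x - e')].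
  rewrite -[X in measurable X]setTI; apply: (@measurable_fun_ltr _ X R setT) => //.
  by apply: measurable_funM => //; exact: measurable_funB.
have HE : H = [set x | 0 < w * (x - e)] `|` [set e].
  apply/seteqP; split => [x|x [/= /ltW //|->]]; last by rewrite /H /= subrr mulr0.
  rewrite /H /= le_eqVlt => /orP[|]; last by left.
  by rewrite eq_sym mulf_eq0 (negPf w0) /= subr_eq0 => /eqP; right.
have mH : measurable (H : set X).
  by rewrite HE; exact: (measurableU _ _ (mlt e) (measurable_set1 e)).
have null_sub (m : fmeasR R) A B : measurable A -> measurable B -> A `<=` B -> m B = 0%E -> m A = 0%E.
  by move=> mA mB AB B0; apply: (subset_measure0 mA mB AB B0).
have [n0 cn0] := c_all cI.
have nunH n : nun n H = (mun n H + (if n == n0 then nu_ I [set e] else 0))%E.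
  rewrite /mun /nun /= /mrestr; case E : (c n) => [J|]; last first.
    rewrite /K E setI0 measure0 add0e; case: eqP => [nn0|//].
    by move: E; rewrite nn0 cn0.
  rewrite (KE E) /=; have cJ := c_comp E.
  case: eqP => [nn0|nn0].
    have -> : J = I by move: E; rewrite nn0 cn0 => -[].
    rewrite (_ : H `&` I = set0) ?measure0 ?add0e; last first.
      by apply/seteqP; split => // x [Hx /Ie]; rewrite ltNge => /negP.
    rewrite HE measureU//.
    - rewrite -[RHS]add0e; congr (_ + _)%E.
      by apply: (decomposition_side cI w1 nUe) => x /Ie/ltW.
    - by apply/seteqP; split => // x /= [h xe]; move: h; rewrite xe subrr mulr0 ltxx.
  rewrite adde0; have JI : J <> I by move=> JI; apply: nn0; apply: (c_inj E); rewrite JI.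
  case: (sepI J cJ JI) => [J0|[e' [nUe' ee' Je']]].
    rewrite (setIidr (_ : J `<=` H)); last by move=> x /J0/ltW.
    rewrite -(decomposition_mass cJ).
    have mHC : measurable (~` H : set X) by exact: measurableC.
    have HCE : ~` H = [set x | 0 < - w * (x - e)].
      by apply/seteqP; split => x /=; rewrite /H /= mulNr oppr_gt0 ltNge => /negP.
    rewrite -(setvU H) measureU// ?setICl// -[LHS]add0e; congr (_ + _)%E.
    apply/esym; rewrite HCE; apply: (decomposition_side cJ) => //.
      by case/orP: w1 => /eqP ->; rewrite ?opprK eqxx ?orbT.
    by move=> x /J0 /ltW; rewrite mulNr oppr_le0.
  rewrite (_ : H `&` J = set0) ?measure0//.
    apply: (null_sub _ _ _ mH (mlt e') _ (decomposition_side cJ w1 nUe' Je')).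
    by move=> x; rewrite /H /=; move: ee'; lra.
  by apply/seteqP; split => // x [Hx /Je']; move: Hx ee'; rewrite /H /=; lra.
rewrite nu_series// mu_series// -addeA; congr (_ + _)%E.
rewrite (eq_eseriesr (fun n _ => nunH n)) nneseriesD//; last first.
  by move=> n _ _; case: ifP.
congr (_ + _)%E; rewrite (@nneseriesD1 _ _ n0 xpredT) ?eqxx//; last by move=> n _; case: ifP.
by rewrite eseries0 ?adde0// => n _ /andP[_ /negPf ->].
Qed.

End any_decomposition.
End enumerated.
End decomposition.

Section ends.
Context (R : realType).
Variable U : set R.
Hypothesis oU : open U.
Implicit Types I J : set R.

(** [w = 1] for the right end of [I], [w = -1] for its left end. *)
Definition is_end I (w e : R) : Prop :=
  (w = 1 /\ has_ubound I /\ e = sup I) \/ (w = -1 /\ has_lbound I /\ e = inf I).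

Lemma is_end_sign I w e : is_end I w e -> (w == 1) || (w == -1).
Proof. by move=> [[-> _]|[-> _]]; rewrite eqxx ?orbT. Qed.

Lemma endpoints_is_end I e : endpoints I e -> exists w, is_end I w e.
Proof. by move=> [[lI eI]|[uI eI]]; [exists (-1); right|exists 1; left]. Qed.

Let out J I x : components U I -> components U J -> J <> I -> J x -> ~ I x.
Proof. by move=> cI cJ JI Jx Ix; apply: JI; exact: component_eq cJ cI Jx Ix. Qed.

Lemma is_endP I w e : components U I -> is_end I w e ->
  [/\ ~ U e, (forall x, I x -> w * (x - e) < 0),
     (forall x0, I x0 -> forall y, w * (y - e) < 0 -> 0 <= w * (y - x0) -> I y) &
    forall J, components U J -> J <> I -> (forall x, J x -> 0 < w * (x - e)) \/
     exists e', [/\ ~ U e', w * (e' - e) < 0 & forall x, J x -> w * (x - e') <= 0]].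
Proof.
move=> cI; have [q Iq] := component_rat oU cI.
have Jsub J x : components U J -> J x -> U x by move=> cJ; exact: component_sub.
move=> [] [-> []].
- move=> ubI ->; have [b bI] := ubI.
  have nIb : ~ I (b + 1) by move=> /bI; lra.
  have qb : ratr q < b + 1 by have := bI _ Iq; lra.
  have [_ _ nU Isup supI] := component_sup oU cI Iq nIb qb.
  split => //.
  + by move=> x /Isup; lra.
  + move=> x0 Ix0 y ys x0y; have x0b : x0 < b + 1 by have := bI _ Ix0; lra.
    have [_ _ _ _ supI'] := component_sup oU cI Ix0 nIb x0b.
    by apply: supI'; lra.
  move=> J cJ JI; have [[y [Jy sy]]|nJ] := pselect (exists y, J y /\ sup I < y).
    left=> x Jx; rewrite mul1r subr_gt0 ltNge; apply/negP => xs; apply: nU.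
    by apply: (Jsub J) => //; apply: (component_interval cJ Jx Jy); rewrite xs ltW.
  right; have below x : J x -> x < sup I.
    move=> Jx; rewrite lt_neqAle; apply/andP; split.
      by apply/eqP => xs; apply: nU; rewrite -xs; exact: Jsub Jx.
    by rewrite leNgt; apply/negP => sx; apply: nJ; exists x.
  have left_inf x : J x -> [/\ x <= inf I, ~ U (inf I) & inf I < sup I].
    move=> Jx; have s0 : 0 < sup I - x by rewrite subr_gt0 below.
    have [z Iz xz] := sup_adherent s0 (conj (ex_intro _ _ Iq) ubI).
    have lt_xz : x < z by lra.
    have [_ xi nUi Ii _] := component_inf oU cI Iz (out cI cJ JI Jx) lt_xz.
    by split => //; exact: lt_trans (Ii _ Iz) (Isup _ Iz).
  have [p Jp] := component_rat oU cJ; have [_ nUi is_] := left_inf _ Jp.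
  by exists (inf I); split => //; [lra|move=> x /left_inf[xi _ _]; lra].
- move=> lbI ->; have [b bI] := lbI.
  have nIb : ~ I (b - 1) by move=> /bI; lra.
  have qb : b - 1 < ratr q by have := bI _ Iq; lra.
  have [_ _ nU Iinf infI] := component_inf oU cI Iq nIb qb.
  split => //.
  + by move=> x /Iinf; lra.
  + move=> x0 Ix0 y ys x0y; have x0b : b - 1 < x0 by have := bI _ Ix0; lra.
    have [_ _ _ _ infI'] := component_inf oU cI Ix0 nIb x0b.
    by apply: infI'; lra.
  move=> J cJ JI; have [[y [Jy sy]]|nJ] := pselect (exists y, J y /\ y < inf I).
    left=> x Jx; rewrite mulN1r oppr_gt0 subr_lt0 ltNge; apply/negP => xs; apply: nU.
    by apply: (Jsub J) => //; apply: (component_interval cJ Jy Jx); rewrite xs ltW.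
  right; have above x : J x -> inf I < x.
    move=> Jx; rewrite lt_neqAle; apply/andP; split.
      by apply/eqP => xs; apply: nU; rewrite xs; exact: Jsub Jx.
    by rewrite leNgt; apply/negP => sx; apply: nJ; exists x.
  have right_sup x : J x -> [/\ sup I <= x, ~ U (sup I) & inf I < sup I].
    move=> Jx; have s0 : 0 < x - inf I by rewrite subr_gt0 above.
    have [z Iz xz] := inf_adherent s0 (conj (ex_intro _ _ Iq) lbI).
    have lt_xz : z < x by lra.
    have [_ xi nUi Ii _] := component_sup oU cI Iz (out cI cJ JI Jx) lt_xz.
    by split => //; exact: lt_trans (Iinf _ Iz) (Ii _ Iz).
  have [p Jp] := component_rat oU cJ; have [_ nUi is_] := right_sup _ Jp.
  by exists (sup I); split => //; [lra|move=> x /right_sup[xi _ _]; lra].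
Qed.

End ends.

Section existence.
Context (R : realType).
Variables (mu nu : fmeasR R).
Hypotheses (mu1 : finite_first_moment mu) (nu1 : finite_first_moment nu).
Hypothesis cmn : convex_order mu nu.
Let X := measurableTypeR R.
Let U := gap mu nu.
Let oU : open U := open_gap mu1 nu1.

(** Minimum of finitely many affine functions: minus it is convex and Lipschitz. *)
Lemma supported_affine_argmin (T : finType) (j : R -> T) (v w : T -> R) :
  (forall y t, v (j y) + w (j y) * y <= v t + w t * y) ->
  supported (fun y => - w (j y)) (fun y => - (v (j y) + w (j y) * y)) /\
  exists2 K, 0 <= K & forall y, `|- w (j y)| <= K.
Proof.
move=> jmin; split; first by move=> c z; have := jmin z (j c); lra.
exists (\sum_t `|w t|); first exact: sumr_ge0.
by move=> y; rewrite normrN (bigD1 (j y))//= lerDl sumr_ge0.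
Qed.

Lemma martingale_exists :
  exists P : {measure set (X * X)%type -> \bar R}, martingale_measure mu nu P.
Proof.
have [P mP _] : exists2 P : {measure set (X * X)%type -> \bar R}, martingale_measure mu nu P &
    forall S, measurable S -> ((mzero : {finite_measure set (X * X)%type -> \bar R}) S <= P S)%E.
  apply: strassen => // [B mB|T i j v w mi mj jmin].
    exact: measure_ge0.
  have zero (f : X * X -> R) : \int[mzero]_z f z = 0.
    by rewrite /Rintegral integral_measure_zero.
  rewrite !zero addr0 subr0.
  have [sup_j [K K0 jK]] := supported_affine_argmin jmin.
  have le := supported_convex_order mu1 nu1 cmn sup_j jK.
  have ij (m : fmeasR R) : finite_first_moment m ->
      m.-integrable setT (EFin \o (fun y : X => v (j y) + w (j y) * y)).
    by move=> m1; exact: integrable_step_affine.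
  have ii : mu.-integrable setT (EFin \o (fun y : X => v (i y) + w (i y) * y)).
    exact: integrable_step_affine.
  apply: le_trans (_ : \int[mu]_y (v (j y) + w (j y) * y) <= _).
    have opp (m : fmeasR R) : finite_first_moment m ->
        \int[m]_y (- (v (j y) + w (j y) * y)) = - \int[m]_y (v (j y) + w (j y) * y).
      move=> m1; transitivity (\int[m]_y (-1 * (v (j y) + w (j y) * y))).
        by apply: eq_Rintegral => x _; rewrite mulN1r.
      by have := RintegralZl (-1) measurableT (ij m m1); rewrite mulN1r.
    by move: le; rewrite !opp// lerN2.
  exact: (le_Rintegral measurableT (ij mu mu1) ii (fun x _ => jmin x (i x))).
by exists P.
Qed.

End existence.

Section irreducible_pairs.
Context (R : realType).
Variables (mu nu : fmeasR R).
Hypotheses (mu1 : finite_first_moment mu) (nu1 : finite_first_moment nu).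
Hypothesis cmn : convex_order mu nu.
Let X := measurableTypeR R.
Let U := gap mu nu.
Let oU : open U := open_gap mu1 nu1.

Lemma measure_eq_mod_negligible d (T : measurableType d) (m : {measure set T -> \bar R})
    (A B N : set T) : measurable A -> measurable B -> m.-negligible N ->
  (forall z, ~ N z -> A z <-> B z) -> m A = m B.
Proof.
move=> mA mB [N' [mN' N'0 NN']] AB.
have le C D : measurable C -> measurable D -> (forall z, ~ N z -> C z -> D z) -> (m C <= m D)%E.
  move=> mC mD CD; apply: (@le_trans _ _ (m (D `|` N'))).
    rewrite le_measure ?inE//; first exact: measurableU.
    move=> z Cz; have [Nz|nNz] := pselect (N z); first by right; exact: NN'.
    by left; exact: CD.
  by apply: le_trans (measureU2 _ mD mN') _; rewrite [X in (_ + X)%E](_ : _ = 0%E) ?adde0.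
by apply/eqP; rewrite eq_le !le// => z nNz; [move/(AB z nNz)|move/(AB z nNz)].
Qed.

(** A martingale measure decomposes along the components of its first coordinate,
    and is carried by the diagonal over their complement. *)
Lemma martingale_decomposition (P : {measure set (X * X)%type -> \bar R}) :
  martingale_measure mu nu P -> exists2 nu_, irr_decomposition mu nu nu_ &
    forall I B, irr_comp mu nu I -> measurable B -> nu_ I B = P (I `*` B).
Proof.
move=> mP; have [P' [P'E cP]] := martingale_centered mu1 nu1 mP.
have [Pmu Pnu _] := cP; have [_ _ [k PE kmean]] := mP.
have Pnu' B : measurable B -> P (setT `*` B) = nu B by move=> mB; rewrite -P'E Pnu.
have /choice[nu_ nuE] I : exists kap : fmeasR R, forall cI : irr_comp mu nu I,
    forall B, measurable B -> kap B = P (I `*` B).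
  have [cI|nI] := pselect (irr_comp mu nu I); last by exists mzero.
  have mI := measurable_components cI.
  have [kap kapE] := rect_measure_exists P mI.
  have [|kap' kap'E] := @finite_measure_exists _ _ _ kap.
    rewrite kapE// -P'E; apply: le_lt_trans (_ : _ <= P' (setT `*` setT))%E _.
      by apply: le_measure; rewrite ?inE//; first [exact: measurableX|exact: setSX].
    by rewrite Pnu// ltey_eq fin_num_measure.
  by exists kap' => _ B mB; rewrite kap'E kapE.
exists nu_; last by move=> I B cI mB; exact: nuE.
split=> [A mA|I cI|I cI].
- have [c [c1 c2 c3]] := component_enum oU.
  rewrite bigcup_components// (esum_components c1 c2 c3) => [|I]; last exact: measure_ge0.
  have mTA : measurable (setT `*` A : set (X * X)) by exact: measurableX.
  have [m mE] := pushforward_measure_exists (mrestr P' mTA)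
    (measurable_fst : measurable_fun setT (@fst X X)).
  have mP' S : m S = P' (S `*` A).
    by rewrite mE /mrestr; congr (P' _); apply/seteqP; split => [z [? [_ ?]]|z [? ?]].
  have mU : measurable (U : set X) := measurable_gap mu1 nu1.
  have := measure_split_components mu1 nu1 c1 c2 c3 m measurableT.
  rewrite mP' Pnu// => ->; congr (_ + _)%E.
    rewrite mP' setTI -Pmu; last by apply: measurableI => //; exact: measurableC.
    apply: (measure_eq_mod_negligible _ _ (crossings_null mu1 nu1 cmn cP)).
    - by apply: measurableX => //; exact: measurableC.
    - by apply: measurableX => //; apply: measurableI => //; exact: measurableC.
    move=> [x y] nxy; split => /= [[nUx Ay]|[[Ax nUx] _]]; have [xy|xy] := eqVneq x y.
    - by rewrite xy in nUx *.
    - by have [I [cI Ix _]] := uncrossed mu1 nu1 nxy xy; case: nUx; exact: component_sub cI _ Ix.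
    - by rewrite -xy.
    - by have [I [cI Ix _]] := uncrossed mu1 nu1 nxy xy; case: nUx; exact: component_sub cI _ Ix.
  apply: eq_eseriesr => n _; rewrite setTI mP'; case E : (c n) => [I|] /=.
    by rewrite (nuE I (c1 _ _ E))// P'E.
  by rewrite set0X measure0.
- exact: (convex_order_kernel mu1 nu1 (measurable_components cI) PE kmean Pnu' (nuE I cI)).1.
- exact: (convex_order_kernel mu1 nu1 (measurable_components cI) PE kmean Pnu' (nuE I cI)).2.
Qed.

Lemma irr_nu_decomposition : irr_decomposition mu nu (irr_nu mu nu).
Proof.
rewrite /irr_nu; case: pselect => [ex|[]]; first exact: (svalP (cid ex)).
have [P mP] := martingale_exists mu1 nu1 cmn.
by have [nu_ dec _] := martingale_decomposition mP; exists nu_.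
Qed.

Lemma irr_end_of_decomposition nu_ I (w e : R) : irr_decomposition mu nu nu_ ->
  irr_comp mu nu I -> is_end I w e ->
  nu [set x | 0 <= w * (x - e)] = (mu [set x | (0 <= w * (x - e))%R] + nu_ I [set e])%E.
Proof.
move=> dec cI eI; have [c [c1 c2 c3]] := component_enum oU.
have [nUe Ie _ sepI] := is_endP oU cI eI.
exact: (decomposition_end mu1 nu1 cmn c1 c2 c3 dec cI (is_end_sign eI) nUe Ie sepI).
Qed.

Lemma irr_nu_end I (w e : R) : irr_comp mu nu I -> is_end I w e ->
  nu [set x | 0 <= w * (x - e)] =
  (mu [set x | (0 <= w * (x - e))%R] + irr_nu mu nu I [set e])%E.
Proof. exact: irr_end_of_decomposition irr_nu_decomposition. Qed.

Lemma coupling_end (P : {measure set (X * X)%type -> \bar R}) I (w e : R) :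
  martingale_measure mu nu P -> irr_comp mu nu I -> is_end I w e ->
  P (I `*` [set e]) = irr_nu mu nu I [set e].
Proof.
move=> mP cI eI; have [nu_ dec nuE] := martingale_decomposition mP.
have := irr_nu_end cI eI; rewrite (irr_end_of_decomposition dec cI eI) nuE//.
set H := [set x | _]; have mH : measurable (H : set X).
  rewrite -[X in measurable X]setTI; apply: (@measurable_fun_ler _ X R setT) => //.
  by apply: measurable_funM => //; exact: measurable_funB.
have Hfin : mu H \is a fin_num by exact: fin_num_measure.
by move=> /(congr1 (fun z => z - mu H)%E); rewrite ![(mu H + _)%E]addeC !addeK.
Qed.

End irreducible_pairs.

(** * Canonical polar sets *)

Section polar_of_cover.
Context (R : realType).
Variables (mu nu : fmeasR R).
Hypotheses (mu1 : finite_first_moment mu) (nu1 : finite_first_moment nu).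
Hypothesis cmn : convex_order mu nu.
Let X := measurableTypeR R.
Let U := gap mu nu.
Let oU : open U := open_gap mu1 nu1.

Lemma is_end_unique (I : set R) w e e' : is_end I w e -> is_end I w e' -> e = e'.
Proof.
have pm : 1 <> -1 :> R by lra.
by move=> [[-> [_ ->]]|[-> [_ ->]]] [[h [_ ->]]|[h [_ ->]]] //; exfalso; apply: pm.
Qed.

Lemma polar_complement : polar mu nu
  (~` (diagonal `|` \bigcup_(I in irr_comp mu nu) (I `*` irr_J mu nu I))).
Proof.
move=> P mP; have [P' [P'E cP]] := martingale_centered mu1 nu1 mP.
pose comp (p : rat * bool) := connected_component U (ratr p.1).
pose w (p : rat * bool) : R := if p.2 then 1 else -1.
pose F p : set (X * X) := [set z | [/\ U (ratr p.1), comp p z.1, is_end (comp p) (w p) z.2 &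
  irr_nu mu nu (comp p) [set z.2] = 0%E]].
have F0 p : P.-negligible (F p).
  have [[[x e] [Up px ep e0]]|nF] := pselect (F p !=set0); last first.
    by apply: negligibleS (negligible_set0 P) => z Fz; apply: nF; exists z.
  have cI : irr_comp mu nu (comp p) by exists (ratr p.1).
  exists (comp p `*` [set e]); split.
  - by apply: measurableX => //; exact: measurable_components cI.
  - by rewrite (coupling_end mu1 nu1 cmn mP cI ep).
  - by move=> [x' e'] [_ px' ep' _]; split => //=; exact: is_end_unique ep' ep.
have cr0 : P.-negligible (crossings mu nu).
  have [N [mN N0 crN]] := crossings_null mu1 nu1 cmn cP.
  by exists N; split => //; rewrite -P'E.
apply: negligibleS (negligibleU cr0 (negligible_bigcup_countable F0)) => -[x y].
move=> nxy; have [cr|ncr] := pselect (crossings mu nu (x, y)); [by left|right].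
have xy : x != y by apply/eqP => xy; apply: nxy; left.
have [I [cI Ix yI]] := uncrossed mu1 nu1 ncr xy.
have nJ : ~ irr_J mu nu I y by move=> Jy; apply: nxy; right; exists I.
have [q Iq] := component_rat oU cI.
have IE : I = connected_component U (ratr q) := component_mem cI Iq.
have [b yb] : exists b : bool, is_end I (if b then 1 else -1) y.
  by case: yI => [Iy|yI|yI]; [case: nJ; left|exists false; right|exists true; left].
exists (q, b) => //; rewrite /F /comp /w /= -IE; split => //.
  exact: component_sub cI _ Iq.
apply/eqP; rewrite eq_le measure_ge0 andbT leNgt; apply/negP => y0; apply: nJ; right.
split => //; case: yI => [Iy|yI|yI]; [|by left|by right].
by case: nxy; right; exists I => //; split => //; left.
Qed.

Lemma polar_of_cover (B : set (X * X)) (Nmu Nnu : set X) :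
  mu.-negligible Nmu -> nu.-negligible Nnu ->
  B `<=` (Nmu `*` setT) `|` (setT `*` Nnu) `|`
    ~` (diagonal `|` \bigcup_(I in irr_comp mu nu) (I `*` irr_J mu nu I)) ->
  polar mu nu B.
Proof.
move=> [M [mM M0 NM]] [N [mN N0 NN]] BN P mP.
have [Pmu Pnu _] := mP.
apply: negligibleS BN (negligibleU (negligibleU _ _) (polar_complement mP)).
  exists (M `*` setT); split; [exact: measurableX| |by apply: setSX].
  by rewrite setXT; exact: etrans (Pmu M mM) M0.
exists (setT `*` N); split; [exact: measurableX| |by apply: setSX].
by rewrite setTX; exact: etrans (Pnu N mN) N0.
Qed.

End polar_of_cover.

(** * The defect of a convex function *)

Section cuts.
Context (R : realType).
Let X := measurableTypeR R.

Lemma supported_nondecreasing (s psi : R -> R) x y : supported s psi -> x <= y -> s x <= s y.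
Proof.
rewrite le_eqVlt => sp /orP[/eqP->//|xy]; rewrite leNgt; apply/negP => sxy.
have := sp x y; have := sp y x; have : 0 < (s x - s y) * (y - x) by rewrite mulr_gt0 ?subr_gt0.
lra.
Qed.

Definition tangent (s psi : R -> R) (c z : R) := psi c + s c * (z - c).

(** A convex function is the sum of its two cuts at [c], where [w] is the side
    of [c] on which it is replaced by its tangent. *)
Definition excess (w c : R) (s psi : R -> R) (z : R) :=
  if 0 <= w * (z - c) then psi z - tangent s psi c z else 0.
Definition excess_slope (w c : R) (s : R -> R) (z : R) :=
  if 0 <= w * (z - c) then s z - s c else 0.
Definition flattened (w c : R) (s psi : R -> R) (z : R) :=
  if 0 <= w * (z - c) then tangent s psi c z else psi z.
Definition flattened_slope (w c : R) (s : R -> R) (z : R) :=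
  if 0 <= w * (z - c) then s c else s z.

Variable w : R.
Hypothesis w1 : (w == 1) || (w == -1).

Let slope_sign (s psi : R -> R) x c z : supported s psi -> 0 <= w * (x - c) ->
  w * (z - c) < 0 -> (s x - s c) * (z - c) <= 0.
Proof.
move=> sp; case/orP: w1 => /eqP ->; rewrite ?mulN1r ?mul1r => xc zc.
  have : s c <= s x by apply: supported_nondecreasing sp _; lra.
  by move=> sxc; rewrite mulr_ge0_le0//; lra.
have : s x <= s c by apply: supported_nondecreasing sp _; lra.
by move=> sxc; rewrite mulr_le0_ge0//; lra.
Qed.

Lemma excess_supported c s psi : supported s psi ->
  supported (excess_slope w c s) (excess w c s psi).
Proof.
move=> sp x z; rewrite /excess /excess_slope /tangent.
have [xc|xc] := leP 0 (w * (x - c)); have [zc|zc] := leP 0 (w * (z - c)).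
- by have := sp x z; lra.
- by have := slope_sign sp xc zc; have := sp x c; lra.
- by have := sp c z; lra.
- by lra.
Qed.

Lemma flattened_supported c s psi : supported s psi ->
  supported (flattened_slope w c s) (flattened w c s psi).
Proof.
move=> sp x z; rewrite /flattened /flattened_slope /tangent.
have [xc|xc] := leP 0 (w * (x - c)); have [zc|zc] := leP 0 (w * (z - c)).
- by lra.
- by have := sp c z; lra.
- have : (s c - s x) * (z - c) >= 0.
    move: xc zc; case/orP: w1 => /eqP ->; rewrite ?mulN1r ?mul1r => xc zc.
      have : s x <= s c by apply: supported_nondecreasing sp _; lra.
      by move=> sxc; rewrite mulr_ge0//; lra.
    have : s c <= s x by apply: supported_nondecreasing sp _; lra.
    by move=> sxc; rewrite mulr_le0//; lra.
  by have := sp x c; lra.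
- exact: sp.
Qed.

Lemma excessD_flattened c s psi z : excess w c s psi z + flattened w c s psi z = psi z.
Proof. by rewrite /excess /flattened; case: ifP => _; lra. Qed.

Lemma excess_slope_le c s K x : (forall x, `|s x| <= K) -> `|excess_slope w c s x| <= 2 * K.
Proof.
move=> sK; rewrite /excess_slope; case: ifP => _.
  by have := sK x; have := sK c; have := ler_normB (s x) (s c); lra.
by rewrite normr0; have := sK 0; have := normr_ge0 (s 0); lra.
Qed.

Lemma flattened_slope_le c s K x : (forall x, `|s x| <= K) -> `|flattened_slope w c s x| <= K.
Proof. by move=> sK; rewrite /flattened_slope; case: ifP => _. Qed.

Section defect.
Variables (mu nu : fmeasR R).
Hypotheses (mu1 : finite_first_moment mu) (nu1 : finite_first_moment nu).
Hypothesis cmn : convex_order mu nu.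

Definition defect (psi : R -> R) := \int[nu]_x psi x - \int[mu]_x psi x.

Lemma defect_ge0 s psi K : supported s psi -> (forall x, `|s x| <= K) -> 0 <= defect psi.
Proof. by move=> sp sK; rewrite subr_ge0; exact: supported_convex_order sp sK. Qed.

Lemma defectD s s' f g K K' : supported s f -> (forall x, `|s x| <= K) ->
  supported s' g -> (forall x, `|s' x| <= K') ->
  defect (fun x => f x + g x) = defect f + defect g.
Proof.
move=> sf sK sg sK'; rewrite /defect.
rewrite (RintegralD measurableT (supported_integrable mu1 sf sK) (supported_integrable mu1 sg sK')).
rewrite (RintegralD measurableT (supported_integrable nu1 sf sK) (supported_integrable nu1 sg sK')).
by ring.
Qed.

Lemma defect_affine a b : defect (fun x => a + b * x) = 0.
Proof. by rewrite /defect (convex_order_affine _ _ mu1 nu1 cmn) subrr. Qed.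

Lemma defect_cuts c s psi K : supported s psi -> (forall x, `|s x| <= K) ->
  defect (excess w c s psi) <= defect psi /\ defect (flattened w c s psi) <= defect psi.
Proof.
move=> sp sK; have eK x := excess_slope_le c x sK; have fK x := flattened_slope_le c x sK.
have se := excess_supported c sp; have sf := flattened_supported c sp.
have := defectD se eK sf fK; rewrite (_ : (fun x => _) = psi); last first.
  by apply/funext => x; exact: excessD_flattened.
by have := defect_ge0 se eK; have := defect_ge0 sf fK; lra.
Qed.

Definition ramp c d s psi := flattened w d (excess_slope w c s) (excess w c s psi).

Lemma defect_ramp c d s psi K : supported s psi -> (forall x, `|s x| <= K) ->
  defect (ramp c d s psi) <= defect psi.
Proof.
move=> sp sK; have [h _] := defect_cuts c sp sK; apply: le_trans h.
exact: (defect_cuts d (excess_supported c sp) (fun x => excess_slope_le c x sK)).2.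
Qed.

Lemma ramp_integrable (m : fmeasR R) c d s psi K : finite_first_moment m -> supported s psi ->
  (forall x, `|s x| <= K) -> m.-integrable setT (fun x : X => (ramp c d s psi x)%:E).
Proof.
move=> m1 sp sK; apply: (supported_integrable m1 (flattened_supported d (excess_supported c sp))).
by move=> x; apply: flattened_slope_le => y; exact: excess_slope_le sK.
Qed.

Lemma rampE c d s psi z : 0 <= w * (d - c) -> ramp c d s psi z =
  if 0 <= w * (z - d) then psi d - tangent s psi c d + (s d - s c) * (z - d)
  else if 0 <= w * (z - c) then psi z - tangent s psi c z else 0.
Proof. by move=> dc; rewrite /ramp /flattened {1}/tangent /excess /excess_slope dc. Qed.

End defect.

End cuts.

(** * A Harnack inequality for convex functions *)

Section harnack.
Context (R : realType).
Variables (mu nu : fmeasR R).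
Hypotheses (mu1 : finite_first_moment mu) (nu1 : finite_first_moment nu).
Hypothesis cmn : convex_order mu nu.
Let X := measurableTypeR R.
Let U := gap mu nu.
Let oU : open U := open_gap mu1 nu1.
Let up (m : fmeasR R) t := \int[m]_x `|x - t|.

Lemma Rintegral_dist_affine (m : fmeasR R) (a b k t : R) : finite_first_moment m ->
  m.-integrable setT (fun x : X => (a + b * x + k * `|x - t|)%:E) /\
  \int[m]_x (a + b * x + k * `|x - t|) =
  a * fine (m setT) + b * (\int[m]_x x) + k * \int[m]_x `|x - t|.
Proof.
move=> m1; have id := integrable_dist t m1.
have ikd : m.-integrable setT (EFin \o (fun x : X => k * `|x - t|)) := integrableZl measurableT k id.
have ia : m.-integrable setT (EFin \o (fun x : X => a + b * x)).
  exact: supported_integrable m1 (supported_affine a b) (fun=> lexx `|b|).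
split; first exact: (integrableD measurableT ia ikd).
rewrite -(Rintegral_affine _ _ m1) -(RintegralZl k measurableT id).
exact: (RintegralD measurableT ia ikd).
Qed.

Lemma Rintegral_indic_dist_affine (m : fmeasR R) (H : set X) (h a b k t : R) :
  measurable H -> finite_first_moment m ->
  m.-integrable setT (fun x : X => (h * \1_H x + (a + b * x + k * `|x - t|))%:E) /\
  \int[m]_x (h * \1_H x + (a + b * x + k * `|x - t|)) =
  h * fine (m H) + (a * fine (m setT) + b * (\int[m]_x x) + k * \int[m]_x `|x - t|).
Proof.
move=> mH m1; have [il <-] := Rintegral_dist_affine a b k t m1.
have iH : m.-integrable setT (EFin \o (\1_H : X -> R)).
  by apply: integrable_indic => //; rewrite ltey_eq fin_num_measure.
have ihH : m.-integrable setT (EFin \o (fun x : X => h * \1_H x)) := integrableZl measurableT h iH.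
split; first exact: (integrableD measurableT ihH il).
have -> : h * fine (m H) = \int[m]_x (h * \1_H x).
  by rewrite (RintegralZl h measurableT iH) /Rintegral integral_indic// setIT.
exact: (RintegralD measurableT ihH il).
Qed.

Let mass_eq : fine (mu setT) = fine (nu setT).
Proof. by rewrite (convex_order_mass mu1 nu1 cmn). Qed.

Let mean_eq : \int[mu]_x x = \int[nu]_x x.
Proof.
have := convex_order_affine 0 1 mu1 nu1 cmn.
by rewrite !Rintegral_affine// !mul0r !mul1r !add0r.
Qed.

Lemma local_slope_bound t : U t -> exists delta C, [/\ 0 < delta, 0 < C &
  forall s psi K, supported s psi -> (forall x, `|s x| <= K) -> (forall x, 0 <= psi x) ->
  forall x y, `|x - t| < delta -> `|y - t| < delta ->
  `|s y| <= C * (defect mu nu psi + psi x)].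
Proof.
rewrite /U /gap /= !potentialE// lte_fin -subr_gt0; set gam := _ - _ => gam0.
pose M := fine (nu setT); have M0 : 0 <= M by exact: fine_measure_ge0.
pose delta := gam / (16 * (M + 1)).
have d0 : 0 < delta by rewrite divr_gt0// mulr_gt0// ltr_wpDl.
have dM : 16 * (delta * M) <= gam.
  have -> : gam = delta * (16 * (M + 1)) by rewrite /delta divfK// gt_eqF// mulr_gt0// ltr_wpDl.
  lra.
exists delta, (delta^-1 + 4 / gam); split => //.
  by rewrite addr_gt0 ?invr_gt0// divr_gt0.
move=> s psi K sp sK psi0 x y xt yt.
pose c := t - 2 * delta; pose d := t + 2 * delta.
have cd : c <= d by rewrite /c /d; lra.
pose sig := s d - s c.
have sig0 : 0 <= sig by rewrite subr_ge0; exact: supported_nondecreasing sp cd.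
have w1 : (1 == 1 :> R) || (1 == -1 :> R) by rewrite eqxx.
pose f := ramp 1 c d s psi.
have fE z : f z = if d <= z then psi d - tangent s psi c d + sig * (z - d)
    else if c <= z then psi z - tangent s psi c z else 0.
  by rewrite /f rampE ?mul1r ?subr_ge0// !mul1r !subr_ge0.
have f_lo z : sig * (- t / 2 - 2 * delta) + sig / 2 * z + sig / 2 * `|z - t| <= f z.
  have -> : sig * (- t / 2 - 2 * delta) + sig / 2 * z + sig / 2 * `|z - t| =
      sig * ((`|z - t| + (z - t)) / 2 - 2 * delta) by field.
  rewrite fE; have [dz|dz] := leP d z.
    rewrite ger0_norm; last by move: dz; rewrite /d; lra.
    have := sp c d; rewrite /tangent /d; lra.
  apply: (@le_trans _ _ 0).
    apply: mulr_ge0_le0 => //; have [h|h] := leP 0 (z - t).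
      by rewrite ger0_norm//; move: dz; rewrite /d; lra.
    by rewrite ltr0_norm//; lra.
  by have [cz|cz] := leP c z; [have := sp c z; rewrite /tangent; lra|].
have f_up z : f z <= sig * (- t / 2 + 2 * delta) + sig / 2 * z + sig / 2 * `|z - t|.
  have -> : sig * (- t / 2 + 2 * delta) + sig / 2 * z + sig / 2 * `|z - t| =
      sig * ((`|z - t| + (z - t)) / 2 + 2 * delta) by field.
  have p0 : 0 <= `|z - t| + (z - t) by have := ler_norm (- (z - t)); rewrite normrN; lra.
  have p1 : 2 * (z - t) <= `|z - t| + (z - t) by have := ler_norm (z - t); lra.
  rewrite fE; have [dz|dz] := leP d z.
    have h : psi d - tangent s psi c d <= sig * (d - c).
      by have := sp d c; rewrite /tangent /sig; lra.
    apply: (@le_trans _ _ (sig * (z - c))); first by move: h; lra.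
    by rewrite ler_wpM2l// /c; lra.
  have [cz|cz] := leP c z; last by rewrite mulr_ge0//; lra.
  apply: (@le_trans _ _ ((s z - s c) * (z - c))).
    by have := sp z c; rewrite /tangent; lra.
  apply: (@le_trans _ _ (sig * (z - c))).
    by rewrite ler_wpM2r ?subr_ge0// lerD2r; apply: supported_nondecreasing sp (ltW dz).
  by rewrite ler_wpM2l// /c; lra.
have [ilo Elo] := Rintegral_dist_affine (sig * (- t / 2 - 2 * delta)) (sig / 2) (sig / 2) t nu1.
have [iup Eup] := Rintegral_dist_affine (sig * (- t / 2 + 2 * delta)) (sig / 2) (sig / 2) t mu1.
have fnu := ramp_integrable w1 c d nu1 sp sK.
have fmu := ramp_integrable w1 c d mu1 sp sK.
have lo := le_Rintegral measurableT ilo fnu (fun z _ => f_lo z).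
have hi := le_Rintegral measurableT fmu iup (fun z _ => f_up z).
have Df := defect_ramp w1 mu1 nu1 cmn c d sp sK.
have key : sig * gam <= 4 * defect mu nu psi.
  have : sig * (16 * (delta * M)) <= sig * gam by rewrite ler_wpM2l.
  move: lo hi Df; rewrite Elo Eup mass_eq mean_eq -/M {1}/defect -/f.
  rewrite /gam; lra.
have key2 : sig <= 4 / gam * defect mu nu psi.
  by rewrite mulrAC ler_pdivlMr.
have D0 := defect_ge0 mu1 nu1 cmn sp sK.
have bc : s c <= delta^-1 * psi x.
  rewrite mulrC ler_pdivlMr//; have := sp c x.
  have := psi0 c; have := psi0 x; have [s0|s0] := leP 0 (s c).
    have : s c * delta <= s c * (x - c).
      by rewrite ler_wpM2l//; move: xt; rewrite /c ltr_norml; lra.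
    lra.
  have : s c * delta <= 0 by rewrite mulr_le0_ge0 ?ltW.
  lra.
have bd : - s d <= delta^-1 * psi x.
  rewrite mulrC ler_pdivlMr//; have := sp d x.
  have := psi0 d; have := psi0 x; have [s0|s0] := leP 0 (s d).
    have : 0 <= s d * delta by rewrite mulr_ge0 ?(ltW d0).
    lra.
  have : 0 <= s d * (x - d + delta).
    by rewrite mulr_le0 ?(ltW s0)//; move: xt; rewrite /d ltr_norml; lra.
  lra.
have sy1 : s c <= s y.
  by apply: supported_nondecreasing sp _; move: yt; rewrite /c ltr_norml; lra.
have sy2 : s y <= s d.
  by apply: supported_nondecreasing sp _; move: yt; rewrite /d ltr_norml; lra.
have : 0 <= delta^-1 * defect mu nu psi by rewrite mulr_ge0// invr_ge0 ltW.
have : 0 <= 4 / gam * psi x by rewrite mulr_ge0// divr_ge0// ltW.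
by rewrite ler_norml; move: key2; rewrite /sig; lra.
Qed.

End harnack.

Section harnack_chains.
Context (R : realType).
Variables (mu nu : fmeasR R).
Hypotheses (mu1 : finite_first_moment mu) (nu1 : finite_first_moment nu).
Hypothesis cmn : convex_order mu nu.
Let X := measurableTypeR R.
Let U := gap mu nu.
Let oU : open U := open_gap mu1 nu1.

(** The values of a nonnegative convex function on [V] are controlled by its
    values on [A] and its defect, uniformly. *)
Definition harnack (A V : set R) := exists2 C, 0 < C &
  forall s psi K, supported s psi -> (forall x, `|s x| <= K) -> (forall x, 0 <= psi x) ->
  forall x y, A x -> V y -> psi y <= C * (defect mu nu psi + psi x).

Lemma harnack_trans A V W y : V y -> harnack A V -> harnack V W -> harnack A W.
Proof.
move=> Vy [C C0 hC] [C' C'0 hC']; exists (C' * (1 + C)); first by rewrite mulr_gt0// addr_gt0.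
move=> s psi K sp sK psi0 x z Ax Wz.
apply: le_trans (hC' s psi K sp sK psi0 y z Vy Wz) _.
rewrite -mulrA ler_wpM2l ?(ltW C'0)//.
have := hC s psi K sp sK psi0 x y Ax Vy.
by have := psi0 x; lra.
Qed.

Lemma harnack_sub A A' V V' : A' `<=` A -> V' `<=` V -> harnack A V -> harnack A' V'.
Proof.
move=> AA VV [C C0 hC]; exists C => // s psi K sp sK psi0 x y /AA Ax /VV Vy.
exact: hC Ax Vy.
Qed.

Lemma harnack_local t : U t -> exists2 delta, 0 < delta & harnack (ball t delta) (ball t delta).
Proof.
move=> Ut; have [delta [C [d0 C0 hC]]] := local_slope_bound mu1 nu1 cmn Ut.
exists delta => //; exists (1 + 2 * delta * C); first by rewrite addr_gt0// !mulr_gt0.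
move=> s psi K sp sK psi0 x y; rewrite /ball /= (distrC t x) (distrC t y) => xt yt.
have := hC s psi K sp sK psi0 x y xt yt.
set D := defect _ _ _ + _ => sy; have D0 : 0 <= defect mu nu psi := defect_ge0 mu1 nu1 cmn sp sK.
have Dpsi : psi x <= D by rewrite /D lerDr.
have yx : `|y - x| <= 2 * delta.
  by move: xt yt; rewrite ler_norml !ltr_norml; lra.
have : `|s y| * `|y - x| <= (C * D) * (2 * delta) by apply: ler_pM.
have := sp y x; have : s y * (y - x) <= `|s y| * `|y - x| by rewrite -normrM ler_norm.
by rewrite mulrDl mul1r; lra.
Qed.

(** Points of one component are comparable: the points comparable to [x] form
    an open and closed subset. *)
Lemma harnack_component I x y : irr_comp mu nu I -> I x -> I y -> harnack [set x] [set y].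
Proof.
move=> cI Ix; have connI : connected I.
  by have [z _ <-] := cI; exact: component_connected.
pose good := [set z | harnack [set x] [set z]].
have IU z : I z -> U z by move=> Iz; exact: component_sub cI _ Iz.
have near_iff z z' delta : harnack (ball z delta) (ball z delta) -> 0 < delta ->
    ball z delta z' -> good z <-> good z'.
  move=> hz d0 zz'; have zz : ball z delta z by exact: ballxx.
  have sub u v : ball z delta u -> ball z delta v -> harnack [set u] [set v].
    by move=> zu zv; apply: harnack_sub hz => _ ->.
  by split => g; apply: harnack_trans g _ => //; exact: sub.
have op (S : set R) : (forall z z' delta, harnack (ball z delta) (ball z delta) -> 0 < delta ->
    ball z delta z' -> S z -> S z') -> exists2 W, open W & I `&` S = I `&` W.
  move=> hS; exists (U `&` [set z | exists2 z', S z' & exists2 delta, 0 < delta &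
    harnack (ball z' delta) (ball z' delta) /\ ball z' delta z]).
    rewrite openE => z [Uz [z' Sz' [delta d0 [hz' zz']]]].
    have : nbhs z (U `&` ball z' delta).
      by apply: filterI; apply: open_nbhs_nbhs; split => //; exact: ball_open.
    by apply: filterS => u [Uu zu]; split => //; exists z' => //; exists delta.
  apply/seteqP; split => z [Iz].
    move=> Sz; split => //; split; first exact: IU.
    have [delta d0 hz] := harnack_local (IU z Iz).
    by exists z => //; exists delta => //; split => //; exact: ballxx.
  by move=> [_ [z' Sz' [delta d0 [hz' zz']]]]; split => //; exact: hS hz' d0 zz' Sz'.
have [W oW IW] := op good (fun z z' d h d0 zz' => (near_iff z z' d h d0 zz').1).
have [W' oW' IW'] := op (~` good) (fun z z' d h d0 zz' ng g =>
  ng ((near_iff z z' d h d0 zz').2 g)).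
have : I `&` good = I.
  apply: connI.
  - exists x; split => //; have [delta d0 hx] := harnack_local (IU x Ix).
    by apply: harnack_sub hx => _ ->; exact: ballxx.
  - by exists W.
  - exists (~` W'); first exact: open_closedC.
    apply/seteqP; split => z [Iz]; last first.
      move=> nO; split => //; apply: contrapT => ng; apply: nO.
      by have [] : (I `&` W') z by rewrite -IW'.
    by move=> g; split => // W'z; have [_ ng] : (I `&` ~` good) z by rewrite IW'.
by move=> IE Iy; have [] : (I `&` good) y by rewrite IE.
Qed.

Lemma harnack_end I w e : irr_comp mu nu I -> is_end I w e ->
  (0 < irr_nu mu nu I [set e])%E -> exists2 c, I c & harnack [set c] [set e].
Proof.
move=> cI eI nu_e; have w1 := is_end_sign eI.
have ww : w * w = 1 by case/orP: w1 => /eqP ->; rewrite ?mulrNN mulr1.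
have [nUe Ie inI _] := is_endP oU cI eI.
have [x0 Ix0] := component_rat oU cI; set q := ratr x0 in Ix0.
pose r := w * (e - q); have r0 : 0 < r by have := Ie q Ix0; rewrite /r; lra.
have [c cE] : exists c : nat -> R, forall n, c n = e - w * (r / n.+1%:R).
  by exists (fun n => e - w * (r / n.+1%:R)).
have wc n : w * (e - c n) = r / n.+1%:R by rewrite cE subKr mulrA ww mul1r.
have rn0 n : 0 < r / n.+1%:R by rewrite divr_gt0.
have Ic n : I (c n).
  apply: (inI q Ix0); first by have := rn0 n; rewrite -wc; lra.
  have : r / n.+1%:R <= r by rewrite ler_pdivrMr// ler_peMr ?(ltW r0)// ler1n.
  by rewrite -(wc n) /r; lra.
pose H : set X := [set x | 0 <= w * (x - e)].
pose G n : set X := [set x | 0 <= w * (x - c n)].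
have mhalf a : measurable ([set x | 0 <= w * (x - a)] : set X).
  rewrite -[X in measurable X]setTI; apply: (@measurable_fun_ler _ X R setT) => //.
  by apply: measurable_funM => //; exact: measurable_funB.
have HG n : H `<=` G n by move=> x; rewrite /H /G /=; have := rn0 n; rewrite -wc; lra.
pose beta := fine (irr_nu mu nu I [set e]).
have beta0 : 0 < beta.
  by rewrite fine_gt0// nu_e ltey_eq fin_num_measure.
have nuH : fine (nu H) = fine (mu H) + beta.
  rewrite /H (irr_nu_end mu1 nu1 cmn cI eI) fineD//; first exact: fin_num_measure.
  exact: fin_num_measure.
have [n muG] : exists n, fine (mu (G n)) <= fine (mu H) + beta / 2.
  have capG : \bigcap_n G n = H.
    apply/seteqP; split => [x xG|x Hx n _]; last exact: HG.
    rewrite /H /= leNgt; apply/negP => xe.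
    have xe0 : 0 < w * (e - x) / r by rewrite divr_gt0//; lra.
    have [m _ /(_ m (leqnn m))/=] := near_infty_natSinv_lt (PosNum xe0).
    rewrite /= => lt_m; have xGm : G m x by exact: xG.
    have : r / m.+1%:R < w * (e - x).
      by rewrite -(ltr_pM2l r0) in lt_m; move: lt_m; rewrite mulrCA divff ?gt_eqF// mulr1.
    by move: xGm; rewrite -wc /G /=; lra.
  have cvG := @nonincreasing_cvg_mu _ _ _ mu G _ (fun n => mhalf (c n)) _ _.
  have : fine (mu (G n)) @[n --> \oo] --> fine (mu H).
    apply: fine_cvg; rewrite -capG fineK ?fin_num_measure//; last by rewrite capG; exact: mhalf.
    apply: cvG => //.
    - by rewrite ltey_eq (fin_num_measure mu _ (mhalf (c 0%N))).
    - by rewrite capG; exact: mhalf.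
    apply/nonincreasing_seqP => k; apply/subsetPset => x; rewrite /G /=.
    have : r / k.+2%:R <= r / k.+1%:R by rewrite ler_pM2l// lef_pV2 ?posrE// ler_nat.
    by rewrite -!wc; lra.
  move=> /cvgrPdist_le /(_ (beta / 2)); rewrite divr_gt0// => /(_ isT)[n _ /(_ n (leqnn n))].
  by rewrite /= ler_norml => h; exists n; lra.
set b := c n in muG *.
exists b; first exact: Ic.
have [delta [C [d0 C0 hC]]] := local_slope_bound mu1 nu1 cmn (component_sub cI (Ic n) : U b).
exists (1 + 2 / beta + `|e - b| * C).
  by rewrite ltr_wpDr ?mulr_ge0 ?(ltW C0)// addr_gt0// divr_gt0.
move=> s psi K sp sK psi0 _ _ -> ->.
have D0 := defect_ge0 mu1 nu1 cmn sp sK.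
have sb : `|s b| <= C * (defect mu nu psi + psi b).
  by apply: (hC s psi K sp sK psi0); rewrite subrr normr0.
pose fe := psi e - tangent s psi b e.
have fe0 : 0 <= fe by rewrite subr_ge0; exact: sp.
pose tau := w * (s e - s b).
have bw : 0 <= w * (e - b) by rewrite wc ltW.
have f_eq z : ramp w b e s psi z = if 0 <= w * (z - e) then fe + tau * (w * (z - e))
    else if 0 <= w * (z - b) then psi z - tangent s psi b z else 0.
  rewrite rampE//; case: ifP => // _; congr (_ + _).
  by rewrite /tau mulrACA ww mul1r.
have tau0 : 0 <= tau.
  move: bw; rewrite /tau; case/orP: w1 => /eqP ->; rewrite ?mulN1r ?mul1r => eb.
    by rewrite subr_ge0; apply: supported_nondecreasing sp _; lra.
  by rewrite oppr_ge0 subr_le0; apply: supported_nondecreasing sp _; lra.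
have linE z : - (tau * w * e) / 2 + tau * w / 2 * z + tau / 2 * `|z - e| =
    tau * (`|z - e| + w * (z - e)) / 2 by field.
have linH z : 0 <= w * (z - e) -> tau * (`|z - e| + w * (z - e)) / 2 = tau * (w * (z - e)).
  move=> ze; have -> : `|z - e| = w * (z - e); last by field.
  move: ze; case/orP: w1 => /eqP ->; rewrite ?mulN1r ?mul1r => ze; first exact: ger0_norm.
  by rewrite ler0_norm//; lra.
have linHC z : w * (z - e) < 0 -> tau * (`|z - e| + w * (z - e)) / 2 = 0.
  move=> ze; have -> : `|z - e| = - (w * (z - e)); last by field.
  move: ze; case/orP: w1 => /eqP ->; rewrite ?mulN1r ?mul1r => ze; first exact: ltr0_norm.
  by rewrite opprK gtr0_norm//; lra.
have f_lo z : fe * \1_H z + (- (tau * w * e) / 2 + tau * w / 2 * z + tau / 2 * `|z - e|) <=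
    ramp w b e s psi z.
  rewrite linE f_eq; have [ze|ze] := leP 0 (w * (z - e)).
    by rewrite linH// indicE mem_set// mulr1.
  rewrite linHC// indicE memNset ?mulr0 ?addr0; last by rewrite /H /=; move: ze; lra.
  by have [zb|zb] := leP 0 (w * (z - b)); [rewrite subr_ge0; exact: sp|].
have f_up z : ramp w b e s psi z <= fe * \1_(G n) z +
    (- (tau * w * e) / 2 + tau * w / 2 * z + tau / 2 * `|z - e|).
  rewrite linE f_eq; have [ze|ze] := leP 0 (w * (z - e)).
    by rewrite linH// indicE mem_set ?mulr1//; exact: HG.
  rewrite linHC// addr0; have [zb|zb] := leP 0 (w * (z - b)); last first.
    by rewrite mulr_ge0// indicE.
  rewrite indicE mem_set// mulr1 /fe /tangent.
  suff : 0 <= (s z - s b) * (e - z) by have := sp z e; lra.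
  move: ze zb; case/orP: w1 => /eqP ->; rewrite ?mulN1r ?mul1r => ze zb.
    have : s b <= s z by apply: supported_nondecreasing sp _; lra.
    by move=> h; rewrite mulr_ge0//; lra.
  have : s z <= s b by apply: supported_nondecreasing sp _; lra.
  by move=> h; rewrite mulr_le0//; lra.
have [ilo Elo] := Rintegral_indic_dist_affine fe (- (tau * w * e) / 2) (tau * w / 2) (tau / 2) e
  (mhalf e) nu1.
have [iup Eup] := Rintegral_indic_dist_affine fe (- (tau * w * e) / 2) (tau * w / 2) (tau / 2) e
  (mhalf b) mu1.
have fnu := ramp_integrable w1 b e nu1 sp sK.
have fmu := ramp_integrable w1 b e mu1 sp sK.
have lo := le_Rintegral measurableT ilo fnu (fun z _ => f_lo z).
have hi := le_Rintegral measurableT fmu iup (fun z _ => f_up z).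
have Df := defect_ramp w1 mu1 nu1 cmn b e sp sK.
have pot_eq : \int[mu]_x `|x - e| = \int[nu]_x `|x - e|.
  by have := eq_potential cmn nUe; rewrite !potentialE// => -[].
have aff_eq : - (tau * w * e) / 2 * fine (mu setT) + tau * w / 2 * (\int[mu]_x x) =
    - (tau * w * e) / 2 * fine (nu setT) + tau * w / 2 * (\int[nu]_x x).
  by have := convex_order_affine (- (tau * w * e) / 2) (tau * w / 2) mu1 nu1 cmn;
    rewrite !Rintegral_affine.
have key : fe * (beta / 2) <= defect mu nu psi.
  have : fe * fine (mu (G n)) <= fe * (fine (mu H) + beta / 2) by rewrite ler_wpM2l.
  move: lo hi Df; rewrite Elo Eup aff_eq pot_eq -/H -/(G n) nuH {1}/defect.
  lra.
have key2 : fe <= 2 / beta * defect mu nu psi.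
  have : fe * beta <= 2 * defect mu nu psi by lra.
  by rewrite -ler_pdivlMr// mulrAC.
have sbe : s b * (e - b) <= `|e - b| * C * (defect mu nu psi + psi b).
  apply: le_trans (ler_norm _) _; rewrite normrM mulrC -mulrA ler_wpM2l//.
have psie : psi e = fe + psi b + s b * (e - b) by rewrite /fe /tangent; lra.
rewrite psie.
have : 0 <= 2 / beta * psi b by rewrite mulr_ge0// divr_ge0// ltW.
lra.
Qed.

End harnack_chains.

(** * Polar sets are canonical *)

Section main.
Context (R : realType).
Variables (mu nu : fmeasR R).
Hypotheses (mu1 : finite_first_moment mu) (nu1 : finite_first_moment nu).
Hypothesis cmn : convex_order mu nu.
Let X := measurableTypeR R.
Let U := gap mu nu.
Let oU : open U := open_gap mu1 nu1.

(** For [t = i x], the convex function [y |-> v t + w t * y - min_s (v s + w s * y)]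
    has the same defect for all [t]; the Harnack inequality bounds its value at
    [y] by its value at [x] and this defect. *)
Lemma harnack_duality (pi : {finite_measure set (X * X)%type -> \bar R}) (A V : set X) (C : R) :
  measurable A -> measurable V -> 0 < C ->
  (forall s psi K, supported s psi -> (forall x, `|s x| <= K) -> (forall x, 0 <= psi x) ->
    forall x y, A x -> V y -> psi y <= C * (defect mu nu psi + psi x)) ->
  (forall B, measurable B -> (pi (setT `*` B) <= nu B)%E) ->
  (forall B, measurable B -> (C%:E * pi (B `*` setT) <= mu B)%E) ->
  C * fine (pi setT) <= 1 -> pi (~` (A `*` V)) = 0%E ->
  forall (T : finType) (i j : R -> T) (v w : T -> R),
    finite_measurable (i : X -> T) -> finite_measurable (j : X -> T) ->
    (forall y t, v (j y) + w (j y) * y <= v t + w t * y) ->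
    \int[nu]_y (v (j y) + w (j y) * y) +
    \int[pi]_z (v (i z.1) + w (i z.1) * z.2) -
    \int[pi]_z (v (j z.2) + w (j z.2) * z.2) <=
    \int[mu]_x (v (i x) + w (i x) * x).
Proof.
move=> mA mV C0 hC pi_nu pi_mu piT pi0 T i j v w mi mj jmin.
pose m y := v (j y) + w (j y) * y.
have [sup_m [K K0 mK]] := supported_affine_argmin jmin.
set D := defect mu nu (fun y => - m y).
have D0 : 0 <= D := defect_ge0 mu1 nu1 cmn sup_m mK.
have [kap1 kap1E] := pushforward_measure_exists pi (measurable_fst : measurable_fun setT (@fst X X)).
have [kap2 kap2E] := pushforward_measure_exists pi (measurable_snd : measurable_fun setT (@snd X X)).
pose g (x : X) := v (i x) + w (i x) * x - m x.
have g0 x : 0 <= g x by rewrite subr_ge0; exact: jmin.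
have im (l : fmeasR R) : finite_first_moment l -> l.-integrable setT (EFin \o m).
  by move=> l1; exact: integrable_step_affine.
have il : mu.-integrable setT (EFin \o (fun x : X => v (i x) + w (i x) * x)).
  exact: integrable_step_affine.
have ig : mu.-integrable setT (EFin \o g) := integrableB measurableT il (im mu mu1).
have Eg : \int[mu]_x g x = \int[mu]_x (v (i x) + w (i x) * x) - \int[mu]_x m x.
  exact: (RintegralB measurableT il (im mu mu1)).
have i2 : pi.-integrable setT (EFin \o (fun z : X * X => z.2 : R)).
  apply: (integrable_image measurable_snd (fun B _ => kap2E B) (h := fun y : X => y : R)).
  by apply: (le_measure_integrable _ nu1) => B mB; rewrite kap2E -setTX; exact: pi_nu.
have mif : finite_measurable (i \o fst : X * X -> T).
  by move=> t; rewrite comp_preimage -setXT; exact: measurableX.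
have mjs : finite_measurable (j \o snd : X * X -> T).
  by move=> t; rewrite comp_preimage -setTX; exact: measurableX.
have ii := integrable_step_affine v w mif i2.
have ij := integrable_step_affine v w mjs i2.
pose h (z : X * X) := (v (i z.1) + w (i z.1) * z.2) - (v (j z.2) + w (j z.2) * z.2).
have h0 z : 0 <= h z by rewrite subr_ge0; exact: jmin.
have ih : pi.-integrable setT (EFin \o h) := integrableB measurableT ii ij.
have Eh : \int[pi]_z h z = \int[pi]_z (v (i z.1) + w (i z.1) * z.2) -
    \int[pi]_z (v (j z.2) + w (j z.2) * z.2) := RintegralB measurableT ii ij.
have hA z : A z.1 -> V z.2 -> h z <= C * (D + g z.1).
  move=> Az Vz; set t := i z.1.
  pose psi y := v t + w t * y + - m y.
  have sup_l := supported_affine (v t) (w t).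
  have sup_psi : supported (fun y => w t - w (j y)) psi.
    by move=> a b; rewrite /psi /m; have := jmin b (j a); lra.
  have K' y : `|w t - w (j y)| <= `|w t| + K.
    by apply: le_trans (ler_normB _ _) _; rewrite lerD2l; have := mK y; rewrite normrN.
  have psi0 y : 0 <= psi y by rewrite subr_ge0; exact: jmin.
  have := hC _ _ _ sup_psi K' psi0 _ _ Az Vz.
  have -> : defect mu nu psi = D.
    rewrite (defectD mu1 nu1 sup_l (fun=> lexx `|w t|) sup_m mK).
    by rewrite defect_affine// add0r.
  by [].
have mg : measurable_fun setT (EFin \o g) := measurable_int mu ig.
have mgR : measurable_fun setT g by exact/measurable_EFinP.
have up : (\int[pi]_z (h z)%:E <= (D + \int[mu]_x g x)%:E)%E.
  pose CDg (x : X) := (C%:E * (D%:E + (g x)%:E))%E.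
  have CDg0 x : (0 <= CDg x)%E by rewrite /CDg -EFinD -EFinM lee_fin mulr_ge0 ?(ltW C0)// addr_ge0.
  have mCDg : measurable_fun setT CDg.
    by apply: measurable_funeM; apply: emeasurable_funD => //; exact: measurable_cst.
  apply: (@le_trans _ _ (\int[pi]_z CDg z.1)%E).
    apply: ae_ge0_le_integral => //.
    - by move=> z _; rewrite lee_fin.
    - exact: (measurable_int pi ih).
    - exact: (measurableT_comp mCDg measurable_fst).
    exists (~` (A `*` V)); split => //; first by apply: measurableC; exact: measurableX.
    move=> z /= nh [Az Vz]; apply: nh => _.
    by rewrite /CDg -EFinD -EFinM lee_fin; exact: hA.
  rewrite -(ge0_integral_image measurable_fst (fun B _ => kap1E B) CDg0 mCDg) /CDg.
  rewrite ge0_integralZl_EFin ?(ltW C0)//; last first.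
  - by apply: emeasurable_funD => //; exact: measurable_cst.
  - by move=> x _; rewrite -EFinD lee_fin addr_ge0.
  rewrite ge0_integralD//; last first.
  - by move=> x _; rewrite lee_fin.
  have kap1T : kap1 setT = (fine (pi setT))%:E.
    by rewrite kap1E preimage_setT; exact/esym/fine_measureK.
  rewrite integral_cst//= kap1T muleDr//.
  rewrite [leRHS]EFinD; apply: leeD.
    rewrite -!EFinM lee_fin.
    by have : D * (C * fine (pi setT)) <= D * 1 by [exact: ler_wpM2l]; lra.
  pose Cn : {nonneg R} := NngNum (ltW C0).
  have -> : (C%:E * \int[kap1]_x (g x)%:E = \int[mscale Cn kap1]_x (g x)%:E)%E.
    by rewrite ge0_integral_mscale// => x _; rewrite lee_fin.
  rewrite /Rintegral fineK; last exact: (integrable_fin_num measurableT ig).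
  apply: ge0_le_measure_integral => //.
  - by move=> B mB; rewrite /= /mscale /= kap1E -setXT; exact: pi_mu.
have : \int[pi]_z h z <= D + \int[mu]_x g x.
  by rewrite -lee_fin /Rintegral fineK//; exact: (integrable_fin_num measurableT ih).
rewrite Eh Eg /D /defect.
have opp (l : fmeasR R) : finite_first_moment l ->
    \int[l]_y (- m y) = - \int[l]_y m y.
  move=> l1; transitivity (\int[l]_y (-1 * m y)).
    by apply: eq_Rintegral => x _; rewrite mulN1r.
  by have := RintegralZl (-1) measurableT (im l l1); rewrite mulN1r.
by rewrite !opp// /m; lra.
Qed.

(** By Kellerer's theorem a piece that has no null cover carries a measure [pi]
    with marginals below [mu] and [nu]; a small multiple of [pi] extends to a
    martingale measure, which charges the piece. *)
Lemma cover_of_polar_piece (A V : set X) (B : set (X * X)) :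
  measurable A -> measurable V -> measurable B -> B `<=` A `*` V ->
  harnack mu nu A V -> polar mu nu B ->
  exists M N, [/\ mu.-negligible M, nu.-negligible N & covers M N B].
Proof.
move=> mA mV mB BAV [C C0 hC] polB.
have [//|[pi [pi_mu pi_nu pi_gt0 pi_fin] piB]] := kellerer mu nu mB.
exfalso; pose p := fine (pi setT).
have pfin : pi setT \is a fin_num by rewrite ge0_fin_numE.
have p0 : 0 <= p by exact: fine_ge0.
pose e := ((1 + C) * (1 + p))^-1.
have e0 : 0 < e by rewrite invr_gt0 mulr_gt0// ltr_wpDr ?(ltW C0)//.
have eE : e * ((1 + C) * (1 + p)) = 1 by rewrite mulVf// gt_eqF// -invr_gt0.
have eC0 : 0 < e * C by rewrite mulr_gt0.
have ep0 : 0 <= e * p by rewrite mulr_ge0// ltW.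
have ecp0 : 0 <= e * C * p by rewrite mulr_ge0// ltW.
have e1 : e <= 1 by lra.
have eC1 : C * e <= 1 by lra.
have eCp : C * (e * p) <= 1 by lra.
pose en : {nonneg R} := NngNum (ltW e0).
have [|pi' pi'E] := @finite_measure_exists _ _ _ (mscale en pi).
  by rewrite /= /mscale /= -(fineK pfin) -EFinM ltry.
have pi'S S : pi' S = (e%:E * pi S)%E by rewrite pi'E.
have piBC : pi (~` B) = 0%E by [].
have pi'0 : pi' (~` (A `*` V)) = 0%E.
  have mAV : measurable (A `*` V) by exact: measurableX.
  have mBC := measurableC mB; have mAVC := measurableC mAV.
  have pi0 : pi (~` (A `*` V)) = 0%E.
    by apply: (subset_measure0 mAVC mBC _ piBC) => z nz /BAV.
  by rewrite pi'S; rewrite [X in (_ * X)%E](_ : _ = 0%E) ?mule0.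
have pi'_nu D : measurable D -> (pi' (setT `*` D) <= nu D)%E.
  move=> mD; rewrite pi'S; apply: le_trans (pi_nu D mD).
  by rewrite -[leRHS]mul1e lee_wpmul2r// lee_fin.
have pi'_mu D : measurable D -> (C%:E * pi' (D `*` setT) <= mu D)%E.
  move=> mD; rewrite pi'S muleA -EFinM; apply: le_trans (pi_mu D mD).
  by rewrite -[leRHS]mul1e lee_wpmul2r// lee_fin.
have pi'T : C * fine (pi' setT) <= 1.
  have -> : fine (pi' setT) = e * p; last exact: eCp.
  by rewrite pi'S fineM.
have [P mP piP] := strassen mu1 nu1 pi'_nu
  (harnack_duality mA mV C0 hC pi'_nu pi'_mu pi'T pi'0).
have P0 : P B = 0%E by apply/negligibleP => //; exact: polB.
have : (pi' B <= 0)%E by rewrite -P0; exact: piP.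
rewrite pi'S pmule_rle0 ?lte_fin// => piB0.
have : (pi setT <= 0)%E.
  rewrite -(setvU B); apply: le_trans (measureU2 _ (measurableC mB) mB) _.
  by rewrite -[leRHS]add0e; apply: leeD => //; rewrite [leLHS](_ : _ = 0%E).
by rewrite leNgt pi_gt0.
Qed.

Lemma harnack_intervals I x y : irr_comp mu nu I -> I x -> I y -> exists a b a' b' : rat,
  [/\ ratr a < x < ratr b, ratr a' < y < ratr b' &
      harnack mu nu `](ratr a), (ratr b)[%classic `](ratr a'), (ratr b')[%classic].
Proof.
move=> cI Ix Iy.
have nbhd z : I z -> exists a b : rat, ratr a < z < ratr b /\ exists2 W,
    harnack mu nu W W & W z /\ `](ratr a), (ratr b)[%classic `<=` W.
  move=> Iz; have Uz : U z by exact: component_sub cI _ Iz.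
  have [delta d0 hz] := harnack_local mu1 nu1 cmn Uz.
  have /rat_in_itvoo[a] : z - delta < z by lra.
  have /rat_in_itvoo[b] : z < z + delta by lra.
  rewrite !in_itv /= => /andP[zb bd] /andP[da az]; exists a, b; split; first by rewrite az zb.
  exists (ball z delta) => //; split; first exact: ballxx.
  by move=> u; rewrite /= in_itv /= /ball /= ltr_norml; lra.
have [a [b [xab [W hW [Wx abW]]]]] := nbhd x Ix.
have [a' [b' [yab [W' hW' [Wy abW']]]]] := nbhd y Iy.
exists a, b, a', b'; split => //.
apply: (@harnack_trans _ _ _ _ [set x] _ x) => //.
  by apply: harnack_sub hW => // _ ->.
apply: (@harnack_trans _ _ _ _ [set y] _ y) => //.
  exact: (harnack_component mu1 nu1 cmn cI).
by apply: harnack_sub hW' => // _ ->.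
Qed.

Lemma harnack_interval_end I x w e : irr_comp mu nu I -> I x -> is_end I w e ->
  (0 < irr_nu mu nu I [set e])%E -> exists a b : rat,
  ratr a < x < ratr b /\ harnack mu nu `](ratr a), (ratr b)[%classic [set e].
Proof.
move=> cI Ix eI nu_e; have [c Ic hc] := harnack_end mu1 nu1 cmn cI eI nu_e.
have [a [b [a' [b' [xab cab h]]]]] := harnack_intervals cI Ix Ic.
exists a, b; split => //; apply: (@harnack_trans _ _ _ _ [set c] _ c) => //.
by apply: harnack_sub h => // _ ->; rewrite /= in_itv.
Qed.

Lemma diagonal_null (B : set (X * X)) : measurable B -> polar mu nu B ->
  mu.-negligible [set x | ~ U x /\ B (x, x)].
Proof.
move=> mB polB; have [P mP] := martingale_exists mu1 nu1 cmn.
have [P' [P'E cP]] := martingale_centered mu1 nu1 mP; have [Pmu _ _] := mP.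
have mU : measurable (U : set X) := measurable_gap mu1 nu1.
have mD : measurable ([set x | ~ U x /\ B (x, x)] : set X).
  apply: (measurableI (~` U)); first exact: measurableC.
  have mdiag : measurable_fun setT (fun x : X => (x, x)).
    by apply: measurable_fun_pair; exact: measurable_id.
  by rewrite -[X in measurable X]setTI; exact: mdiag.
set D := [set x | _] in mD *.
apply/negligibleP => //; rewrite -[LHS](Pmu D mD) /pushforward -setXT.
suff : P.-negligible (D `*` setT) by move=> /negligibleP; apply; exact: measurableX.
have cr0 : P.-negligible (crossings mu nu).
  have [N [mN N0 crN]] := crossings_null mu1 nu1 cmn cP.
  by exists N; split => //; rewrite -P'E.
apply: negligibleS (negligibleU cr0 (polB P mP)) => -[x y] [[/= nUx Bxx] _].
have [cr|ncr] := pselect (crossings mu nu (x, y)); [by left|right].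
have [<-//|xy] := eqVneq x y.
by have [I [cI Ix _]] := uncrossed mu1 nu1 ncr xy; case: nUx; exact: component_sub cI _ Ix.
Qed.

Lemma cover_of_polar (B : set (X * X)) : measurable B -> polar mu nu B ->
  exists Nmu Nnu, [/\ mu.-negligible Nmu, nu.-negligible Nnu &
    B `<=` (Nmu `*` setT) `|` (setT `*` Nnu) `|`
      ~` (diagonal `|` \bigcup_(I in irr_comp mu nu) (I `*` irr_J mu nu I))].
Proof.
move=> mB polB.
pose comp (q : rat) := connected_component U (ratr q).
pose left_piece (p : rat * rat) : set X := `](ratr p.1), (ratr p.2)[%classic.
pose right_piece (p : (rat * rat) + (rat * bool)) : set X := match p with
  | inl p => `](ratr p.1), (ratr p.2)[%classic
  | inr p => [set if p.2 then sup (comp p.1) else inf (comp p.1)] end.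
have /choice[MN MNP] p : exists MN : set X * set X,
    [/\ mu.-negligible MN.1, nu.-negligible MN.2 &
     harnack mu nu (left_piece p.1) (right_piece p.2) ->
     covers MN.1 MN.2 (B `&` (left_piece p.1 `*` right_piece p.2))].
  have [h|nh] := pselect (harnack mu nu (left_piece p.1) (right_piece p.2)); last first.
    by exists (set0, set0); split => //; exact: negligible_set0.
  have mR : measurable (right_piece p.2) by case: (p.2) => q; [exact: measurable_itv|exact: measurable_set1].
  have mpiece : measurable (B `&` (left_piece p.1 `*` right_piece p.2)).
    by apply: measurableI => //; apply: measurableX => //; exact: measurable_itv.
  have [|||M [N [M0 N0 c]]] := @cover_of_polar_piece (left_piece p.1) (right_piece p.2) _ _ mR mpiece _ h.
  - exact: measurable_itv.
  - by move=> z [].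
  - by move=> P mP; apply: negligibleS (polB P mP) => z [].
  by exists (M, N).
exists ([set x | ~ U x /\ B (x, x)] `|` \bigcup_p (MN p).1), (\bigcup_p (MN p).2); split.
- apply: negligibleU; first exact: diagonal_null.
  by apply: negligible_bigcup_countable => p; have [] := MNP p.
- by apply: negligible_bigcup_countable => p; have [] := MNP p.
have piece p z : B z -> left_piece p.1 z.1 -> right_piece p.2 z.2 ->
    harnack mu nu (left_piece p.1) (right_piece p.2) ->
    (([set x | ~ U x /\ B (x, x)] `|` \bigcup_p (MN p).1) `*` setT `|`
      setT `*` \bigcup_p (MN p).2) z.
  move=> Bz lz rz h; have [_ _ /(_ h z)] := MNP p.
  move=> /(_ (conj Bz (conj lz rz)))[Mz|Nz]; [left|right]; split => //; last by exists p.
  by right; exists p.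
have inner I x y : irr_comp mu nu I -> I x -> I y -> B (x, y) ->
    (([set x | ~ U x /\ B (x, x)] `|` \bigcup_p (MN p).1) `*` setT `|`
      setT `*` \bigcup_p (MN p).2) (x, y).
  move=> cI Ix Iy Bxy; have [a [b [a' [b' [xab yab h]]]]] := harnack_intervals cI Ix Iy.
  by apply: (piece ((a, b), inl (a', b')) (x, y) Bxy _ _ h); rewrite /left_piece /right_piece /= in_itv.
move=> [x y] Bxy; have [dz|ndz] := pselect ((diagonal `|`
  \bigcup_(I in irr_comp mu nu) (I `*` irr_J mu nu I)) (x, y)); [left|by right].
case: dz => [xy|[I cI [/= Ix Jy]]].
  rewrite /diagonal /= in xy; move: Bxy; rewrite -xy => Bxx.
  have [Ux|nUx] := pselect (U x); last by left; split => //; left.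
  have cI : irr_comp mu nu (connected_component U x) by exists x.
  by apply: (inner _ _ _ cI) => //; exact: connected_component_refl.
case: Jy => [Iy|[ey nu_y]]; first exact: (inner I).
have [w ew] := endpoints_is_end ey.
have [a [b [xab h]]] := harnack_interval_end cI Ix ew nu_y.
have [q Iq] := component_rat oU cI.
have IE : I = comp q := component_mem cI Iq.
have [d yd] : exists d : bool, y = if d then sup (comp q) else inf (comp q).
  by rewrite -IE; case: ew => [[_ [_ ->]]|[_ [_ ->]]]; [exists true|exists false].
have rE : right_piece (inr (q, d)) = [set y] by rewrite /right_piece /= -yd.
apply: (piece ((a, b), inr (q, d)) (x, y) Bxy); last by rewrite rE.
  by rewrite /left_piece /= in_itv.
by rewrite rE.
Qed.

End main.

Local Open Scope ereal_scope.

Theorem theorem3p2 (R : realType)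
    (mu nu : {finite_measure set (measurableTypeR R) -> \bar R})
    (B : set (measurableTypeR R * measurableTypeR R)) :
  finite_first_moment mu ->
  finite_first_moment nu ->
  convex_order mu nu ->
  measurable B ->
  polar mu nu B <->
  exists (Nmu Nnu : set (measurableTypeR R)),
    [/\ mu.-negligible Nmu,
        nu.-negligible Nnu &
        B `<=` (Nmu `*` [set: R]) `|` ([set: R] `*` Nnu) `|`
               ~` (diagonal `|`
                   \bigcup_(I in irr_comp mu nu) (I `*` irr_J mu nu I))].
Proof.
move=> mu1 nu1 cmn mB; split; first exact: cover_of_polar.
by move=> [Nmu [Nnu [M0 N0 BN]]]; exact: polar_of_cover BN.
Qed.
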